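(* Let $k$ be an algebraically closed field of arbitrary characteristic and let $A = k[[x,y,z]]/(x^2y-z^2)$. Then the indecomposable non-free Cohen-Macaulay $A$-modules are (up to isomorphism) given by the following matrix factorizations of $x^2y-z^2$: (1) $M(\alpha^+,\alpha^-)$, where $$\alpha^+=\begin{pmatrix} z & xy\\ x & z\end{pmatrix},\quad \alpha^-=\begin{pmatrix} -z & xy\\ x & -z\end{pmatrix};$$ moreover $M(\alpha^+,\alpha^-)\cong M(\alpha^-,\alpha^+)\cong R$, where $R$ is the normalization of $A$. (2) $M(\beta^+,\beta^-)$, where $$\beta^+=\begin{pmatrix} x^2 & z\\ z& y\end{pmatrix},\quad \beta^-=\begin{pmatrix} y & -z\\ -z& x^2\end{pmatrix}.$$ (3) $M(\gamma_m^+,\gamma_m^-)$ for $m\ge 1$, where $$\gamma_m^+=\begin{pmatrix} z & xy & 0 & -y^{m+1}\\ x & z & y^m & 0\\ 0&0&z&xy\\ 0&0&x&z\end{pmatrix},\quad \gamma_m^-=\begin{pmatrix} -z & xy & 0 & -y^{m+1}\\ x & -z & y^m & 0\\ 0&0&-z&xy\\ 0&0&x&-z\end{pmatrix}.$$ (4) $M(\delta_m^+,\delta_m^-)$ for $m\ge 1$, where $$\delta_m^+=\begin{pmatrix} z & xy & -y^{m} & 0\\ x & z & 0& y^m\\ 0&0&z&xy\\ 0&0&x&z\end{pmatrix},\quad \delta_m^-=\begin{pmatrix} -z & xy & -y^{m} & 0\\ x & -z & 0 & y^m\\ 0&0&-z&xy\\ 0&0&x&-z\end{pmatrix}.$$ That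 is, each of these modules is an indecomposable non-free Cohen-Macaulay $A$-module, and every indecomposable non-free Cohen-Macaulay $A$-module is isomorphic to one of them. In all four cases $M(\phi,\psi)\cong M(\psi,\phi)$. Moreover, the indecomposable modules of types (2), (3) and (4) are locally free on the punctured spectrum of $A$.
   Context: A finitely generated module $M$ over a Noetherian local ring $A$ is called Cohen-Macaulay (short for maximal Cohen-Macaulay) if $\mathrm{depth}(M)$ equals the Krull dimension of $A$. A finitely generated module $M$ over a local ring $(A,\mathfrak m)$ is locally free on the punctured spectrum if $M_{\mathfrak p}$ is a free $A_{\mathfrak p}$-module for every prime ideal $\mathfrak p\neq\mathfrak m$. For $S=k[[x,y,z]]$, $f\in S$ and $A=S/(f)$, a matrix factorization of $f$ is a pair $(\alpha,\beta)$ of $n\times n$ matrices over $S$ with $\alpha\beta=\beta\alpha=f\cdot I_n$. The corresponding $A$-module is $M(\alpha,\beta)=\mathrm{coker}(\alpha: S^n\to S^n)$, equivalently the cokernel of $\bar\alpha: A^n\to A^n$. *)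

(* Defs.v *)
From HB Require Import structures.
From mathcomp Require Import all_boot all_algebra.
From mathcomp Require Import ring boolp.

Set Implicit Arguments.
Unset Strict Implicit.
Unset Printing Implicit Defensive.

Import GRing.Theory.
Local Open Scope ring_scope.
Local Open Scope quotient_scope.

(* R[[T]]: [f n] is the coefficient of T^n. *)
Definition powser (R : comNzRingType) : Type := nat -> R.

Section PowerSeries.
Variable R : comNzRingType.
Implicit Types f g h : powser R.

HB.instance Definition _ := gen_eqMixin (powser R).
HB.instance Definition _ := gen_choiceMixin (powser R).

Definition ps_const (c : R) : powser R := fun n => if n == 0%N then c else 0.
Definition ps_var : powser R := fun n => (n == 1%N)%:R.
Definition ps_add f g : powser R := fun n => f n + g n.
Definition ps_opp f : powser R := fun n => - f n.
Definition ps_mul f g : powser R := fun n => \sum_(i < n.+1) f i * g (n - i)%N.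

Fact ps_addA : associative ps_add.
Proof. by move=> f g h; apply/funext => n; rewrite /ps_add addrA. Qed.
Fact ps_addC : commutative ps_add.
Proof. by move=> f g; apply/funext => n; rewrite /ps_add addrC. Qed.
Fact ps_add0 : left_id (ps_const 0) ps_add.
Proof.
by move=> f; apply/funext => n; rewrite /ps_add /ps_const; case: eqP; rewrite add0r.
Qed.
Fact ps_addN : left_inverse (ps_const 0) ps_opp ps_add.
Proof.
move=> f; apply/funext => n.
by rewrite /ps_add /ps_opp /ps_const addNr; case: eqP.
Qed.

HB.instance Definition _ :=
  GRing.isZmodule.Build (powser R) ps_addA ps_addC ps_add0 ps_addN.

Let trunc (N : nat) f : {poly R} := \poly_(i < N) f i.

Let coef_mul_trunc N f g n : (n < N)%N -> (trunc N f * trunc N g)`_n = ps_mul f g n.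
Proof.
move=> ltnN; rewrite coefM; apply: eq_bigr => i _; rewrite !coef_poly.
rewrite (leq_ltn_trans _ ltnN) ?leq_ord //.
by rewrite (leq_ltn_trans _ ltnN) ?leq_subr.
Qed.

Fact ps_mulC : commutative ps_mul.
Proof.
move=> f g; apply/funext => n.
by rewrite -!(@coef_mul_trunc n.+1) // mulrC.
Qed.

Fact ps_mulA : associative ps_mul.
Proof.
move=> f g h; apply/funext => n.
transitivity ((trunc n.+1 f * (trunc n.+1 g * trunc n.+1 h))`_n).
  rewrite coefM; apply: eq_bigr => i _.
  by rewrite coef_poly ltn_ord coef_mul_trunc // ltnS leq_subr.
rewrite mulrA coefM; apply: eq_bigr => i _.
by rewrite coef_mul_trunc // coef_poly ltnS leq_subr.
Qed.

Fact ps_mul1 : left_id (ps_const 1) ps_mul.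
Proof.
move=> f; apply/funext => n; rewrite /ps_mul big_ord_recl /= subn0 mul1r.
by rewrite big1 ?addr0 // => i _; rewrite /ps_const /= mul0r.
Qed.

Fact ps_mulDl : left_distributive ps_mul ps_add.
Proof.
move=> f g h; apply/funext => n; rewrite /ps_mul /ps_add -big_split /=.
by apply: eq_bigr => i _; rewrite mulrDl.
Qed.

Fact ps_1neq0 : ps_const 1 != ps_const 0.
Proof. by apply/eqP => /(congr1 (fun f => f 0%N)) /eqP; rewrite oner_eq0. Qed.

HB.instance Definition _ := GRing.Zmodule_isComNzRing.Build (powser R)
  ps_mulA ps_mulC ps_mul1 ps_mulDl ps_1neq0.

Lemma coef0_ps_mul f g : (f * g) 0%N = f 0%N * g 0%N.
Proof. by transitivity (ps_mul f g 0%N); rewrite // /ps_mul big_ord1. Qed.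

Lemma coef_ps_sub f g n : (f - g) n = f n - g n.
Proof. by []. Qed.

End PowerSeries.

Arguments ps_var {R}.

(* k[[x,y,z]], taken as k[[x]][[y]][[z]]: the coefficient of x^a y^b z^c in [f]
   is [f c b a]. *)
Definition powser3 (k : comNzRingType) : comNzRingType :=
  powser (powser (powser k)).
Definition serX (k : comNzRingType) : powser3 k := ps_const (ps_const ps_var).
Definition serY (k : comNzRingType) : powser3 k := ps_const ps_var.
Definition serZ (k : comNzRingType) : powser3 k := ps_var.

Section Modules.
Variable A : comNzRingType.

Definition mod_iso (M N : lmodType A) : Prop :=
  exists f : {linear M -> N}, bijective f.

Definition fin_gen (M : lmodType A) : Prop :=
  exists (n : nat) (e : 'I_n -> M),
    forall x, exists c : 'I_n -> A, x = \sum_(i < n) c i *: e i.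

(* Free of finite rank; all modules considered are finitely generated. *)
Definition free_mod (M : lmodType A) : Prop := exists n : nat, mod_iso M 'cV[A]_n.

Definition indecomposable (M : lmodType A) : Prop :=
  (exists x : M, x != 0) /\
  forall M1 M2 : lmodType A, mod_iso M (M1 * M2)%type ->
    (forall x : M1, x = 0) \/ (forall x : M2, x = 0).

(* The set of non-units: the maximal ideal, when A is local. *)
Definition max_ideal (a : A) : Prop := ~ exists b, a * b = 1.

(* p 0 < p 1 < ... < p d *)
Definition prime_chain (p : nat -> prime_idealr A) (d : nat) : Prop :=
  forall i, (i < d)%N ->
    {subset p i <= p i.+1} /\ exists2 a, a \in p i.+1 & a \notin p i.

Definition krull_dim_is (d : nat) : Prop :=
  (exists p, prime_chain p d) /\ (forall p e, prime_chain p e -> (e <= d)%N).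

(* x belongs to (s_0, ..., s_r) M *)
Definition in_ideal_mul (M : lmodType A) (s : seq A) (x : M) : Prop :=
  exists y : nat -> M, x = \sum_(i < size s) s`_i *: y i.

(* s_i acts injectively on M / (s_0, ..., s_(i-1)) M, and M / sM is nonzero. *)
Definition regular_seq (M : lmodType A) (s : seq A) : Prop :=
  (forall i, (i < size s)%N -> forall x : M,
     in_ideal_mul (take i s) (s`_i *: x) -> in_ideal_mul (take i s) x) /\
  (exists x : M, ~ in_ideal_mul s x).

Definition depth_is (M : lmodType A) (d : nat) : Prop :=
  let reg_in_max s := regular_seq M s /\ (forall a, a \in s -> max_ideal a) in
  (exists s, reg_in_max s /\ size s = d) /\
  (forall s, reg_in_max s -> (size s <= d)%N).

Definition cohen_macaulay (M : lmodType A) : Prop :=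
  fin_gen M /\ exists d : nat, depth_is M d /\ krull_dim_is d.

End Modules.

Record mult_set (A : comNzRingType) := MultSet {
  denom :> pred A;
  denom1 : denom 1;
  denomM : forall a b, denom a -> denom b -> denom (a * b);
  denom0 : ~~ denom 0
}.

Section Localization.
Variables (A : comNzRingType) (S : mult_set A).

Section LocalizedModule.
Variable M : lmodType A.

Definition prefrac : Type := (M * {s : A | S s})%type.
HB.instance Definition _ := Choice.on prefrac.

(* x1 / s1 = x2 / s2 iff u (s2 x1 - s1 x2) = 0 for some u in S *)
Definition frac_eq (p q : prefrac) : bool :=
  `[< exists2 u, S u & u *: (sval q.2 *: p.1) = u *: (sval p.2 *: q.1) >].

Fact frac_eq_refl : reflexive frac_eq.
Proof. by move=> p; apply/asboolP; exists 1; rewrite ?denom1. Qed.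
Fact frac_eq_sym : symmetric frac_eq.
Proof.
by move=> p q; apply/asboolP/asboolP => -[u Su e]; exists u; rewrite ?e.
Qed.
Fact frac_eq_trans : transitive frac_eq.
Proof.
move=> q p r /asboolP[u Su eu] /asboolP[v Sv ev]; apply/asboolP.
exists (u * v * sval q.2); first by rewrite !denomM // (valP q.2).
rewrite !scalerA in eu ev *.
rewrite (_ : _ * sval r.2 = v * sval r.2 * (u * sval q.2)); last by ring.
rewrite -scalerA eu scalerA.
rewrite (_ : _ * (u * sval p.2) = u * sval p.2 * (v * sval r.2)); last by ring.
by rewrite -scalerA ev scalerA; congr (_ *: _); ring.
Qed.

Canonical frac_equiv := EquivRel frac_eq frac_eq_refl frac_eq_sym frac_eq_trans.

Definition loc_mod : Type := {eq_quot frac_equiv}.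
HB.instance Definition _ := Choice.on loc_mod.
HB.instance Definition _ := EqQuotient.on loc_mod.

Definition mkfrac (x : M) (s : {s : A | S s}) : loc_mod := \pi_loc_mod (x, s).

Lemma mkfracP x s y t :
  (mkfrac x s = mkfrac y t) <->
  exists2 u, S u & u *: (sval t *: x) = u *: (sval s *: y).
Proof.
split; first by move/eqP; rewrite /mkfrac eqmodE => /asboolP.
by move=> H; apply/eqP; rewrite /mkfrac eqmodE; apply/asboolP.
Qed.

Lemma mkfrac_ind (P : loc_mod -> Prop) :
  (forall x s, P (mkfrac x s)) -> forall q, P q.
Proof. by move=> H; elim/quotP => -[x s] _; apply: H. Qed.

Lemma mkfrac_repr q : mkfrac (repr q).1 (repr q).2 = q.
Proof. by rewrite /mkfrac -surjective_pairing reprK. Qed.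

Lemma repr_mkfrac x s : exists2 u, S u &
  u *: (sval s *: (repr (mkfrac x s)).1) = u *: (sval (repr (mkfrac x s)).2 *: x).
Proof. by apply/mkfracP; rewrite mkfrac_repr. Qed.

End LocalizedModule.

Definition den_one : {s : A | S s} := exist _ 1 (denom1 S).
Definition den_mul (s t : {s : A | S s}) : {s : A | S s} :=
  exist _ (sval s * sval t) (denomM (valP s) (valP t)).

Section LocalizedZmodule.
Variable M : lmodType A.
Implicit Types q r : loc_mod M.

Definition loc_zero : loc_mod M := mkfrac 0 den_one.
Definition loc_opp q : loc_mod M := mkfrac (- (repr q).1) (repr q).2.
Definition loc_add q r : loc_mod M :=
  mkfrac (sval (repr r).2 *: (repr q).1 + sval (repr q).2 *: (repr r).1)
         (den_mul (repr q).2 (repr r).2).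

Lemma loc_oppE x s : loc_opp (mkfrac x s) = mkfrac (- x) s.
Proof.
have [u Su e] := repr_mkfrac x s.
by apply/mkfracP; exists u => //; rewrite !scalerN e.
Qed.

Lemma loc_addE x s y t : loc_add (mkfrac x s) (mkfrac y t) =
  mkfrac (sval t *: x + sval s *: y) (den_mul s t).
Proof.
have [u Su eu] := repr_mkfrac x s; have [v Sv ev] := repr_mkfrac y t.
rewrite /loc_add; case: (repr (mkfrac x s)) eu => x' s' /= eu.
case: (repr (mkfrac y t)) ev => y' t' /= ev.
apply/mkfracP; exists (u * v); first exact: denomM.
rewrite /= !scalerDr !scalerA in eu ev *; congr (_ + _).
  rewrite (_ : _ * sval t' = v * sval t * sval t' * (u * sval s)); last by ring.
  by rewrite -scalerA eu scalerA; congr (_ *: _); ring.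
rewrite (_ : _ * sval s' = u * sval s * sval s' * (v * sval t)); last by ring.
by rewrite -scalerA ev scalerA; congr (_ *: _); ring.
Qed.

Lemma mkfrac_eq x s y t : sval t *: x = sval s *: y -> mkfrac x s = mkfrac y t :> loc_mod M.
Proof. by move=> e; apply/mkfracP; exists 1; rewrite ?denom1 ?e. Qed.

Fact loc_addA : associative loc_add.
Proof.
elim/mkfrac_ind=> x s; elim/mkfrac_ind=> y t; elim/mkfrac_ind=> z u.
rewrite !loc_addE; apply: mkfrac_eq.
by rewrite /= !scalerDr !scalerA addrA; congr (_ *: _ + _ *: _ + _ *: _); ring.
Qed.
Fact loc_addC : commutative loc_add.
Proof.
elim/mkfrac_ind=> x s; elim/mkfrac_ind=> y t; rewrite !loc_addE addrC.
by apply: mkfrac_eq; rewrite /= mulrC.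
Qed.
Fact loc_add0 : left_id loc_zero loc_add.
Proof.
elim/mkfrac_ind=> x s; rewrite /loc_zero loc_addE; apply: mkfrac_eq.
by rewrite /= scaler0 add0r scale1r mul1r.
Qed.
Fact loc_addN : left_inverse loc_zero loc_opp loc_add.
Proof.
elim/mkfrac_ind=> x s; rewrite loc_oppE loc_addE; apply: mkfrac_eq.
by rewrite /= scalerN addNr !scaler0.
Qed.

HB.instance Definition _ :=
  GRing.isZmodule.Build (loc_mod M) loc_addA loc_addC loc_add0 loc_addN.

Lemma addfrac x s y t : mkfrac x s + mkfrac y t =
  mkfrac (sval t *: x + sval s *: y) (den_mul s t) :> loc_mod M.
Proof. exact: loc_addE. Qed.

(* (a / s) (x / t) = (a x) / (s t) *)
Definition loc_scale (a : loc_mod A^o) q : loc_mod M :=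
  mkfrac (((repr a).1 : A) *: (repr q).1) (den_mul (repr a).2 (repr q).2).

Lemma loc_scaleE (a : A) s x t :
  loc_scale (mkfrac (a : A^o) s) (mkfrac x t) = mkfrac (a *: x) (den_mul s t).
Proof.
have [u Su eu] := repr_mkfrac (a : A^o) s; have [v Sv ev] := repr_mkfrac x t.
rewrite /loc_scale; case: (repr (mkfrac (a : A^o) s)) eu => a' s' /= eu.
case: (repr (mkfrac x t)) ev => x' t' /= ev.
apply/mkfracP; exists (u * v); first exact: denomM.
rewrite /= !scalerA in eu ev *.
have {}eu : u * sval s * a' = u * sval s' * a by exact: eu.
rewrite (_ : _ * a' = u * sval s * a' * (v * sval t)); last by ring.
by rewrite eu -scalerA ev scalerA; congr (_ *: _); ring.
Qed.

End LocalizedZmodule.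

(* The ring of fractions S^-1 A. *)
Definition loc_ring : Type := loc_mod A^o.
HB.instance Definition _ := GRing.Zmodule.on loc_ring.

Definition loc_mul : loc_ring -> loc_ring -> loc_ring := @loc_scale A^o.
Definition loc_of (a : A) : loc_ring := mkfrac (a : A^o) den_one.
Definition loc_one : loc_ring := loc_of 1.

Lemma loc_mulE (a b : A) s t :
  loc_mul (mkfrac (a : A^o) s) (mkfrac (b : A^o) t) =
  mkfrac (a * b : A^o) (den_mul s t).
Proof. exact: loc_scaleE. Qed.

Lemma loc_addrE (a b : A) s t :
  mkfrac (a : A^o) s + mkfrac (b : A^o) t =
  mkfrac (sval t * a + sval s * b : A^o) (den_mul s t) :> loc_ring.
Proof. exact: loc_addE. Qed.

Lemma mkfracr_eq (a b : A) s t :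
  sval t * a = sval s * b -> mkfrac (a : A^o) s = mkfrac (b : A^o) t :> loc_ring.
Proof. by move=> e; apply: (@mkfrac_eq A^o); rewrite /GRing.scale /= e. Qed.

Section ScaleTheory.
Variable M : lmodType A.
Implicit Types q r : loc_mod M.

Lemma loc_scaleA (a b : loc_ring) q :
  loc_scale a (loc_scale b q) = loc_scale (loc_mul a b) q.
Proof.
move: a b q; elim/mkfrac_ind=> a s; elim/mkfrac_ind=> b t; elim/mkfrac_ind=> x u.
rewrite loc_mulE (loc_scaleE b t x u) (loc_scaleE a s) loc_scaleE; apply: mkfrac_eq.
by rewrite /= !scalerA; congr (_ *: _); ring.
Qed.
Lemma loc_scale1 : left_id loc_one (@loc_scale M).
Proof.
elim/mkfrac_ind=> x t; rewrite loc_scaleE; apply: mkfrac_eq.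
by rewrite /= scale1r mul1r.
Qed.
Lemma loc_scaleDr : right_distributive (@loc_scale M) +%R.
Proof.
elim/mkfrac_ind=> a s; elim/mkfrac_ind=> x t; elim/mkfrac_ind=> y u.
rewrite addfrac !loc_scaleE addfrac; apply: mkfrac_eq.
by rewrite /= !(scalerDr, scalerA); congr (_ *: _ + _ *: _); ring.
Qed.
Lemma loc_scaleDl q : {morph (@loc_scale M)^~ q : a b / a + b}.
Proof.
move=> a b; move: a b q.
elim/mkfrac_ind=> a s; elim/mkfrac_ind=> b t; elim/mkfrac_ind=> x u.
rewrite loc_addrE !loc_scaleE addfrac; apply: mkfrac_eq.
by rewrite /= !(scalerDr, scalerDl, scalerA); congr (_ *: _ + _ *: _); ring.
Qed.
End ScaleTheory.

Fact loc_mulC : commutative loc_mul.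
Proof.
elim/mkfrac_ind=> a s; elim/mkfrac_ind=> b t.
rewrite !loc_mulE; apply: mkfracr_eq.
by rewrite /=; ring.
Qed.
Fact loc_1neq0 : loc_one != 0.
Proof.
apply/eqP => /mkfracP[u Su]; rewrite /= scaler0 scaler0 scale1r.
have -> : u *: (1 : A^o) = u by rewrite /GRing.scale /= mulr1.
by move=> u0; move: Su; rewrite u0; apply/negP/denom0.
Qed.
Fact loc_mulA : associative loc_mul. Proof. exact: loc_scaleA. Qed.
Fact loc_mul1 : left_id loc_one loc_mul. Proof. exact: loc_scale1. Qed.
Fact loc_mulDl : left_distributive loc_mul +%R.
Proof. by move=> a b c; apply: loc_scaleDl. Qed.

HB.instance Definition _ := GRing.Zmodule_isComNzRing.Build loc_ring
  loc_mulA loc_mulC loc_mul1 loc_mulDl loc_1neq0.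

HB.instance Definition _ (M : lmodType A) :=
  GRing.Zmodule_isLmodule.Build loc_ring (loc_mod M)
    (@loc_scaleA M) (@loc_scale1 M) (@loc_scaleDr M) (@loc_scaleDl M).

Fact loc_of_zmod_morphism : zmod_morphism loc_of.
Proof.
move=> a b; apply/esym; rewrite /loc_of.
rewrite (_ : - mkfrac (b : A^o) den_one = mkfrac (- b : A^o) den_one); last exact: loc_oppE.
by rewrite loc_addrE; apply: mkfracr_eq; rewrite /=; ring.
Qed.
Fact loc_of_monoid_morphism : monoid_morphism loc_of.
Proof.
split=> // a b; apply/esym; rewrite [LHS]loc_mulE; apply: mkfracr_eq.
by rewrite /=; ring.
Qed.
HB.instance Definition _ :=
  GRing.isZmodMorphism.Build A loc_ring loc_of loc_of_zmod_morphism.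
HB.instance Definition _ :=
  GRing.isMonoidMorphism.Build A loc_ring loc_of loc_of_monoid_morphism.

End Localization.

Section PrimeLocalization.
Variables (A : comNzRingType) (p : prime_idealr A).

Fact prime_compl1 : [predC p] 1.
Proof. by rewrite /= idealr1. Qed.
Fact prime_complM a b : [predC p] a -> [predC p] b -> [predC p] (a * b).
Proof. by rewrite /= prime_idealrM negb_or => -> ->. Qed.
Fact prime_compl0 : ~~ [predC p] 0.
Proof. by rewrite /= negbK rpred0. Qed.

Definition prime_compl : mult_set A :=
  MultSet prime_compl1 prime_complM prime_compl0.

End PrimeLocalization.

Definition locally_free_punctured (A : comNzRingType) (M : lmodType A) : Prop :=
  forall p : prime_idealr A, ~ (forall a : A, a \in p <-> max_ideal a) ->
    @free_mod (loc_ring (prime_compl p)) (loc_mod (prime_compl p) M).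

Section Normalization.
Variable A : comNzRingType.

Definition nonzerodiv : pred A := fun a => `[< forall b : A, a * b = 0 -> b = 0 >].

Fact nonzerodiv1 : nonzerodiv 1.
Proof. by apply/asboolP => b; rewrite mul1r. Qed.
Fact nonzerodivM a b : nonzerodiv a -> nonzerodiv b -> nonzerodiv (a * b).
Proof.
by move=> /asboolP ra /asboolP rb; apply/asboolP => c; rewrite -mulrA => /ra/rb.
Qed.
Fact nonzerodiv0 : ~~ nonzerodiv 0.
Proof.
by apply/asboolP => /(_ 1); rewrite mul0r => /(_ erefl)/eqP; rewrite oner_eq0.
Qed.

Definition total_frac : comNzRingType :=
  loc_ring (MultSet nonzerodiv1 nonzerodivM nonzerodiv0).

Definition to_frac : {rmorphism A -> total_frac} := @loc_of A _.

Definition int_closure : pred total_frac := fun q => `[< integralOver to_frac q >].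

Fact int_closure_subring : subring_closed int_closure.
Proof.
split=> [|a b|a b]; first by apply/asboolP; apply: integral1.
- by move=> /asboolP ia /asboolP ib; apply/asboolP; apply: integral_sub.
- by move=> /asboolP ia /asboolP ib; apply/asboolP; apply: integral_mul.
Qed.
HB.instance Definition _ :=
  GRing.isSubringClosed.Build total_frac int_closure int_closure_subring.

(* The integral closure of A in its total ring of fractions. *)
Definition normalization : Type := {q : total_frac | int_closure q}.
HB.instance Definition _ := SubChoice.on normalization.
HB.instance Definition _ := [SubChoice_isSubComNzRing of normalization by <:].

Fact to_frac_int a : int_closure (to_frac a).
Proof. by apply/asboolP; apply: integral_id. Qed.

Definition to_norm (a : A) : normalization := exist _ (to_frac a) (to_frac_int a).

Definition norm_scale (a : A) (r : normalization) : normalization := to_norm a * r.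

Fact norm_scaleA a b r : norm_scale a (norm_scale b r) = norm_scale (a * b) r.
Proof. by apply: val_inj; rewrite !rmorphM /= rmorphM mulrA. Qed.
Fact norm_scale1 : left_id 1 norm_scale.
Proof. by move=> r; apply: val_inj; rewrite rmorphM /= rmorph1 mul1r. Qed.
Fact norm_scaleDr : right_distributive norm_scale +%R.
Proof. by move=> a r s; apply: mulrDr. Qed.
Fact norm_scaleDl r : {morph norm_scale^~ r : a b / a + b}.
Proof. by move=> a b; apply: val_inj; rewrite !(rmorphM, rmorphD) /= rmorphD mulrDl. Qed.

HB.instance Definition _ := GRing.Zmodule_isLmodule.Build A normalization
  norm_scaleA norm_scale1 norm_scaleDr norm_scaleDl.

End Normalization.

Section Cokernel.
Variables (A : comNzRingType) (n : nat) (phi : 'M[A]_n).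

Definition im_mx : pred 'cV[A]_n := fun w => `[< exists v : 'cV[A]_n, w = phi *m v >].

Fact im_mx_zmod_closed : zmod_closed im_mx.
Proof.
split; first by apply/asboolP; exists 0; rewrite mulmx0.
by move=> _ _ /asboolP[v ->] /asboolP[w ->]; apply/asboolP; exists (v - w); rewrite mulmxBr.
Qed.
HB.instance Definition _ := GRing.isZmodClosed.Build 'cV[A]_n im_mx im_mx_zmod_closed.

Definition im_zmod : zmodClosed 'cV[A]_n := GRing.ZmodClosed.clone _ im_mx _.

Definition coker : Type := {ideal_quot im_zmod}.
HB.instance Definition _ := GRing.Zmodule.on coker.

Definition to_coker (v : 'cV[A]_n) : coker := \pi_{ideal_quot im_zmod} v.

Lemma to_cokerP v w : to_coker v = to_coker w <-> exists u, v - w = phi *m u.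
Proof.
split=> [/eqP | vw]; first by rewrite -Quotient.idealrBE => /asboolP.
by apply/eqP; rewrite -Quotient.idealrBE; apply/asboolP.
Qed.

Lemma to_cokerD v w : to_coker (v + w) = to_coker v + to_coker w.
Proof. exact: raddfD. Qed.

Lemma coker_ind (P : coker -> Prop) : (forall v, P (to_coker v)) -> forall q, P q.
Proof. by move=> Pv; elim/quotP => v _; apply: Pv. Qed.

Definition coker_scale (a : A) (q : coker) : coker := to_coker (a *: repr q).

Lemma coker_scaleE a v : coker_scale a (to_coker v) = to_coker (a *: v).
Proof.
have /to_cokerP[u e] : to_coker (repr (to_coker v)) = to_coker v by apply: reprK.
by apply/to_cokerP; exists (a *: u); rewrite -scalerBr e scalemxAr.
Qed.

Fact coker_scaleA a b q : coker_scale a (coker_scale b q) = coker_scale (a * b) q.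
Proof. by elim/coker_ind: q => v; rewrite !coker_scaleE scalerA. Qed.
Fact coker_scale1 : left_id 1 coker_scale.
Proof. by elim/coker_ind => v; rewrite coker_scaleE scale1r. Qed.
Fact coker_scaleDr : right_distributive coker_scale +%R.
Proof.
move=> a; elim/coker_ind => v; elim/coker_ind => w.
by rewrite -to_cokerD !coker_scaleE scalerDr to_cokerD.
Qed.
Fact coker_scaleDl q : {morph coker_scale^~ q : a b / a + b}.
Proof.
by elim/coker_ind: q => v a b; rewrite !coker_scaleE scalerDl to_cokerD.
Qed.

HB.instance Definition _ := GRing.Zmodule_isLmodule.Build A coker
  coker_scaleA coker_scale1 coker_scaleDr coker_scaleDl.

End Cokernel.

Definition matrix_factorization (S : comNzRingType) (f : S) (n : nat)
    (phi psi : 'M[S]_n) : Prop :=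
  phi *m psi = f%:M /\ psi *m phi = f%:M.

Definition mx_of_rows (S : comNzRingType) (n : nat) (rows : seq (seq S)) : 'M[S]_n :=
  \matrix_(i, j) nth 0 (nth [::] rows i) j.

Section Dinfty.
Variable k : closedFieldType.

Local Notation S := (powser3 k).
Local Notation x := (serX k).
Local Notation y := (serY k).
Local Notation z := (serZ k).

Definition dinf_eq : S := x ^+ 2 * y - z ^+ 2.

Definition dinf_ideal : pred S := fun g => `[< exists h, g = h * dinf_eq >].

Fact dinf_ideal_closed : idealr_closed dinf_ideal.
Proof.
split; first by apply/asboolP; exists 0; rewrite mul0r.
- apply/asboolP => -[h /(congr1 (fun g => g 0%N 0%N 0%N)) /eqP].
  rewrite !coef0_ps_mul (_ : dinf_eq 0%N 0%N 0%N = 0) ?mulr0 ?oner_eq0 //.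
  rewrite /dinf_eq !coef_ps_sub !coef0_ps_mul (_ : y 0%N 0%N 0%N = 0) //.
  by rewrite mulr0 expr2 coef0_ps_mul (_ : z 0%N = 0) // mul0r subr0.
- move=> a _ _ /asboolP[g ->] /asboolP[h ->]; apply/asboolP.
  by exists (a * g + h); rewrite mulrDl mulrA.
Qed.
HB.instance Definition _ := isIdealr.Build S dinf_ideal dinf_ideal_closed.

Definition dinf_idealr : idealr S := Idealr.clone _ dinf_ideal _.

Definition dinf_ring : comNzRingType := {ideal_quot dinf_idealr}.

(* M(phi, psi) = coker (phi : A^n -> A^n), columns acted on from the left. *)
Definition mf_module (n : nat) (phi psi : 'M[S]_n) : lmodType dinf_ring :=
  coker (map_mx \pi_dinf_ring phi).

Definition alphaP : 'M[S]_2 := mx_of_rows 2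
  [:: [:: z; x * y];
      [:: x; z]].
Definition alphaM : 'M[S]_2 := mx_of_rows 2
  [:: [:: - z; x * y];
      [:: x; - z]].

Definition betaP : 'M[S]_2 := mx_of_rows 2
  [:: [:: x ^+ 2; z];
      [:: z; y]].
Definition betaM : 'M[S]_2 := mx_of_rows 2
  [:: [:: y; - z];
      [:: - z; x ^+ 2]].

Definition gammaP (m : nat) : 'M[S]_4 := mx_of_rows 4
  [:: [:: z; x * y; 0; - y ^+ m.+1];
      [:: x; z; y ^+ m; 0];
      [:: 0; 0; z; x * y];
      [:: 0; 0; x; z]].
Definition gammaM (m : nat) : 'M[S]_4 := mx_of_rows 4
  [:: [:: - z; x * y; 0; - y ^+ m.+1];
      [:: x; - z; y ^+ m; 0];
      [:: 0; 0; - z; x * y];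
      [:: 0; 0; x; - z]].

Definition deltaP (m : nat) : 'M[S]_4 := mx_of_rows 4
  [:: [:: z; x * y; - y ^+ m; 0];
      [:: x; z; 0; y ^+ m];
      [:: 0; 0; z; x * y];
      [:: 0; 0; x; z]].
Definition deltaM (m : nat) : 'M[S]_4 := mx_of_rows 4
  [:: [:: - z; x * y; - y ^+ m; 0];
      [:: x; - z; 0; y ^+ m];
      [:: 0; 0; - z; x * y];
      [:: 0; 0; x; - z]].

End Dinfty.

Definition indec_nonfree_cm (A : comNzRingType) (M : lmodType A) : Prop :=
  [/\ cohen_macaulay M, indecomposable M & ~ free_mod M].

(* Main.v *)
(* Put P = k[[x,y]], so that A = P[z] with z^2 = x^2 y is free of rank 2 over P.
   A Cohen-Macaulay A-module is free over P, hence is a matrix Z over P with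
   Z^2 = x^2 y, taken up to conjugation.  If some entry of Z is a unit, then A splits
   off.  Otherwise Z is the restriction of x Theta to the lattice
   {v in P^n | v mod x in V}, where Theta is a matrix over C = k[[y]] with
   Theta^2 = y and V is a direct summand of C^n.  Through Theta, C^n becomes a module
   N over the valuation ring k[[t]], t^2 = y; the invariant factors t^a of N / k[[t]]V
   (Smith form) decide which summand splits off: alpha for a = oo, beta for a = 1,
   gamma and delta for odd and even a >= 2.  The Z of these summands have a commutant
   which is local, because det is a power of one diagonal entry modulo the maximal
   ideal; hence they are indecomposable. *)
From HB Require Import structures.
Require Import Defs.
From mathcomp Require Import all_boot all_algebra.
From mathcomp Require Import ring boolp zify perm.

Set Implicit Arguments.
Unset Strict Implicit.
Unset Printing Implicit Defensive.

Import GRing.Theory.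
Local Open Scope ring_scope.
Local Open Scope quotient_scope.

(** * Power series *)

(** The ring k[[x,t]] with y = t^2 and z = x t is behind the constructions: it contains A, which
    gives the absence of zero divisors and the normalization. The dimension bound is a divisibility
    statement about single elements, [one_dim_mod]; the same relation bounds chains of primes,
    bounds the depth, and makes y injective on a Cohen-Macaulay module given by any regular sequence
    s0, s1. Theta first appears over P. It is conjugate to its reduction modulo x because both
    square to y, and a contracting homotopy modulo (x, y), available in every characteristic, makes
    the intertwiner invertible. The conjugation is arranged to be congruent to 1 modulo x, so that
    it stays integral when carried to the lattice. Splitting off is recognised through maps F1, F2
    compatible with z whose composite F2 F1 has unit determinant: such maps can be written down from
    one row and one column of the Smith transformations, and an indecomposable module with such a
    nonzero retract is isomorphic to it. *)

Definition no_zero_div (R : comNzRingType) : Prop :=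
  forall a b : R, a * b = 0 -> a = 0 \/ b = 0.

(** Recursion on coefficients: after n+1 iterations the coefficients up to n no longer change, so
    the diagonal of the iterates is a fixed point. *)
Lemma powser_fixpoint (R : Type) (r0 : R) (F : (nat -> R) -> nat -> R) :
  (forall f g n, (forall i, (i < n)%N -> f i = g i) -> F f n = F g n) ->
  exists f, F f =1 f.
Proof.
move=> contr; pose it n := iter n F (fun=> r0).
have stab n m i : (i < n)%N -> (n <= m)%N -> it n i = it m i.
  elim: n m i => // n IH [|m] i // lin lenm; apply: contr => j ltji.
  by apply: IH => //; apply: leq_trans ltji _.
exists (fun n => it n.+1 n) => n /=.
rewrite -[RHS]/(F (it n) n); apply: contr => i ltin.
exact: (stab i.+1 n i (ltnSn i) ltin).
Qed.

(** Used for T-adic expansions: [a] is the sequence of remainders and [u] the sequence of digits. *)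
Lemma stream_unfold (T U : Type) (step : T -> U * T) (a0 : T) :
  exists (a : nat -> T) (u : nat -> U),
    a 0%N = a0 /\ forall n, step (a n) = (u n, a n.+1).
Proof.
pose a n := iter n (fun t => (step t).2) a0.
exists a, (fun n => (step (a n)).1); split=> // n.
by rewrite {1}[step (a n)]surjective_pairing.
Qed.

Section PowserTheory.
Variable R : comNzRingType.
Implicit Types (f g : powser R) (c : R).

Local Notation T := (@ps_var R : powser R).

Lemma coef_psD f g n : (f + g) n = f n + g n. Proof. by []. Qed.
Lemma coef_psN f n : (- f) n = - f n. Proof. by []. Qed.
Lemma coef_psM f g n : (f * g) n = \sum_(i < n.+1) f i * g (n - i)%N.
Proof. by []. Qed.
Lemma coef_ps0 n : (0 : powser R) n = 0.
Proof. by rewrite -[LHS]/(ps_const 0 n) /ps_const; case: eqP. Qed.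
Lemma coef_ps1 n : (1 : powser R) n = (n == 0%N)%:R.
Proof. by rewrite -[LHS]/(ps_const 1 n) /ps_const; case: eqP. Qed.
Lemma coef_const c n : ps_const c n = if n == 0%N then c else 0. Proof. by []. Qed.

Lemma coef_constM c f n : (ps_const c * f : powser R) n = c * f n.
Proof.
rewrite coef_psM big_ord_recl subn0 big1 ?addr0 // => i _.
by rewrite /ps_const /= mul0r.
Qed.

Lemma coef_psMl f g n : (g * f) n = f n * g 0%N + \sum_(i < n) f i * g (n - i)%N.
Proof. by rewrite mulrC coef_psM big_ord_recr /= subnn addrC. Qed.

Lemma coef_varM f n : (T * f) n = if n is m.+1 then f m else 0.
Proof.
case: n => [|n]; first by rewrite coef0_ps_mul mul0r.
rewrite coef_psM big_ord_recl /= mul0r add0r big_ord_recl /= mul1r subSS subn0.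
by rewrite big1 ?addr0 // => i _; rewrite mul0r.
Qed.

Lemma coef_varXM f m n : (T ^+ m * f) n = if (m <= n)%N then f (n - m)%N else 0.
Proof.
elim: m f n => [|m IH] f n; first by rewrite expr0 mul1r subn0.
rewrite exprSr -mulrA IH; case: (leqP m n) => [lemn|ltnm].
  rewrite coef_varM; case: (ltnP m n) => [lt|ge]; first by rewrite -(subnSK lt).
  by have -> : (n - m = 0)%N by apply/eqP.
by rewrite leqNgt ltnS ltnW.
Qed.

Lemma ps_const_zmod : zmod_morphism (@ps_const R : R -> powser R).
Proof.
by move=> a b; apply/funext => n; rewrite coef_ps_sub /ps_const; case: eqP; rewrite ?subr0.
Qed.
Lemma ps_const_monoid : monoid_morphism (@ps_const R : R -> powser R).
Proof.
split=> // a b; apply/funext => n; rewrite coef_constM /ps_const.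
by case: eqP; rewrite ?mulr0.
Qed.
HB.instance Definition _ :=
  GRing.isZmodMorphism.Build R (powser R) (@ps_const R) ps_const_zmod.
HB.instance Definition _ :=
  GRing.isMonoidMorphism.Build R (powser R) (@ps_const R) ps_const_monoid.

Definition ps_coef0 f : R := f 0%N.
Lemma ps_coef0_zmod : zmod_morphism ps_coef0. Proof. by []. Qed.
Lemma ps_coef0_monoid : monoid_morphism ps_coef0.
Proof. by split=> // f g; apply: coef0_ps_mul. Qed.
HB.instance Definition _ :=
  GRing.isZmodMorphism.Build (powser R) R ps_coef0 ps_coef0_zmod.
HB.instance Definition _ :=
  GRing.isMonoidMorphism.Build (powser R) R ps_coef0 ps_coef0_monoid.

Definition ps_tail f : powser R := fun n => f n.+1.

Lemma ps_split f : f = ps_const (f 0%N) + T * ps_tail f.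
Proof.
by apply/funext => -[|n]; rewrite coef_psD coef_varM /ps_const /= ?addr0 ?add0r.
Qed.

Lemma ps_var_inj : injective (fun f => T * f).
Proof. by move=> f g e; apply/funext => n; move/(congr1 (fun h => h n.+1)): e; rewrite !coef_varM. Qed.

Lemma ps_var_div f : f 0%N = 0 -> exists g, f = T * g.
Proof. by move=> f0; exists (ps_tail f); rewrite {1}[f]ps_split f0 rmorph0 add0r. Qed.

Lemma ps_varX_div m f : (forall i, (i < m)%N -> f i = 0) -> exists g, f = T ^+ m * g.
Proof.
move=> f0; exists (fun n => f (n + m)%N); apply/funext => n.
by rewrite coef_varXM; case: leqP => [le|/f0 //]; rewrite subnK.
Qed.

Lemma ps_eq0_divX f : (forall m, exists g, f = T ^+ m * g) -> f = 0.
Proof.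
move=> dv; apply/funext => n; have [g ->] := dv n.+1.
by rewrite coef_varXM ltnn coef_ps0.
Qed.

Lemma ps_unit f c : f 0%N * c = 1 -> exists g, f * g = 1.
Proof.
move=> fc; pose F g n : R := c * ((n == 0%N)%:R - \sum_(i < n) g i * f (n - i)%N).
have [|g gE] := @powser_fixpoint R 0 F.
  move=> f1 f2 n e; rewrite /F; congr (_ * (_ - _)).
  by apply: eq_bigr => i _; rewrite e.
exists g; apply/funext => n; rewrite coef_psMl coef_ps1.
by rewrite -{1}gE /F mulrAC [c * _]mulrC fc mul1r subrK.
Qed.

Lemma ps_order f : f <> 0 -> exists n g, f = T ^+ n * g /\ g 0%N <> 0.
Proof.
move=> f0; have [n /negP fn0]: exists n, ~~ `[< f n = 0 >].
  apply: contrapT => H; apply: f0; apply/funext => n; rewrite coef_ps0.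
  by apply: contrapT => fn; apply: H; exists n; apply/asboolPn.
have ex : exists n, ~~ `[< f n = 0 >] by exists n; apply/negP.
case: (ex_minnP ex) => m /asboolPn fm min.
have [|g fE] := @ps_varX_div m f.
  by move=> i; rewrite ltnNge; apply: contraNP => fi; apply: min; apply/asboolPn.
exists m, g; split=> // g0; apply: fm.
by rewrite fE coef_varXM leqnn subnn.
Qed.

Lemma ps_varX_neq0 m g : g 0%N <> 0 -> T ^+ m * g <> 0.
Proof. by move=> g0 /(congr1 (fun h => h m)); rewrite coef_varXM leqnn subnn coef_ps0. Qed.

Lemma ps_no_zero_div : no_zero_div R -> no_zero_div (powser R).
Proof.
move=> domR f g fg.
have [?|/ps_order[n [f' [fE f0]]]] := EM (f = 0); first by left.
have [?|/ps_order[m [g' [gE g0]]]] := EM (g = 0); first by right.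
have: T ^+ (n + m) * (f' * g') = 0.
  by rewrite -fg fE gE exprD; ring.
move=> e; exfalso; apply: (ps_varX_neq0 _ e); rewrite coef0_ps_mul.
by case/domR.
Qed.

End PowserTheory.

Section PowserMap.
Variables (R R' : comNzRingType) (phi : {rmorphism R -> R'}).

Definition ps_map (f : powser R) : powser R' := fun n => phi (f n).

Lemma ps_map_zmod : zmod_morphism ps_map.
Proof. by move=> f g; apply/funext => n; rewrite /ps_map !coef_ps_sub rmorphB. Qed.
Lemma ps_map_monoid : monoid_morphism ps_map.
Proof.
split=> [|f g]; apply/funext => n; rewrite /ps_map.
  by rewrite !coef_ps1 rmorph_nat.
by rewrite !coef_psM rmorph_sum; apply: eq_bigr => i _; rewrite rmorphM.
Qed.
HB.instance Definition _ :=
  GRing.isZmodMorphism.Build (powser R) (powser R') ps_map ps_map_zmod.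
HB.instance Definition _ :=
  GRing.isMonoidMorphism.Build (powser R) (powser R') ps_map ps_map_monoid.

Lemma ps_map_var : ps_map ps_var = ps_var.
Proof. by apply/funext => n; rewrite /ps_map /ps_var rmorph_nat. Qed.

End PowserMap.

Section PowserDouble.
Variable R : comNzRingType.
Implicit Types f g : powser R.

Local Notation T := (@ps_var R : powser R).

(** Substitution of T^2 for the variable: the inclusion of k[[y]] in k[[t]] with t^2 = y, both rings
    being represented by [powser]. *)
Definition ps_dbl f : powser R := fun n => if odd n then 0 else f n./2.

Lemma ps_dbl_zmod : zmod_morphism ps_dbl.
Proof.
by move=> f g; apply/funext => n; rewrite coef_ps_sub /ps_dbl; case: odd; rewrite ?subr0.
Qed.

Lemma sum_even (G : nat -> R) m :
  \sum_(i < m.*2.+1) (if odd i then 0 else G i./2) = \sum_(i < m.+1) G i.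
Proof.
elim: m => [|m IH]; first by rewrite !big_ord1.
rewrite doubleS big_ord_recr big_ord_recr /= IH [RHS]big_ord_recr /=.
by rewrite negbK odd_double /= addr0 ?uphalf_double ?doubleK.
Qed.

Lemma ps_dbl_monoid : monoid_morphism ps_dbl.
Proof.
split=> [|f g]; apply/funext => n; rewrite /ps_dbl.
  by rewrite !coef_ps1; case: n => [|[|n]] //=; case: odd.
rewrite !coef_psM; case: (boolP (odd n)) => on.
  rewrite big1 // => i _; case: (boolP (odd i)) => oi; first by rewrite mul0r.
  by rewrite oddB ?on ?(negPf oi) ?mulr0 // -ltnS.
rewrite -(sum_even (fun i => f i * g (n./2 - i)%N)) even_halfK //.
apply: eq_bigr => i _; case: (boolP (odd i)) => oi; first by rewrite mul0r.
rewrite oddB ?(negPf on) ?(negPf oi) /=; last by rewrite -ltnS.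
by congr (_ * g _); move: (nat_of_ord i) oi (ltn_ord i) => j; lia.
Qed.
HB.instance Definition _ :=
  GRing.isZmodMorphism.Build (powser R) (powser R) ps_dbl ps_dbl_zmod.
HB.instance Definition _ :=
  GRing.isMonoidMorphism.Build (powser R) (powser R) ps_dbl ps_dbl_monoid.

Lemma ps_dbl_const c : ps_dbl (ps_const c) = ps_const c.
Proof. by apply/funext => -[|[|n]]; rewrite /ps_dbl /ps_const //=; case: odd. Qed.
Lemma ps_dbl_var : ps_dbl T = T ^+ 2.
Proof.
apply/funext => n; rewrite -[T ^+ 2]mulr1 coef_varXM coef_ps1 /ps_dbl /ps_var.
by case: n => [|[|[|[|n]]]] //=; case: odd.
Qed.

Definition ps_even f : powser R := fun n => f n.*2.
Definition ps_odd f : powser R := fun n => f n.*2.+1.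

Lemma ps_dblK f : f = ps_dbl (ps_even f) + T * ps_dbl (ps_odd f).
Proof.
apply/funext => n; rewrite coef_psD coef_varM /ps_dbl /ps_even /ps_odd.
case: n => [|n] /=; first by rewrite addr0.
by case: (boolP (odd n)) => on /=; rewrite ?addr0 ?add0r; congr f; lia.
Qed.

Lemma ps_dbl_eq0 f g : ps_dbl f + T * ps_dbl g = 0 -> f = 0 /\ g = 0.
Proof.
move=> e; split; apply/funext => n; rewrite coef_ps0.
  move/(congr1 (fun h => h n.*2)): e; rewrite coef_psD coef_varM coef_ps0.
  rewrite /ps_dbl odd_double doubleK; case: n => [|n] /=; rewrite ?addr0 //.
  by rewrite odd_double /= addr0.
move/(congr1 (fun h => h n.*2.+1)): e; rewrite coef_psD coef_varM coef_ps0.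
by rewrite /ps_dbl /= odd_double /= doubleK add0r.
Qed.

End PowserDouble.

(** * Quadratic extensions *)

(** Two instances matter: A over k[[x,y]] with z^2 = x^2 y, and k[[t]] over k[[y]] with t^2 = y. *)
Definition quad_ext (P A : comNzRingType) (io : {rmorphism P -> A}) (z : A) (w : P) : Prop :=
  [/\ z * z = io w,
      forall a, exists pq : P * P, a = io pq.1 + io pq.2 * z &
      forall p q, io p + io q * z = 0 -> p = 0 /\ q = 0].

Section QuadExt.
Variables (P A : comNzRingType) (io : {rmorphism P -> A}) (z : A) (w : P).
Hypothesis qe : quad_ext io z w.

Let zz : z * z = io w. Proof. by case: qe. Qed.

Definition qx0 a : P := (projT1 (cid (let: And3 _ ex _ := qe in ex a))).1.
Definition qx1 a : P := (projT1 (cid (let: And3 _ ex _ := qe in ex a))).2.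

Lemma qxE a : a = io (qx0 a) + io (qx1 a) * z.
Proof. by rewrite /qx0 /qx1; case: cid. Qed.

Lemma qx_inj p q p' q' :
  io p + io q * z = io p' + io q' * z -> p = p' /\ q = q'.
Proof.
case: qe => _ _ un e; have [|/eqP pE /eqP qE] := un (p - p') (q - q').
  by rewrite !rmorphB mulrBl addrACA -opprD e subrr.
by rewrite !subr_eq0 in pE qE; split; apply/eqP.
Qed.

Lemma qxP p q : qx0 (io p + io q * z) = p /\ qx1 (io p + io q * z) = q.
Proof. by apply: qx_inj; rewrite -qxE. Qed.

Lemma io_inj : injective io.
Proof. by move=> p q e; have [] // := @qx_inj p 0 q 0; rewrite e. Qed.

Lemma qx_io p : qx0 (io p) = p /\ qx1 (io p) = 0.
Proof. by have := qxP p 0; rewrite rmorph0 mul0r addr0. Qed.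

Lemma qxB a b : qx0 (a - b) = qx0 a - qx0 b /\ qx1 (a - b) = qx1 a - qx1 b.
Proof.
apply: qx_inj; rewrite -qxE {1}[a]qxE {1}[b]qxE.
by rewrite !rmorphB; ring.
Qed.

Lemma qxM a b : qx0 (a * b) = qx0 a * qx0 b + qx1 a * qx1 b * w /\
  qx1 (a * b) = qx0 a * qx1 b + qx1 a * qx0 b.
Proof.
apply: qx_inj; rewrite -qxE {1}[a]qxE {1}[b]qxE.
by rewrite !(rmorphD, rmorphM) -zz; ring.
Qed.

(** Universal property of P[Z]/(Z^2 - w): a homomorphism out of [A] amounts to one out of [P] and a
    square root of the image of [w]. It yields the residue maps and the embedding into k[[x,t]]. *)
Lemma quad_lift (D : comNzRingType) (phi : {rmorphism P -> D}) (d : D) :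
  d * d = phi w ->
  exists Phi : {rmorphism A -> D}, [/\ forall p, Phi (io p) = phi p, Phi z = d &
    forall a, Phi a = phi (qx0 a) + phi (qx1 a) * d].
Proof.
move=> dd; pose f a := phi (qx0 a) + phi (qx1 a) * d.
have fB : zmod_morphism f.
  by move=> a b; rewrite /f (qxB a b).1 (qxB a b).2 !rmorphB; ring.
have fM : monoid_morphism f.
  split=> [|a b].
    by rewrite /f -(rmorph1 io) (qx_io 1).1 (qx_io 1).2 rmorph1 rmorph0 mul0r addr0.
  by rewrite /f (qxM a b).1 (qxM a b).2 !(rmorphD, rmorphM) -dd; ring.
pose F : {rmorphism A -> D} := HB.pack f (GRing.isZmodMorphism.Build A D f fB)
  (GRing.isMonoidMorphism.Build A D f fM).
exists F; split=> [p||//]; rewrite /F /= /f.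
  by rewrite (qx_io p).1 (qx_io p).2 rmorph0 mul0r addr0.
have := qxP 0 1; rewrite rmorph0 rmorph1 mul1r add0r => -[-> ->].
by rewrite rmorph0 rmorph1 mul1r add0r.
Qed.

(** The witness is the conjugate p - q z, which turns questions about [a] into questions about its
    norm in [P]. *)
Lemma quad_norm a : exists a', a * a' = io (qx0 a ^+ 2 - qx1 a ^+ 2 * w) /\
  (a' = 0 -> a = 0).
Proof.
exists (io (qx0 a) - io (qx1 a) * z); split.
  by rewrite {1}[a]qxE rmorphB rmorphM expr2 rmorphM -zz; ring.
rewrite -mulNr -rmorphN => e; case: qe => _ _ /(_ _ _ e)[a0 /eqP].
by rewrite oppr_eq0 => /eqP a1; rewrite [a]qxE a0 a1 rmorph0 mul0r addr0.
Qed.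

End QuadExt.

Section QuadPowser.
Variables (Q : comNzRingType) (c : Q).
Local Notation P := (powser Q).
Local Notation w := (ps_const c * ps_var : powser Q).
Local Notation z := (@ps_var P : powser P).
Local Notation cst := (@ps_const P : P -> powser P).

(** The sum of the w^m u_m: as w is [c] times the variable, only the terms with m <= j reach the
    coefficient of degree j. *)
Let psum (u : nat -> P) : P := fun j => \sum_(m < j.+1) c ^+ m * u m (j - m)%N.

Let psumE u : psum u = u 0%N + w * psum (fun n => u n.+1).
Proof.
apply/funext => j; rewrite /psum big_ord_recl coef_psD expr0 mul1r subn0.
congr (_ + _); rewrite -mulrA coef_constM coef_varM.
case: j => [|j]; first by rewrite big_ord0 mulr0.
by rewrite mulr_sumr; apply: eq_bigr => i _; rewrite exprS mulrA.
Qed.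

(** Replacing z^2 by w everywhere leads to r_n = sum_m w^m s_(n+2m). The remainder is r_0 + r_1 z,
    and the recursion r_n = s_n + w r_(n+2) shows that the quotient has coefficients - r_(n+2). *)
Lemma powser_quad_nf (s : powser P) : exists pq h,
  s = cst pq.1 + cst pq.2 * z + h * (cst w - z ^+ 2).
Proof.
pose r n := psum (fun m => s (n + m.*2)%N).
have rE n : r n = s n + w * r n.+2.
  rewrite /r psumE addn0; congr (_ + _ * psum _).
  by apply/funext => m; congr s; rewrite doubleS; lia.
exists (r 0%N, r 1%N), (fun n => - r n.+2); apply/funext => n /=.
rewrite mulrBr -[cst (r 1%N) * z]mulrC -[_ * cst w]mulrC -[_ * z ^+ 2]mulrC.
rewrite !coef_psD coef_psN coef_constM coef_varXM coef_varM coef_const.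
case: n => [|[|n]] /=.
- by rewrite (rE 0%N); ring.
- by rewrite coef_const (rE 1%N) /=; ring.
by rewrite coef_const subSS subSS subn0 (rE n.+2) /=; ring.
Qed.

(** Comparing coefficients of degree at least 2 gives h_n = w h_(n+2); hence every h_n is divisible
    by all powers of the variable and vanishes. *)
Lemma powser_quad_uniq (p q : P) h :
  cst p + cst q * z = h * (cst w - z ^+ 2) -> p = 0 /\ q = 0.
Proof.
rewrite mulrBr -[cst q * z]mulrC -[_ * cst w]mulrC -[_ * z ^+ 2]mulrC => e.
have hE n : h n = w * h n.+2.
  move/(congr1 (fun f => f n.+2)): e.
  rewrite !coef_psD coef_psN coef_constM coef_varXM coef_varM !coef_const /= subSS subSS subn0.
  by rewrite addr0 => /esym/eqP; rewrite subr_eq0 => /eqP.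
have h0 n : h n = 0.
  apply: ps_eq0_divX => m; elim: m n => [|m IH] n; first by exists (h n); rewrite mul1r.
  by have [g gE] := IH n.+2; exists (ps_const c * g); rewrite hE gE exprS; ring.
move: (congr1 (fun f => f 0%N) e) (congr1 (fun f => f 1%N) e).
rewrite !coef_psD !coef_psN !coef_constM !coef_varXM !coef_varM !coef_const /= !h0.
by rewrite !mulr0 ?oppr0 !addr0 !add0r.
Qed.

End QuadPowser.

Lemma dbl_quad_ext (R : comNzRingType) :
  quad_ext (@ps_dbl R : {rmorphism powser R -> powser R}) (@ps_var R) (@ps_var R).
Proof.
split=> [|a|p q]; first exact/esym/ps_dbl_var.
  by exists (ps_even a, ps_odd a); rewrite /= {1}[a]ps_dblK mulrC.
by rewrite [_ * ps_var]mulrC; apply: ps_dbl_eq0.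
Qed.

Section DinfRing.
Variable k : closedFieldType.
Local Notation P := (powser (powser k)).
Local Notation A := (dinf_ring k).

Definition dinf_x : P := ps_const ps_var.
Definition dinf_y : P := ps_var.
Definition dinf_w : P := dinf_x ^+ 2 * dinf_y.

Definition dinf_pi (s : powser3 k) : A := \pi_(dinf_ring k) s.

Lemma dinf_piB s t : dinf_pi (s - t) = dinf_pi s - dinf_pi t.
Proof. exact: rmorphB. Qed.
Lemma dinf_piD s t : dinf_pi (s + t) = dinf_pi s + dinf_pi t.
Proof. exact: rmorphD. Qed.
Lemma dinf_piM s t : dinf_pi (s * t) = dinf_pi s * dinf_pi t.
Proof. exact: rmorphM. Qed.
Lemma dinf_pi1 : dinf_pi 1 = 1.
Proof. exact: rmorph1. Qed.

Definition dinf_of (p : P) : A := dinf_pi (ps_const p).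
Definition dinf_z : A := dinf_pi (serZ k).

Lemma dinf_of_zmod : zmod_morphism dinf_of.
Proof. by move=> p q; rewrite /dinf_of rmorphB dinf_piB. Qed.
Lemma dinf_of_monoid : monoid_morphism dinf_of.
Proof. by split=> [|p q]; rewrite /dinf_of ?rmorph1 ?dinf_pi1 // rmorphM dinf_piM. Qed.
HB.instance Definition _ := GRing.isZmodMorphism.Build P A dinf_of dinf_of_zmod.
HB.instance Definition _ := GRing.isMonoidMorphism.Build P A dinf_of dinf_of_monoid.

Lemma dinf_eqE : dinf_eq k = ps_const dinf_w - serZ k ^+ 2.
Proof. by rewrite /dinf_eq /dinf_w rmorphM rmorphXn. Qed.

Lemma dinf_wE : dinf_w = ps_const (ps_var ^+ 2) * ps_var.
Proof. by rewrite /dinf_w /dinf_x rmorphXn. Qed.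

Lemma pi_dinf_eq0 (s : powser3 k) : dinf_pi s = 0 <-> exists h, s = h * dinf_eq k.
Proof.
rewrite -[0](rmorph0 \pi_(dinf_ring k)); split=> [/eqP|[h ->]].
  by rewrite -Quotient.idealrBE subr0 => /asboolP.
by apply/eqP; rewrite -Quotient.idealrBE subr0; apply/asboolP; exists h.
Qed.

Lemma dinf_quad_ext : quad_ext (dinf_of : {rmorphism P -> A}) dinf_z dinf_w.
Proof.
split.
- apply/eqP; rewrite -subr_eq0; apply/eqP.
  rewrite -dinf_piM -dinf_piB; apply/pi_dinf_eq0; exists (-1).
  by rewrite mulN1r dinf_eqE expr2 opprB.
- move=> a; elim/quotP: a => s _.
  have [pq [h sE]] := powser_quad_nf (ps_var ^+ 2) s.
  exists pq; rewrite -dinf_piM -dinf_piD; apply/eqP; rewrite -subr_eq0; apply/eqP.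
  rewrite -dinf_piB; apply/pi_dinf_eq0; exists h.
  by rewrite dinf_eqE dinf_wE {1}sE [LHS]addrC addrA addNr add0r.
move=> p q; rewrite -dinf_piM -dinf_piD => /pi_dinf_eq0[h].
by rewrite dinf_eqE dinf_wE; apply: powser_quad_uniq.
Qed.

End DinfRing.

(** * Krull dimension *)

Lemma fieldT_no_zero_div (k : fieldType) : no_zero_div k.
Proof. by move=> a b /eqP; rewrite mulf_eq0 => /orP[] /eqP; [left|right]. Qed.

Lemma poly_low_term (C : comNzRingType) (p : {poly C}) : p != 0 ->
  exists j (c : C) q, c <> 0 /\ p = (q * 'X + c%:P) * 'X^j.
Proof.
elim/poly_ind: p => [|p c IH]; first by rewrite eqxx.
have [->|c0] := eqVneq c 0; last by exists 0%N, c, p; rewrite mulr1; split=> //; apply/eqP.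
rewrite addr0; have [->|/IH] := eqVneq p 0; first by rewrite mul0r eqxx.
by move=> [j [c' [q [c'0 ->]]]] _; exists j.+1, c', q; split=> //; rewrite exprSr mulrA.
Qed.

Lemma horner_map_low (C A : comNzRingType) (J : {rmorphism C -> A}) q c j b :
  (map_poly J ((q * 'X + c%:P) * 'X^j)).[b] = ((map_poly J q).[b] * b + J c) * b ^+ j.
Proof.
rewrite rmorphM rmorphD rmorphM /= map_polyX map_polyC map_polyXn.
by rewrite hornerM hornerD hornerMX hornerC hornerXn.
Qed.

(* If b stabilizes, modulo H, the C-span of a family containing 1, then the
   characteristic polynomial of its action kills b modulo H. *)
Lemma finite_span_integral (C A : comNzRingType) (J : {rmorphism C -> A}) n
    (e : 'I_n -> A) (H b : A) :
  (forall a : A, exists (c : 'I_n -> C) (s : A), a = \sum_j J (c j) * e j + H * s) ->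
  exists (p : {poly C}) (s : A), p \is monic /\ (map_poly J p).[b] = H * s.
Proof.
move=> span; have [f fE] := choice (fun i => span (b * e i)).
have {fE}[s sE] := choice fE.
pose B := \matrix_(i, j) f i j.
pose M : 'M[A]_n := b%:M - map_mx J B.
pose ev : 'cV[A]_n := \col_i e i; pose sv : 'cV[A]_n := \col_i s i.
have ME : M *m ev = H *: sv.
  apply/colP => i; rewrite mulmxBl mul_scalar_mx !mxE sE addrC addrA.
  suff -> : - (\sum_j (map_mx J B) i j * ev j 0) + \sum_j J (f i j) * e j = 0 by rewrite add0r.
  by rewrite addrC; apply/eqP; rewrite subr_eq0; apply/eqP/eq_bigr => j _; rewrite !mxE.
have detE i : \det M * e i = H * (\adj M *m sv) i 0.
  have := congr1 (fun v => (\adj M *m v) i 0) ME.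
  by rewrite /= mulmxA mul_adj_mx mul_scalar_mx -scalemxAr !mxE.
exists (char_poly B); have [c [s0 one]] := span 1.
exists (\sum_j J (c j) * (\adj M *m sv) j 0 + \det M * s0); split.
  exact: char_poly_monic.
have -> : (map_poly J (char_poly B)).[b] = \det M.
  rewrite map_char_poly -[LHS]/(horner_eval b _) /char_poly -det_map_mx; congr (\det _).
  apply/matrixP => i j; rewrite !mxE -[LHS]/(('X *+ (i == j) - (J (f i j))%:P).[b]).
  by rewrite hornerD hornerN hornerMn hornerX hornerC.
rewrite -[LHS]mulr1 {1}one !mulrDr mulr_sumr mulr_sumr; congr (_ + _); last by ring.
by apply: eq_bigr => j _; rewrite mulrCA detE mulrCA.
Qed.

(* a divides b^M (c^N + b r) for suitable r: in A/(a), some power of c is a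
   multiple of b up to b-torsion. *)
Definition one_dim_mod (A : comNzRingType) (b c a : A) : Prop :=
  exists M N r s, b ^+ M * (c ^+ N + b * r) = a * s.

(** Multiplicativity reduces a nonzero series in x and y to the factor y and to a series that is
    nonzero modulo y. *)
Lemma one_dim_mod_mul (A : comNzRingType) (b c a a' : A) :
  one_dim_mod b c a -> one_dim_mod b c a' -> one_dim_mod b c (a * a').
Proof.
move=> [M [N [r [s e]]]] [M' [N' [r' [s' e']]]].
exists (M + M')%N, (N + N')%N, (c ^+ N * r' + r * c ^+ N' + b * r * r'), (s * s').
rewrite mulrACA -e -e' !exprD; ring.
Qed.

Lemma one_dim_mod_dvd (A : comNzRingType) (b c a t : A) :
  one_dim_mod b c (a * t) -> one_dim_mod b c a.
Proof. by move=> [M [N [r [s e]]]]; exists M, N, r, (t * s); rewrite e mulrA. Qed.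

Lemma sum_expr_mod (A : comNzRingType) (y s H s' : A) l :
  exists t, (y * s + H * s') ^+ l = y ^+ l * s ^+ l + H * t.
Proof.
elim: l => [|l [t IH]]; first by exists 0; rewrite !expr0; ring.
by exists (y * s * t + s' * (y ^+ l * s ^+ l + H * t)); rewrite !exprS IH; ring.
Qed.

(** * Dimension of A, by reduction modulo y and Weierstrass division *)

Section LocalDimension.
Variable k : fieldType.
Local Notation K := (powser k).
Local Notation P := (powser (powser k)).
Local Notation X := (ps_const ps_var : powser (powser k)).
Local Notation Y := (@ps_var (powser k) : powser (powser k)).
Variables (A : comNzRingType) (io : {rmorphism P -> A}) (z : A).
Hypothesis qe : quad_ext io z (X ^+ 2 * Y).

Lemma ps_field_unit (f : K) : f 0%N <> 0 -> exists g, f * g = 1.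
Proof. by move=> f0; apply: (@ps_unit _ f (f 0%N)^-1); rewrite mulfV //; apply/eqP. Qed.

Lemma ps2_unit (f : P) : f 0%N 0%N <> 0 -> exists g, f * g = 1.
Proof. by move/ps_field_unit => [c /ps_unit]. Qed.

Lemma ps_field_no_zero_div : no_zero_div K.
Proof. exact/ps_no_zero_div/fieldT_no_zero_div. Qed.

Lemma quad_res : exists res : {rmorphism A -> k}, forall a, res a = qx0 qe a 0%N 0%N.
Proof.
have [|res [_ _ E]] := @quad_lift _ _ _ _ _ qe k
    (@ps_coef0 k \o @ps_coef0 K : {rmorphism P -> k}) 0.
  by rewrite mul0r /= /ps_coef0 !coef0_ps_mul mulr0.
by exists res => a; rewrite E mulr0 addr0.
Qed.

Lemma quad_unit a : qx0 qe a 0%N 0%N <> 0 -> exists b, a * b = 1.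
Proof.
move=> a0; have [a' [aa' _]] := quad_norm qe a.
have [|g gE] := @ps2_unit (qx0 qe a ^+ 2 - qx1 qe a ^+ 2 * (X ^+ 2 * Y)).
  rewrite !expr2 !coef_psD !coef_psN !coef0_ps_mul !mulr0 subr0.
  by move=> /eqP; rewrite mulf_eq0 orbb => /eqP.
by exists (a' * io g); rewrite mulrA aa' -rmorphM gE rmorph1.
Qed.

Lemma max_idealE a : max_ideal a <-> qx0 qe a 0%N 0%N = 0.
Proof.
split=> [na|a0 [b ab]]; first by apply: contrapT => /quad_unit.
have [res resE] := quad_res; move: a0; rewrite -resE => a0.
by move/eqP: (congr1 res ab); rewrite rmorphM a0 mul0r rmorph1 eq_sym oner_eq0.
Qed.

(** The quotient map A -> k[[x]] killing y and z. Its kernel is the radical of (y), by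
    [redX_eq0]. *)
Lemma quad_redX : exists redX : {rmorphism A -> K},
  forall a, redX a = qx0 qe a 0%N.
Proof.
have [|redX [_ _ E]] := @quad_lift _ _ _ _ _ qe K (@ps_coef0 K : {rmorphism P -> K}) 0.
  by rewrite mul0r /= /ps_coef0 !coef0_ps_mul (_ : Y 0%N = 0) // mulr0.
by exists redX => a; rewrite E mulr0 addr0.
Qed.

Lemma redX_eq0 a : qx0 qe a 0%N = 0 -> exists s, a ^+ 2 = io Y * s.
Proof.
move=> /ps_var_div[p pE]; rewrite {1}(qxE qe a) pE.
exists (io Y * io p ^+ 2 + 2%:R * io p * io (qx1 qe a) * z + io X ^+ 2 * io (qx1 qe a) ^+ 2).
have zz : z * z = io X * io X * io Y by case: qe => ->; rewrite !rmorphM.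
rewrite rmorphM; transitivity (io Y * (io Y * io p ^+ 2 + 2%:R * io p * io (qx1 qe a) * z)
  + z * z * io (qx1 qe a) ^+ 2); first by ring.
by rewrite zz; ring.
Qed.

(** Modulo the radical of (y) the ring is the discrete valuation ring k[[x]]: either b vanishes
    there, so that b^2 is in (y), or b is a unit times x^j and divides c^j. Squaring returns from
    the radical to (y). *)
Lemma one_dim_mod_y b c : qx0 qe c 0%N 0%N = 0 -> one_dim_mod b c (io Y).
Proof.
have [redX rE] := quad_redX; rewrite -rE => /ps_var_div[c1 cE].
have [b0|/ps_order[j [g [bE g0]]]] := EM (redX b = 0).
  rewrite rE in b0; have [s sE] := redX_eq0 b0.
  by exists 2%N, 0%N, 0, s; rewrite -sE; ring.
have [h gh] := ps_field_unit g0.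
pose r := io (ps_const (h * c1 ^+ j)).
have [|s sE] := @redX_eq0 (c ^+ j - b * r).
  rewrite -rE rmorphB rmorphM rmorphXn cE bE (_ : redX r = h * c1 ^+ j); last first.
    by rewrite rE /r (qx_io qe _).1.
  transitivity (ps_var ^+ j * c1 ^+ j * (1 - g * h)); first by rewrite exprMn; ring.
  by rewrite gh; ring.
exists 0%N, (j + j)%N, (b * r ^+ 2 - 2%:R * c ^+ j * r), s.
by rewrite -sE exprD; ring.
Qed.

(** The ring k[[y]] inside k[[x,y]]: the variable of [K], which stands for x elsewhere in this
    section, is read as y. *)
Definition ps_constY : K -> P := ps_map (@ps_const k).
HB.instance Definition _ := GRing.RMorphism.on ps_constY.

(** The quotient is built by recursion on the degree in y. Since [h 0] is x^d times a unit, [dv]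
    gives the multiple of it that removes all terms of degree at least d in x from a given
    series. *)
Lemma weierstrass_division (h : P) d (g : K) : g 0%N <> 0 -> h 0%N = ps_var ^+ d * g ->
  forall p, exists q, forall n i, (d <= i)%N -> (p - h * q) n i = 0.
Proof.
move=> /ps_field_unit[g' gg'] hE p.
pose dv (f : K) : K := g' * (fun i => f (i + d)%N).
have dvE f i : (d <= i)%N -> (f - h 0%N * dv f) i = 0.
  move=> di; rewrite hE /dv.
  rewrite (_ : _ * _ * _ = (ps_var ^+ d * (fun i => f (i + d)%N)) * (g * g')); last by ring.
  by rewrite gg' mulr1 coef_ps_sub coef_varXM di subnK // subrr.
pose F (q : P) n : K := dv (p n - \sum_(i < n) q i * h (n - i)%N).
have [|q qE] := @powser_fixpoint K 0 F.
  by move=> f1 f2 n e; rewrite /F; congr (dv (_ - _)); apply: eq_bigr => i _; rewrite e.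
exists q => n i di; rewrite coef_ps_sub coef_psMl opprD addrCA [q n * _]mulrC -qE /F.
by rewrite addrC; apply: dvE.
Qed.

Lemma polyX_split (r : P) d : (forall n i, (d <= i)%N -> r n i = 0) ->
  r = \sum_(i < d) ps_constY (fun n => r n i) * X ^+ i.
Proof.
move=> r0; apply/funext => n; apply/funext => j.
have coefsum (I : finType) (F : I -> P) : (\sum_i F i) n j = \sum_i F i n j.
  by elim/big_ind2: _ => [|a b c d' <- <-|//]; rewrite ?coef_ps0 // !coef_psD.
rewrite coefsum; transitivity (\sum_(i < d) if (j == i)%N then r n i else 0).
  have [ltjd|ledj] := ltnP j d; last first.
    by rewrite r0 // big1 // => i _; case: eqP => // ji; move: ledj; rewrite ji leqNgt ltn_ord.
  rewrite (bigD1 (Ordinal ltjd)) //= eqxx big1 ?addr0 // => i ine.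
  by case: eqP => // ji; case/eqP: ine; apply: val_inj.
apply: eq_bigr => i _; rewrite mulrC -rmorphXn coef_constM coef_varXM -[ps_constY _ n]/(ps_const (r n i)) coef_const.
by case: (ltngtP i j) => [ij|//|->]; rewrite ?subnn //; rewrite -subnSK.
Qed.

(** A/(h) is spanned over k[[y]] by x^i and x^i z with i < d. The lowest coefficient of a monic
    relation for b is y^l times a unit, which puts b^j (y^l + b r) in (h) for some r; and a power of
    c lies in (y^l, h), because h is x^d times a unit modulo y. *)
Lemma one_dim_mod_monic b c (h : P) : qx0 qe c 0%N 0%N = 0 -> h 0%N <> 0 -> one_dim_mod b c (io h).
Proof.
have [redX rE] := quad_redX; rewrite -rE => /ps_var_div[c1 cE] /ps_order[d [g [hE g0]]].
pose J : {rmorphism K -> A} := io \o ps_constY.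
have division p : exists (r : 'I_d -> K) q, io p = \sum_i J (r i) * io X ^+ i + io h * io q.
  have [q qE] := weierstrass_division g0 hE p.
  exists (fun i n => (p - h * q) n i), q; rewrite -[p in LHS](subrK (h * q)) rmorphD rmorphM.
  congr (_ + _); rewrite {1}(polyX_split qE) rmorph_sum; apply: eq_bigr => i _.
  by rewrite rmorphM rmorphXn.
pose e (i : 'I_(d + d)) := match split i with inl i => io X ^+ i | inr i => io X ^+ i * z end.
have [|p [s [mon pE]]] := @finite_span_integral _ _ J _ e (io h) b.
  move=> a; have [r [q E]] := division (qx0 qe a); have [r' [q' E']] := division (qx1 qe a).
  exists (fun i => match split i with inl i => r i | inr i => r' i end), (io q + io q' * z).
  rewrite {1}(qxE qe a) E E' big_split_ord /= /e.
  under [X in _ = X + _ + _]eq_bigr do rewrite (unsplitK (inl _)).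
  under [X in _ = _ + X + _]eq_bigr do rewrite (unsplitK (inr _)) mulrA.
  by rewrite -mulr_suml; ring.
have [|j [a0 [q [a0n pq]]]] := poly_low_term (p := p); first exact: monic_neq0.
have [l [a' [a0E /ps_field_unit[a1 a1E]]]] := ps_order a0n.
have {}pE : b ^+ j * (io Y ^+ l * J a' + b * (map_poly J q).[b]) = io h * s.
  have JE : J a0 = io Y ^+ l * J a'.
    by rewrite a0E rmorphM rmorphXn /= /ps_constY ps_map_var.
  by rewrite -pE pq horner_map_low JE; ring.
have [h' gh'] := ps_field_unit g0.
pose v := ps_const (h' * c1 ^+ d) : P.
have [|t tE] := @redX_eq0 (c ^+ d - io h * io v).
  rewrite -rE rmorphB rmorphM rmorphXn cE !rE !(qx_io qe _).1 hE /v /ps_const /=.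
  transitivity (ps_var ^+ d * c1 ^+ d * (1 - g * h')); first by rewrite exprMn; ring.
  by rewrite gh'; ring.
(* c^d is h v up to an element whose square is in (y). Squaring gives c^(2d) in (y, h), and the l-th
   power reaches (y^l, h). *)
have [u uE] := sum_expr_mod (io Y) t (io h) (2%:R * c ^+ d * io v - io h * io v ^+ 2) l.
have {uE} uE : c ^+ (d * 2 * l) = io Y ^+ l * t ^+ l + io h * u.
  by rewrite -uE -tE exprM; congr (_ ^+ _); rewrite exprM; ring.
exists j, (d * 2 * l)%N, ((map_poly J q).[b] * J a1 * t ^+ l), (s * J a1 * t ^+ l + b ^+ j * u).
rewrite uE; have one : J a' * J a1 = 1 by rewrite -rmorphM a1E rmorph1.
transitivity (b ^+ j * (io Y ^+ l * J a' + b * (map_poly J q).[b]) * J a1 * t ^+ l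
   + b ^+ j * io Y ^+ l * t ^+ l * (1 - J a' * J a1) + io h * b ^+ j * u); first by ring.
by rewrite one pE; ring.
Qed.

(** The inclusion of A in k[[x,t]] given by y = t^2 and z = x t. The target is again [P], whose
    variable [Y] now stands for t. *)
Lemma quad_emb : exists emb : {rmorphism A -> P},
  forall a, emb a = ps_dbl (qx0 qe a) + ps_dbl (qx1 qe a) * (X * Y).
Proof.
have [|emb [_ _ E]] := @quad_lift _ _ _ _ _ qe P (@ps_dbl K) (X * Y); last by exists emb.
by rewrite rmorphM rmorphXn /= ps_dbl_const ps_dbl_var; ring.
Qed.

Lemma ps2_no_zero_div : no_zero_div P.
Proof. exact/ps_no_zero_div/ps_field_no_zero_div. Qed.

Lemma X_neq0 : X <> 0.
Proof. by move/(congr1 (fun f : P => f 0%N 1%N))/eqP; rewrite coef_ps0 coef_ps0 oner_eq0. Qed.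

Lemma X_mul_inj (p : P) : X * p = 0 -> p = 0.
Proof. by case/ps2_no_zero_div => // /X_neq0. Qed.

Lemma quad_emb_inj (emb : {rmorphism A -> P}) :
  (forall a, emb a = ps_dbl (qx0 qe a) + ps_dbl (qx1 qe a) * (X * Y)) ->
  forall a, emb a = 0 -> a = 0.
Proof.
move=> embE a; rewrite embE (_ : _ * (X * Y) = Y * ps_dbl (X * qx1 qe a)); last first.
  by rewrite rmorphM /= ps_dbl_const; ring.
case/ps_dbl_eq0 => a0 /X_mul_inj a1.
by rewrite (qxE qe a) a0 a1 rmorph0 mul0r addr0.
Qed.

Lemma quad_no_zero_div : no_zero_div A.
Proof.
have [emb /quad_emb_inj inj] := quad_emb.
move=> a b ab; have: emb a * emb b = 0 by rewrite -rmorphM ab rmorph0.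
by case/ps2_no_zero_div => /inj; [left|right].
Qed.

(** The norm of a is a multiple of a that lies in k[[x,y]]. It is nonzero, so it factors as y^m h
    with h nonzero modulo y, and both kinds of factors are settled. *)
Lemma one_dim_mod_neq0 (a b c : A) : a <> 0 -> max_ideal c -> one_dim_mod b c a.
Proof.
move=> a0 /max_idealE c0; have [a' [aa' a'0]] := quad_norm qe a; set n := _ - _ in aa'.
apply: (@one_dim_mod_dvd _ _ _ _ a'); rewrite aa'.
have [n0|/ps_order[m [h [-> h0]]]] := EM (n = 0).
  by move: aa'; rewrite n0 rmorph0; case/quad_no_zero_div => // /a'0 /a0.
rewrite rmorphM rmorphXn; apply: one_dim_mod_mul; last exact: one_dim_mod_monic.
elim: m => [|m IH]; last by rewrite exprS; apply: one_dim_mod_mul IH; apply: one_dim_mod_y.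
by exists 0%N, 0%N, 0, 1; ring.
Qed.

End LocalDimension.

Section KernelPrime.
Variables (A D : comNzRingType) (f : {rmorphism A -> D}).
Hypothesis domD : no_zero_div D.

Definition ker_pred : pred A := fun a => f a == 0.

Lemma ker_pred_idealr : idealr_closed ker_pred.
Proof.
split; rewrite ?unfold_in /ker_pred ?rmorph0 ?rmorph1 ?oner_eq0 //.
move=> a u v; rewrite !unfold_in /ker_pred => /eqP u0 /eqP v0.
by rewrite rmorphD rmorphM u0 v0 mulr0 addr0.
Qed.

Lemma ker_pred_prime : prime_idealr_closed ker_pred.
Proof.
move=> u v; rewrite !unfold_in /ker_pred rmorphM => /eqP/domD[] ->; rewrite eqxx //.
by rewrite orbT.
Qed.

Lemma ker_prime_ex : exists p : prime_idealr A, forall a, (a \in p) = (f a == 0).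
Proof.
pose p : prime_idealr A := HB.pack ker_pred (isIdealr.Build A ker_pred ker_pred_idealr)
  (isPrimeIdealrClosed.Build A ker_pred ker_pred_prime).
by exists p.
Qed.

End KernelPrime.

Lemma prime_max_ideal (A : comNzRingType) (p : prime_idealr A) a : a \in p -> max_ideal a.
Proof.
move=> ap [b ab]; have := idealr1 p; rewrite -ab mulrC.
by rewrite (idealMr _ ap).
Qed.

Lemma prime_expr (A : comNzRingType) (p : prime_idealr A) a n : a ^+ n \in p -> a \in p.
Proof.
elim: n => [|n IH]; first by rewrite expr0 idealr1.
by rewrite exprS prime_idealrM => /orP[].
Qed.

Section Krull.
Variable k : closedFieldType.
Local Notation A := (dinf_ring k).

Lemma dinf_one_dim (a b c : A) : a <> 0 -> max_ideal c -> one_dim_mod b c a.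
Proof. exact: (one_dim_mod_neq0 (dinf_quad_ext k)). Qed.

Lemma dinf_no_zero_div : no_zero_div A.
Proof. exact: (quad_no_zero_div (dinf_quad_ext k)). Qed.

Lemma dinf_krull_dim : krull_dim_is A 2.
Proof.
pose qe := dinf_quad_ext k; split.
  have [emb embE] := quad_emb qe; have embI := quad_emb_inj embE.
  (* The chain consists of the kernels of the maps to k[[x,t]], k[[x]] and k; y and x witness the
     strict inclusions. *)
  have [p0 p0E] := ker_prime_ex emb (@ps2_no_zero_div k).
  have [redX redXE] := quad_redX qe.
  have [res resE] := quad_res qe.
  have [p2 p2E] := ker_prime_ex res (@fieldT_no_zero_div k).
  have [p1 p1E] := ker_prime_ex redX (@ps_field_no_zero_div k).
  exists (fun i => nth p2 [:: p0; p1; p2] i) => -[|[|//]] _ /=; split.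
  - by move=> a; rewrite p0E p1E => /eqP/embI ->; rewrite rmorph0.
  - exists (dinf_of (dinf_y k)); first by rewrite p1E redXE (qx_io qe _).1.
    rewrite p0E; apply/eqP => /embI/(congr1 (qx0 qe)).
    rewrite (qx_io qe _).1 -(rmorph0 (dinf_of (k := k))) (qx_io qe _).1.
    by move/(congr1 (fun f => f 1%N 0%N))/eqP; rewrite /= oner_eq0.
  - by move=> a; rewrite p1E p2E redXE resE => /eqP ->.
  - exists (dinf_of (dinf_x k)); first by rewrite p2E resE (qx_io qe _).1.
    rewrite p1E redXE (qx_io qe _).1; apply/eqP => /(congr1 (fun f => f 1%N))/eqP.
    by rewrite /= oner_eq0.
move=> p e pe; rewrite leqNgt; apply/negP => lt2e.
have [sub0 [a a1 a0]] := pe 0%N (ltnW (ltnW lt2e)).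
have [sub1 [b b2 b1]] := pe 1%N (ltnW lt2e).
have [sub2 [c c3 c2]] := pe 2%N lt2e.
have an0 : a <> 0 by move=> e0; move: a0; rewrite e0 rpred0.
(* With a, b, c taken from the successive gaps, b^M (c^N + b r) = a s lies in p_1. As b is not in
   p_1 but in p_2, this forces c into p_2, against its choice. *)
have [M [N [r [s E]]]] := dinf_one_dim b an0 (prime_max_ideal c3).
have: b ^+ M * (c ^+ N + b * r) \in p 1%N by rewrite E mulrC idealMr.
rewrite prime_idealrM => /orP[/prime_expr bp|/sub1 cp]; first by rewrite bp in b1.
have: c ^+ N \in p 2%N.
  by rewrite -(addrK (b * r) (c ^+ N)) rpredB // mulrC idealMr.
by move/prime_expr; apply/negP.
Qed.

End Krull.

(** * Modules as square roots of x^2 y *)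

Lemma linear_ex (A : pzRingType) (M N : lmodType A) (f : M -> N) :
  linear f -> exists g : {linear M -> N}, forall x, g x = f x.
Proof.
move=> lf; pose g : {linear M -> N} := HB.pack f (GRing.isLinear.Build A M N *:%R f lf).
by exists g.
Qed.

Section ModuleMaps.
Variable A : comNzRingType.
Implicit Types M N : lmodType A.

Lemma mod_iso_bij M N (f : {linear M -> N}) :
  (forall x, f x = 0 -> x = 0) -> (forall y, exists x, f x = y) -> mod_iso M N.
Proof.
move=> inj /choice[g gE]; exists f; exists g => // x.
by apply/eqP; rewrite -subr_eq0; apply/eqP/inj; rewrite linearB gE subrr.
Qed.

Lemma mod_iso_linv M N (f : {linear M -> N}) : bijective f ->
  exists g : {linear N -> M}, cancel f g /\ cancel g f.
Proof.
move=> [g fK gK]; have [|h hE] := @linear_ex _ _ _ g.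
  by move=> a u v; apply: (can_inj fK); rewrite linearP !gK.
by exists h; split=> x; rewrite hE.
Qed.

Lemma mod_iso_sym M N : mod_iso M N -> mod_iso N M.
Proof. by move=> [f /mod_iso_linv[g [fK gK]]]; exists g; exists f. Qed.

Lemma mod_iso_trans M N N' : mod_iso M N -> mod_iso N N' -> mod_iso M N'.
Proof. by move=> [f fb] [g gb]; exists (g \o f); apply: bij_comp. Qed.

Section LinearKernel.
Variables (M N : lmodType A) (p : {linear M -> N}).

Definition lker_pred : pred M := fun x => p x == 0.
Lemma lker_pred_closed : submod_closed lker_pred.
Proof.
split=> [|a u v]; rewrite !unfold_in /lker_pred ?linear0 // => /eqP u0 /eqP v0.
by rewrite linearP u0 v0 scaler0 addr0.
Qed.
HB.instance Definition _ := GRing.isSubmodClosed.Build A M lker_pred lker_pred_closed.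

Definition lker : Type := {x : M | lker_pred x}.
HB.instance Definition _ := SubChoice.on lker.
HB.instance Definition _ := [SubChoice_isSubLmodule of lker by <:].

End LinearKernel.

(** M is the direct sum of the image of [i] and the kernel of [p], so a nonzero N leaves the kernel
    zero. The free module and the listed modules are all recognised in this way. *)
Lemma indecomposable_retract M N (i : {linear N -> M}) (p : {linear M -> N}) :
  indecomposable M -> (exists x : N, x != 0) -> (forall x, p (i x) = x) -> mod_iso M N.
Proof.
move=> [_ dec] [x0 /eqP nx0] pi.
have prP m : lker_pred p (m - i (p m)) by rewrite /lker_pred linearB pi subrr.
pose f m : (N * lker p)%type := (p m, exist _ (m - i (p m)) (prP m)).
have [|F FE] := @linear_ex _ M (N * lker p)%type f.
  move=> a u v; apply/eqP; rewrite xpair_eqE; apply/andP; split; apply/eqP.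
    by rewrite /f /= linearP.
  by apply: val_inj; rewrite /= !linearP /= addrACA -scalerDr.
have inj m : p m = 0 -> m - i (p m) = 0 -> m = 0.
  by move=> ->; rewrite linear0 subr0.
have [|N0|K0] := dec N (lker p).
- apply: (@mod_iso_bij _ _ F) => [m|[x [m m0]]]; rewrite ?FE /f.
    by case; apply: inj.
  have pm0 : p m = 0 by apply/eqP.
  have pE : p (i x + m) = x by rewrite linearD pi pm0 addr0.
  exists (i x + m); rewrite FE; apply/eqP; rewrite xpair_eqE; apply/andP; split; apply/eqP => //.
  by apply: val_inj; rewrite /= pE addrAC subrr add0r.
- by case: nx0; apply: N0.
apply: (@mod_iso_bij _ _ p) => [m pm|y]; last by exists (i y).
by apply: inj => //; move/(congr1 val): (K0 (f m).2).
Qed.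

Lemma indecomposable_idempotent M : (exists x : M, x != 0) ->
  (forall h : {linear M -> M}, (forall x, h (h x) = h x) ->
     (forall x, h x = 0) \/ (forall x, h x = x)) -> indecomposable M.
Proof.
move=> nz idem; split=> // M1 M2 [f /mod_iso_linv[g [fK gK]]].
have [|h hE] := @linear_ex _ M M (fun m => g ((f m).1, 0)).
  move=> a u v; have -> : ((f (a *: u + v)).1, 0) =
      a *: ((f u).1, 0) + ((f v).1, 0) :> (M1 * M2)%type.
    by rewrite linearP; apply/eqP; rewrite xpair_eqE /= scaler0 addr0 !eqxx.
  by rewrite linearP.
have [x|h0|h1] := idem h; first by rewrite !hE gK.
  left=> x; have := h0 (g (x, 0)); rewrite hE gK /= => /(congr1 f).
  by rewrite gK linear0 => -[].
right=> x; have := h1 (g (0, x)); rewrite hE gK /= => /(congr1 f).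
by rewrite !gK => -[].
Qed.

Lemma mod_iso_coker n (phi psi U U' V V' : 'M[A]_n) :
  U *m U' = 1%:M -> U *m phi = psi *m V -> U' *m psi = phi *m V' ->
  mod_iso (coker phi) (coker psi).
Proof.
move=> UU' e e'; have U'U := mulmx1C UU'.
have wd v : to_coker psi (U *m repr (to_coker phi v)) = to_coker psi (U *m v).
  have /to_cokerP[u uE] : to_coker phi (repr (to_coker phi v)) = to_coker phi v by apply: reprK.
  by apply/to_cokerP; exists (V *m u); rewrite -mulmxBr uE !mulmxA e.
have [|f fE] := @linear_ex _ (coker phi) (coker psi) (fun q => to_coker psi (U *m repr q)).
  move=> a; elim/coker_ind => v; elim/coker_ind => w.
  rewrite !wd -[a *: to_coker _ _ in LHS]/(coker_scale a (to_coker phi v)).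
  rewrite coker_scaleE -to_cokerD wd -[RHS]/(coker_scale a (to_coker psi _) + _).
  by rewrite coker_scaleE -to_cokerD mulmxDr scalemxAr.
apply: (@mod_iso_bij _ _ f); elim/coker_ind => v; last first.
  by exists (to_coker phi (U' *m v)); rewrite fE wd mulmxA UU' mul1mx.
rewrite fE wd -[0](_ : to_coker psi 0 = 0); last exact: raddf0.
move=> /to_cokerP[u]; rewrite subr0 => uE.
rewrite -[0](_ : to_coker phi 0 = 0); last exact: raddf0.
by apply/to_cokerP; exists (V' *m u); rewrite subr0 mulmxA -e' -mulmxA -uE mulmxA U'U mul1mx.
Qed.

End ModuleMaps.

Lemma det_unit_inv (R : comNzRingType) n (F : 'M[R]_n) c :
  \det F * c = 1 -> exists F', F *m F' = 1%:M /\ F' *m F = 1%:M.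
Proof.
move=> dc; exists (c *: \adj F).
by rewrite -scalemxAr -scalemxAl mul_mx_adj mul_adj_mx scale_scalar_mx mulrC dc.
Qed.

Definition quad_basis (P A : comNzRingType) (io : {rmorphism P -> A}) (z : A)
    (M : lmodType A) n (Z : 'M[P]_n) (e : 'cV[P]_n -> M) : Prop :=
  [/\ forall u v, e (u + v) = e u + e v,
      forall p u, e (p *: u) = io p *: e u,
      forall u, z *: e u = e (Z *m u),
      forall u, e u = 0 -> u = 0 &
      forall m, exists u, e u = m].

Definition quad_mod (P A : comNzRingType) (io : {rmorphism P -> A}) (z : A)
    (M : lmodType A) n (Z : 'M[P]_n) : Prop :=
  exists e, quad_basis io z Z (e : 'cV[P]_n -> M).

Section QuadMod.
Variables (P A : comNzRingType) (io : {rmorphism P -> A}) (z : A) (w : P).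
Hypothesis qe : quad_ext io z w.
Implicit Types M N : lmodType A.

Section Basis.
Variables (M : lmodType A) (n : nat) (Z : 'M[P]_n) (e : 'cV[P]_n -> M).
Hypothesis be : quad_basis io z Z e.

Lemma qbD u v : e (u + v) = e u + e v. Proof. by case: be. Qed.
Lemma qbZ p u : e (p *: u) = io p *: e u. Proof. by case: be. Qed.
Lemma qbz u : z *: e u = e (Z *m u). Proof. by case: be. Qed.
Lemma qb_eq0 u : e u = 0 -> u = 0. Proof. by case: be => _ _ _ h _; apply: h. Qed.
Lemma qb_surj m : exists u, e u = m. Proof. by case: be => _ _ _ _; apply. Qed.
Lemma qb0 : e 0 = 0.
Proof. by apply: (addrI (e 0)); rewrite -qbD !addr0. Qed.
Lemma qbN u : e (- u) = - e u.
Proof. by apply: (addrI (e u)); rewrite -qbD !subrr qb0. Qed.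
Lemma qb_inj : injective e.
Proof.
move=> u v uv; apply/eqP; rewrite -subr_eq0; apply/eqP/qb_eq0.
by rewrite qbD qbN uv subrr.
Qed.
Lemma qb_sum (I : finType) (F : I -> 'cV[P]_n) : e (\sum_i F i) = \sum_i e (F i).
Proof. by apply: (big_morph e qbD qb0). Qed.

Lemma quad_basis_sq : Z *m Z = w%:M.
Proof.
have zz : z * z = io w by case: qe.
suff h (u : 'cV_n) : Z *m Z *m u = w *: u.
  apply/matrixP => i j; have := congr1 (fun v : 'cV_n => v i 0) (h (delta_mx j 0)).
  by rewrite -colE !mxE => ->; rewrite mulr_natr andbT.
by apply: qb_inj; rewrite -mulmxA -!qbz scalerA zz qbZ.
Qed.

End Basis.

Lemma quad_hom M N n1 n2 (Z1 : 'M[P]_n1) (Z2 : 'M[P]_n2) e1 e2 (F : 'M[P]_(n2, n1)) :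
  quad_basis io z Z1 (e1 : _ -> M) -> quad_basis io z Z2 (e2 : _ -> N) ->
  F *m Z1 = Z2 *m F ->
  exists f : {linear M -> N}, forall u, f (e1 u) = e2 (F *m u).
Proof.
move=> b1 b2 FZ; have [c cE] := choice (qb_surj b1).
have cK u : c (e1 u) = u by apply: (qb_inj b1).
have [|f fE] := @linear_ex _ M N (fun m => e2 (F *m c m)).
  move=> a m m'; rewrite -[m]cE -[m']cE; move: (c m) (c m') => u v.
  rewrite (qxE qe a) !scalerDl -!scalerA (qbz b1) (qbz b2) -!(qbZ b1) -!(qbZ b2).
  by rewrite -!(qbD b1) -!(qbD b2) !cK !mulmxDr -!scalemxAr !mulmxA FZ.
by exists f => u; rewrite fE cK.
Qed.

Lemma quad_mod_iso M N n (Z : 'M[P]_n) :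
  quad_mod io z M Z -> quad_mod io z N Z -> mod_iso M N.
Proof.
move=> [e1 b1] [e2 b2]; have [|f fE] := @quad_hom _ _ _ _ _ _ _ _ 1%:M b1 b2.
  by rewrite mul1mx mulmx1.
apply: (@mod_iso_bij _ _ _ f) => [x|y].
  by have [u <-] := qb_surj b1 x; rewrite fE mul1mx => /(qb_eq0 b2) ->; rewrite (qb0 b1).
by have [u <-] := qb_surj b2 y; exists (e1 u); rewrite fE mul1mx.
Qed.

Lemma quad_mod_transport M N n (Z : 'M[P]_n) :
  mod_iso M N -> quad_mod io z N Z -> quad_mod io z M Z.
Proof.
move=> [f /mod_iso_linv[g [fK gK]]] [e b]; exists (fun u => g (e u)); split=> [u v|p u|u|u|m].
- by rewrite (qbD b) linearD.
- by rewrite (qbZ b) linearZ.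
- by rewrite -linearZ (qbz b).
- by move/(congr1 f); rewrite gK linear0; apply: qb_eq0 b _.
by have [u uE] := qb_surj b (f m); exists u; rewrite uE fK.
Qed.

Lemma quad_mod_conj M n (Z Z' U U' : 'M[P]_n) :
  U' *m U = 1%:M -> U' *m Z' = Z *m U' -> quad_mod io z M Z -> quad_mod io z M Z'.
Proof.
move=> U'U UZ [e b]; exists (fun u => e (U' *m u)); split=> [u v|p u|u|u|m].
- by rewrite mulmxDr (qbD b).
- by rewrite -scalemxAr (qbZ b).
- by rewrite (qbz b) !mulmxA UZ.
- move/(qb_eq0 b)/(congr1 (mulmx U)).
  by rewrite mulmx0 mulmxA (mulmx1C U'U) mul1mx.
by have [u <-] := qb_surj b m; exists (U *m u); rewrite mulmxA U'U mul1mx.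
Qed.

Lemma quad_endo M n (Z : 'M[P]_n) e (h : {linear M -> M}) :
  quad_basis io z Z e -> exists F, F *m Z = Z *m F /\ forall u, h (e u) = e (F *m u).
Proof.
move=> b; have [c cE] := choice (qb_surj b).
pose F := \matrix_(i, j) c (h (e (delta_mx j 0))) i 0.
have FE u : h (e u) = e (F *m u).
  have uE : u = \sum_j u j 0 *: delta_mx j 0.
    rewrite {1}[u]matrix_sum_delta; apply: eq_bigr => j _.
    by rewrite big_ord_recl big_ord0 addr0; congr (_ *: delta_mx _ _).
  have -> : F *m u = \sum_j u j 0 *: c (h (e (delta_mx j 0))).
    apply/colP => i; rewrite mxE summxE; apply: eq_bigr => j _.
    by rewrite !mxE mulrC.
  rewrite {1}uE !(qb_sum b) linear_sum; apply: eq_bigr => j _.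
  by rewrite !(qbZ b) linearZ cE.
exists F; split=> //; suff E (u : 'cV_n) : F *m Z *m u = Z *m F *m u.
  by apply/matrixP => i j; have := congr1 (fun v : 'cV_n => v i 0) (E (delta_mx j 0)); rewrite -!colE !mxE.
by apply: (qb_inj b); rewrite -!mulmxA -FE -!(qbz b) linearZ FE.
Qed.

Lemma quad_mod_neq0 M n (Z : 'M[P]_n.+1) : quad_mod io z M Z -> exists x : M, x != 0.
Proof.
move=> [e b]; exists (e (delta_mx 0 0)); apply/eqP => /(qb_eq0 b)/(congr1 (fun v : 'cV_n.+1 => v 0 0))/eqP.
by rewrite !mxE !eqxx oner_eq0.
Qed.

Lemma quad_mod_indecomposable M n (Z : 'M[P]_n.+1) :
  (forall F, F *m Z = Z *m F -> F *m F = F -> F = 0 \/ F = 1%:M) ->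
  quad_mod io z M Z -> indecomposable M.
Proof.
move=> idem qm; apply: indecomposable_idempotent; first exact: quad_mod_neq0 qm.
move: qm => [e b] h hh; have [F [FZ FE]] := quad_endo h b.
have [|F0|F1] := idem F FZ.
- suff E (u : 'cV_n.+1) : F *m F *m u = F *m u.
    by apply/matrixP => i j; have := congr1 (fun v : 'cV_n.+1 => v i 0) (E (delta_mx j 0)); rewrite -!colE !mxE.
  by apply: (qb_inj b); rewrite -mulmxA -!FE hh.
- by left=> x; have [u <-] := qb_surj b x; rewrite FE F0 mul0mx (qb0 b).
by right=> x; have [u <-] := qb_surj b x; rewrite FE F1 mul1mx.
Qed.

(** F2 F1 commutes with Z1, hence so does its inverse V, and V F2 gives an A-linear retraction of
    F1. *)
Lemma quad_mod_retract M N n1 n (Z1 : 'M[P]_n1.+1) (Z : 'M[P]_n) F1 F2 c :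
  F1 *m Z1 = Z *m F1 -> F2 *m Z = Z1 *m F2 -> \det (F2 *m F1) * c = 1 ->
  indecomposable M -> quad_mod io z M Z -> quad_mod io z N Z1 -> mod_iso M N.
Proof.
move=> c1 c2 /det_unit_inv[V [FV VF]] indM qM qN; have nz := quad_mod_neq0 qN.
move: qM qN => [e b] [e1 b1].
have WZ : F2 *m F1 *m Z1 = Z1 *m (F2 *m F1) by rewrite -mulmxA c1 mulmxA c2 mulmxA.
have VZ : V *m Z1 = Z1 *m V.
  by rewrite -[LHS]mulmx1 -FV mulmxA -(mulmxA V Z1) -WZ (mulmxA V) VF mul1mx.
have [i iE] := quad_hom b1 b c1; have [|p pE] := @quad_hom _ _ _ _ _ _ _ _ (V *m F2) b b1.
  by rewrite -mulmxA c2 !mulmxA VZ.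
apply: (indecomposable_retract (i := i) (p := p)) => // x.
by have [u <-] := qb_surj b1 x; rewrite iE pE mulmxA -(mulmxA V) VF mul1mx.
Qed.

Lemma mx_qx_split m n (v : 'M[A]_(m, n)) :
  v = map_mx io (map_mx (qx0 qe) v) + z *: map_mx io (map_mx (qx1 qe) v).
Proof. by apply/matrixP => i j; rewrite !mxE mulrC -qxE. Qed.

Lemma mx_qx_eq0 m n (u v : 'M[P]_(m, n)) :
  map_mx io u + z *: map_mx io v = 0 -> u = 0 /\ v = 0.
Proof.
move=> e; have un i j : u i j = 0 /\ v i j = 0.
  move/matrixP/(_ i j): e; rewrite !mxE mulrC => E.
  by case: qe => _ _; apply.
by split; apply/matrixP => i j; rewrite !mxE; case: (un i j).
Qed.

(** Since A^n = P^n + z P^n and z v is congruent to Z v, each class has a representative in P^n; the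
    condition [Z *m Z = w%:M] makes it unique. *)
Lemma coker_quad_mod n (Z : 'M[P]_n) : Z *m Z = w%:M ->
  quad_mod io z (coker (z%:M - map_mx io Z)) Z.
Proof.
move=> ZZ; set phi := _ - _; have zz : z * z = io w by case: qe.
have phiE v : phi *m v = z *: v - map_mx io Z *m v by rewrite mulmxBl mul_scalar_mx.
exists (fun u => to_coker phi (map_mx io u)); split=> [u v|p u|u|u|].
- by rewrite map_mxD to_cokerD.
- rewrite -[RHS]/(coker_scale _ _) coker_scaleE; congr to_coker.
  by apply/matrixP => i j; rewrite !mxE rmorphM.
- rewrite -[LHS]/(coker_scale _ _) coker_scaleE; apply/to_cokerP.
  by exists (map_mx io u); rewrite phiE map_mxM.
- rewrite -[0](_ : to_coker phi 0 = 0); last exact: raddf0.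
  move=> /to_cokerP[v]; rewrite subr0 phiE (mx_qx_split v).
  set a := map_mx _ v; set b := map_mx (qx1 _) v => e.
  have [] := @mx_qx_eq0 _ _ (Z *m a + u - w *: b) (Z *m b - a).
    have wE : map_mx io (w *: b) = z *: (z *: map_mx io b).
      by rewrite scalerA zz; apply/matrixP => i j; rewrite !mxE rmorphM.
    rewrite !(map_mxD, map_mxN) !map_mxM wE e mulmxDr -scalemxAr.
    move: (map_mx io a) (map_mx io b) (_ *m map_mx io a) (_ *m map_mx io b) => ? ? ? ?.
    by apply/matrixP => i j; rewrite !mxE; ring.
  move=> E /eqP; rewrite subr_eq0 => /eqP aE; move: E; rewrite -aE mulmxA ZZ mul_scalar_mx.
  by rewrite addrAC subrr add0r.
elim/coker_ind => v; exists (map_mx (qx0 qe) v + Z *m map_mx (qx1 qe) v).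
apply/to_cokerP; exists (- map_mx io (map_mx (qx1 qe) v)).
rewrite phiE map_mxD map_mxM mulmxN scalerN.
move: (mx_qx_split v); set ZB := _ *m _; set a := map_mx io _; set b := map_mx io _.
move: ZB a b => ZB a b ->.
by apply/matrixP => i j; rewrite !mxE; ring.
Qed.

End QuadMod.

(** * Depth *)

Section IdealMul.
Variables (A : comNzRingType) (M : lmodType A).
Implicit Types (a b : A) (x : M) (s : seq A).

Lemma in_ideal_mul0 x : in_ideal_mul [::] x <-> x = 0.
Proof. by split=> [[y ->]|->]; [|exists (fun=> 0)]; rewrite big_ord0. Qed.

Lemma in_ideal_mul1 a x : in_ideal_mul [:: a] x <-> exists y, x = a *: y.
Proof.
split=> [[y ->]|[y ->]]; [exists (y 0%N) | exists (fun=> y)]; by rewrite big_ord1.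
Qed.

Lemma in_ideal_mul2 a b x : in_ideal_mul [:: a; b] x <-> exists y y', x = a *: y + b *: y'.
Proof.
split=> [[y ->]|[y [y' ->]]].
  by exists (y 0%N), (y 1%N); rewrite !big_ord_recl big_ord0 addr0.
by exists (fun i => if i is 0%N then y else y'); rewrite !big_ord_recl big_ord0 addr0.
Qed.

Lemma in_ideal_mul_cat2 a b s x : in_ideal_mul [:: a; b] x -> in_ideal_mul (a :: b :: s) x.
Proof.
move/in_ideal_mul2 => [y [y' ->]].
exists (fun i => match i with 0%N => y | 1%N => y' | _ => 0 end).
rewrite !big_ord_recl big1 ?addr0 // => i _; exact: scaler0.
Qed.

Lemma in_ideal_mul_0 s : in_ideal_mul s (0 : M).
Proof. by exists (fun=> 0); rewrite big1 // => i _; rewrite scaler0. Qed.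

Lemma scale_expr_mem (P : M -> Prop) a n x :
  (forall x, P (a *: x) -> P x) -> P (a ^+ n *: x) -> P x.
Proof.
move=> reg; elim: n => [|n IH]; first by rewrite expr0 scale1r.
by rewrite exprS -scalerA => /reg.
Qed.

End IdealMul.

Lemma mx_span2 (R : comNzRingType) m n (x y : R) (Z : 'M[R]_(m, n)) :
  (forall i j, exists a b, Z i j = x * a + y * b) -> exists A B, Z = x *: A + y *: B.
Proof.
move=> dv; have {}dv (ij : 'I_m * 'I_n) : exists ab : R * R, Z ij.1 ij.2 = x * ab.1 + y * ab.2.
  by have [a [a' E]] := dv ij.1 ij.2; exists (a, a').
have [a aE] := choice dv.
exists (\matrix_(i, j) (a (i, j)).1), (\matrix_(i, j) (a (i, j)).2).
by apply/matrixP => i j; rewrite !mxE; apply: (aE (i, j)).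
Qed.

Lemma quad_z_span (P A : comNzRingType) (io : {rmorphism P -> A}) z w :
  quad_ext io z w -> forall x y a b, z = io x * a + io y * b ->
  exists a' b', x * a' + y * b' = 1.
Proof.
move=> qe x y a b zE; exists (qx1 qe a), (qx1 qe b).
have [|_ <-] // := @qx_inj _ _ _ _ _ qe 0 1 (x * qx0 qe a + y * qx0 qe b)
  (x * qx1 qe a + y * qx1 qe b).
transitivity (io x * a + io y * b); first by rewrite rmorph0 rmorph1 add0r mul1r.
by rewrite {1}(qxE qe a) {1}(qxE qe b) !(rmorphD, rmorphM); ring.
Qed.

Section DinfCM.
Variable k : closedFieldType.
Local Notation A := (dinf_ring k).
Local Notation io := (dinf_of (k := k)).
Local Notation z := (dinf_z k).
Local Notation X := (dinf_x k).
Local Notation Y := (dinf_y k).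
Local Notation P := (powser (powser k)).
Local Notation qe := (dinf_quad_ext k).

(** The relation b^m (c^n + b r) = a t that bounds the dimension also bounds the depth: on M / a M
    regularity cancels b^m, so c^n carries M into (a, b) M, and cancelling c^n gives M = (a, b)
    M. *)
Lemma dinf_depth_le2 (M : lmodType A) (s : seq A) :
  regular_seq M s -> (forall a, a \in s -> max_ideal a) -> (size s <= 2)%N.
Proof.
move: s => [|a [|b [|c s]]] // [reg [x0 nx0]] mx; case: nx0.
have reg0 (x : M) : a *: x = 0 -> x = 0.
  by move=> ax; apply/in_ideal_mul0; apply: (reg 0%N isT x); apply/in_ideal_mul0.
have reg1 (x : M) : in_ideal_mul [:: a] (b *: x) -> in_ideal_mul [:: a] x by apply: (reg 1%N isT).
have reg2 (x : M) : in_ideal_mul [:: a; b] (c *: x) -> in_ideal_mul [:: a; b] x by apply: (reg 2%N isT).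
have [a0|a0] := EM (a = 0).
  by rewrite (_ : x0 = 0); [apply: in_ideal_mul_0 | apply: reg0; rewrite a0 scale0r].
have [|m [n [r [t e]]]] := @dinf_one_dim k a b c a0; first by apply: mx; rewrite !inE eqxx !orbT.
apply: in_ideal_mul_cat2; apply: (scale_expr_mem reg2 (n := n)).
have: in_ideal_mul [:: a] ((c ^+ n + b * r) *: x0).
  apply: (scale_expr_mem reg1 (n := m)); apply/in_ideal_mul1; exists (t *: x0).
  by rewrite !scalerA e.
move=> /in_ideal_mul1[y yE]; apply/in_ideal_mul2; exists y, (- (r *: x0)).
by rewrite -yE scalerN scalerA -scalerBl addrK.
Qed.

Lemma max_ideal_x : max_ideal (io X).
Proof. by apply/(max_idealE qe); rewrite (qx_io qe _).1. Qed.
Lemma max_ideal_y : max_ideal (io Y).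
Proof. by apply/(max_idealE qe); rewrite (qx_io qe _).1. Qed.

Lemma xy_neq1 (a b : P) : X * a + Y * b <> 1.
Proof.
move/(congr1 (fun f => f 0%N 0%N)) => /eqP.
by rewrite !coef_psD !coef0_ps_mul !mul0r addr0 eq_sym oner_eq0.
Qed.

Lemma quad_mod_cm (M : lmodType A) n (Z : 'M[P]_n.+1) :
  quad_mod io z M Z -> cohen_macaulay M.
Proof.
move=> [e b]; split.
  exists n.+1, (fun i => e (delta_mx i 0)) => m; have [u <-] := qb_surj b m.
  exists (fun i => io (u i 0)); rewrite {1}[u]matrix_sum_delta (qb_sum b).
  by apply: eq_bigr => i _; rewrite big_ord_recl big_ord0 addr0 (qbZ b).
exists 2; split; last exact: dinf_krull_dim.
split=> [|s [reg mx]]; last exact: (dinf_depth_le2 reg mx).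
exists [:: io Y; io X]; split=> //; split; last first.
  by move=> a; rewrite !inE => /orP[] /eqP ->; [apply: max_ideal_y|apply: max_ideal_x].
split; last first.
  exists (e (delta_mx 0 0)) => /in_ideal_mul2[m [m']].
  have [u <-] := qb_surj b m; have [v <-] := qb_surj b m'.
  rewrite -!(qbZ b) -(qbD b) => /(qb_inj b)/(congr1 (fun v : 'cV_n.+1 => v 0 0)).
  by rewrite !mxE !eqxx addrC => /esym/xy_neq1.
move=> [|[|//]] _ m /=.
  have [u <-] := qb_surj b m; move/in_ideal_mul0; rewrite -(qbZ b) => /(qb_eq0 b) u0.
  apply/in_ideal_mul0; rewrite (_ : u = 0) ?(qb0 b) //; apply/colP => i.
  move/colP/(_ i): u0; rewrite !mxE => e0; apply: ps_var_inj.
  by rewrite /= e0 mulr0.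
move=> /in_ideal_mul1[m']; have [u <-] := qb_surj b m; have [v <-] := qb_surj b m'.
rewrite -!(qbZ b) => /(qb_inj b) E; apply/in_ideal_mul1.
have dv i : exists g, u i 0 = Y * g.
  apply: ps_var_div; move/colP/(_ i)/(congr1 (fun f => f 0%N)): E.
  rewrite !mxE coef_varM coef_constM => E; apply: ps_var_inj.
  by rewrite /= mulr0; apply: E.
have [g gE] := choice dv; exists (e (\col_i g i)); rewrite -(qbZ b); congr e.
by apply/colP => i; rewrite !mxE gE.
Qed.

Lemma split_xy (p : P) : p 0%N 0%N = 0 -> exists a b, p = X * a + Y * b.
Proof.
move=> p0; have [g gE] := ps_var_div p0; exists (ps_const g), (ps_tail p).
by rewrite {1}[p]ps_split gE rmorphM.
Qed.

(** With all entries of Z in (x, y), z M lies in (x, y) M. In a nonzero free module this would put z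
    in (x, y) A, against the basis 1, z of A over P. *)
Lemma quad_mod_nonfree (M : lmodType A) n (Z : 'M[P]_n.+1) :
  (forall i j, Z i j 0%N 0%N = 0) -> quad_mod io z M Z -> ~ free_mod M.
Proof.
move=> Z0 qm [r [f /mod_iso_linv[g [fK gK]]]]; have [x0 nx0] := quad_mod_neq0 qm.
case: qm => e b; case: r f g fK gK => [|r] f g fK gK.
  by case/eqP: nx0; rewrite -[x0]fK (_ : f x0 = 0) ?linear0 //; apply/colP => -[].
have zM (m : M) : exists m1 m2, z *: m = io X *: m1 + io Y *: m2.
  have [u <-] := qb_surj b m.
  have [Z1 [Z2 ZE]] := mx_span2 (fun i j => split_xy (Z0 i j)).
  exists (e (Z1 *m u)), (e (Z2 *m u)).
  by rewrite -!(qbZ b) -(qbD b) (qbz b) !scalemxAl -mulmxDl -ZE.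
have [m1 [m2]] := zM (g (delta_mx 0 0)).
move/(congr1 f); rewrite -linearZ gK linearD !linearZ => /(congr1 (fun v : 'cV_r.+1 => v 0 0)).
rewrite !mxE !eqxx mulr1 => /(quad_z_span qe)[a [a']].
exact: xy_neq1.
Qed.

End DinfCM.

(** * Freeness over the regular subring *)

Definition noetherian (R : comNzRingType) : Prop :=
  forall N : R -> Prop, N 0 -> (forall a b, N a -> N b -> N (a + b)) ->
  (forall c a, N a -> N (c * a)) ->
  exists (I : finType) (g : I -> R), (forall i, N (g i)) /\
    forall a, N a -> exists c : I -> R, a = \sum_i c i * g i.

Lemma closed_sum (V : nmodType) (N : V -> Prop) (I : finType) (F : I -> V) :
  N 0 -> (forall a b, N a -> N b -> N (a + b)) -> (forall i, N (F i)) -> N (\sum_i F i).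
Proof. by move=> N0 ND NF; elim/big_ind: _ => // i _; apply: NF. Qed.

Lemma noetherian_field (k : fieldType) : noetherian k.
Proof.
move=> N N0 _ NM; have [[a [Na /eqP a0]]|all0] := EM (exists a, N a /\ a <> 0).
  exists unit, (fun=> a); split=> // b _; exists (fun=> b / a).
  by rewrite big_const card_unit iterS addr0 mulfVK.
exists void, (of_void k); split=> [[]|a Na]; exists (fun=> 0).
rewrite big1 => [|[]]; apply: contrapT => a0; apply: all0.
by exists a.
Qed.

Lemma noetherian_image (R R' : comNzRingType) (f : {rmorphism R -> R'}) :
  (forall b, exists a, f a = b) -> noetherian R -> noetherian R'.
Proof.
move=> /choice[h hE] noeth N N0 ND NM.
have [|a b||I [g [gN gE]]] := noeth (fun a => N (f a)); first by rewrite rmorph0.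
- by rewrite rmorphD; apply: ND.
- by move=> c a Na; rewrite rmorphM; apply: NM.
exists I, (fun i => f (g i)); split=> // b Nb.
have [|c cE] := gE (h b); first by rewrite hE.
exists (fun i => f (c i)); rewrite -[b]hE cE rmorph_sum.
by apply: eq_bigr => i _; rewrite rmorphM.
Qed.

(** * Hilbert's basis theorem for power series *)

Section NoetherianPowser.
Variable R : comNzRingType.
Hypothesis noethR : noetherian R.
Local Notation T := (@ps_var R : powser R).

Section Ideal.
Variable N : powser R -> Prop.
Hypothesis N0 : N 0.
Hypothesis ND : forall a b, N a -> N b -> N (a + b).
Hypothesis NM : forall c a, N a -> N (c * a).

Let NB a b : N a -> N b -> N (a - b).
Proof. by move=> Na Nb; rewrite -mulN1r; apply/ND/NM. Qed.

(** Coefficients of T^j of the elements of N of order at least j. These ideals of R increase with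
    j. *)
Let lead j (c : R) := exists g, N (T ^+ j * g) /\ g 0%N = c.

Let lead0 j : lead j 0. Proof. by exists 0; rewrite mulr0. Qed.
Let leadD j a b : lead j a -> lead j b -> lead j (a + b).
Proof.
by move=> [g [Ng <-]] [h [Nh <-]]; exists (g + h); rewrite mulrDr; split=> //; apply: ND.
Qed.
Let leadM j c a : lead j a -> lead j (c * a).
Proof.
move=> [g [Ng <-]]; exists (ps_const c * g); rewrite mulrCA; split; first exact: NM.
by rewrite coef_constM.
Qed.
Let lead_mono i j a : (i <= j)%N -> lead i a -> lead j a.
Proof.
move=> le [g [Ng <-]]; exists g; split=> //.
by rewrite -(subnK le) exprD -mulrA; apply: NM.
Qed.

Let lead_gens j : exists (I : finType) (g : I -> powser R), (forall i, N (T ^+ j * g i)) /\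
  forall a, lead j a -> exists c : I -> R, a = \sum_i c i * g i 0%N.
Proof.
have [I [c [cl cE]]] := noethR (lead0 j) (@leadD j) (@leadM j).
have [g gE] := choice cl; exists I, g; split=> [i|a /cE[d ->]]; first by case: (gE i).
by exists d; apply: eq_bigr => i _; case: (gE i) => _ ->.
Qed.

Let lead_stable : exists d, forall j a, lead j a -> lead d a.
Proof.
have [||c a|I [c [cl cE]]] := noethR (N := fun a => exists j, lead j a).
- by exists 0%N.
- move=> a b [i ai] [j bj]; exists (maxn i j).
  by apply: leadD; [apply: lead_mono ai | apply: lead_mono bj]; rewrite ?leq_maxl ?leq_maxr.
- by move=> [j aj]; exists j; apply: leadM.
have [f fE] := choice cl; exists (\max_i f i) => j a aj.
have [|b ->] := cE a; first by exists j.
apply: closed_sum => [|a' b'|i]; [exact: lead0 | exact: leadD |].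
apply: leadM; apply: lead_mono (fE i); exact: leq_bigmax.
Qed.

Let fg_above j := exists (I : finType) (g : I -> powser R), (forall i, N (g i)) /\
  forall h, N (T ^+ j * h) -> exists c : I -> powser R, T ^+ j * h = \sum_i c i * g i.

Let coef_sum (I : finType) (F : I -> powser R) n : (\sum_i F i) n = \sum_i F i n.
Proof. by elim/big_ind2: _ => [|a b c d <- <-|//]; rewrite ?coef_ps0 ?coef_psD. Qed.

(* Once the leading coefficients stabilize at order d, the coefficients of the
   combination are produced one power of T at a time. *)
Let fg_above_stable d : (forall j a, lead j a -> lead d a) -> fg_above d.
Proof.
move=> stab; have [I [g [gN gE]]] := lead_gens d.
exists I, (fun i => T ^+ d * g i); split=> // h Nh.
have step (f : powser R) : exists cf : (I -> R) * powser R,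
    (exists l, N (T ^+ (d + l) * f)) -> f = \sum_i ps_const (cf.1 i) * g i + T * cf.2.
  have [[l Nf]|no] := EM (exists l, N (T ^+ (d + l) * f)); last by exists (fun=> 0, 0).
  have [|c cE] := gE (f 0%N); first by apply: (stab (d + l)%N); exists f.
  have [|r rE] := @ps_var_div _ (f - \sum_i ps_const (c i) * g i).
    rewrite coef_ps_sub cE coef_sum; apply/eqP; rewrite subr_eq0; apply/eqP.
    by apply: eq_bigr => i _; rewrite coef_constM.
  by exists (c, r) => _; rewrite -rE addrC subrK.
have [st stE] := choice step.
have [a [u [a0 aE]]] := stream_unfold st h.
have aS n : N (T ^+ (d + n) * a n) /\
    h = \sum_i (\sum_(j < n) ps_const (u j i) * T ^+ j) * g i + T ^+ n * a n.
  elim: n => [|n [Na hE]].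
    rewrite addn0 a0 expr0 mul1r big1 ?add0r // => i _.
    by rewrite big_ord0 mul0r.
  have := stE (a n) (ex_intro _ n Na); rewrite aE /= => anE; split.
    rewrite (_ : _ * _ = T ^+ (d + n) * a n - \sum_i T ^+ n * ps_const (u n i) * (T ^+ d * g i)).
      by apply: NB => //; apply: closed_sum => // i; apply: NM.
    rewrite anE mulrDr mulrA -exprSr addnS mulr_sumr addrAC.
    by rewrite -sumrB big1 ?add0r // => i _; rewrite exprD; ring.
  rewrite {1}hE {1}anE mulrDr mulr_sumr mulrA -exprSr addrA; congr (_ + _).
  by rewrite -big_split; apply: eq_bigr => i _; rewrite /= big_ord_recr /=; ring.
exists (fun i n => u n i).
under eq_bigr do rewrite mulrCA.
rewrite -mulr_sumr; congr (_ * _); apply/eqP; rewrite -subr_eq0; apply/eqP.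
apply: ps_eq0_divX => n; have [_ {1}->] := aS n.
(* The series of digits agrees with its n-th partial sum modulo T^n, so h and the full combination
   differ by a multiple of T^n for every n. *)
have cut i : exists t, (fun m => u m i) = \sum_(j < n) ps_const (u j i) * T ^+ j + T ^+ n * t :> powser R.
  elim: n => [|n [t tE]]; first by exists (fun m => u m i); rewrite big_ord0 expr0 mul1r add0r.
  have t0 : t 0%N = u n i.
    move/(congr1 (fun f => f n)): tE; rewrite coef_psD coef_varXM leqnn subnn => ->.
    rewrite coef_sum big1 ?add0r // => j _.
    by rewrite mulrC coef_varXM coef_const; case: (ltngtP j n) (ltn_ord j) => // lt _; rewrite subn_eq0 leqNgt lt.
  exists (ps_tail t); rewrite tE {1}[t]ps_split t0 big_ord_recr /= exprSr; ring.
have [t tE] := choice cut.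
exists (a n - \sum_i t i * g i).
have -> : \sum_i ((fun m => u m i) : powser R) * g i =
    \sum_i (\sum_(j < n) ps_const (u j i) * T ^+ j) * g i + T ^+ n * \sum_i t i * g i.
  by rewrite mulr_sumr -big_split; apply: eq_bigr => i _; rewrite tE /=; ring.
ring.
Qed.

(** Descent from the stable order d: passing from T^(d+1) to T^d costs finitely many further
    generators, which account for the leading coefficients of order d. *)
Let fg_all : fg_above 0.
Proof.
have [d stab] := lead_stable; have := fg_above_stable stab.
elim: d {stab} => // d IH [I [g [gN gE]]]; apply: IH.
have [J [f [fN fE]]] := lead_gens d.
exists (I + J)%type, (fun ij => match ij with inl i => g i | inr j => T ^+ d * f j end).
split=> [[]//|h Nh]; have [|c cE] := fE (h 0%N); first by exists h.
have [|h' hE] := @ps_var_div _ (h - \sum_j ps_const (c j) * f j).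
  rewrite coef_ps_sub cE coef_sum; apply/eqP; rewrite subr_eq0; apply/eqP.
  by apply: eq_bigr => i _; rewrite coef_constM.
have sE : T ^+ d * h = T ^+ d.+1 * h' + \sum_j ps_const (c j) * (T ^+ d * f j).
  under eq_bigr do rewrite mulrCA.
  by rewrite exprSr -mulrA -hE -mulr_sumr -mulrDr subrK.
have [|b bE] := gE h'.
  rewrite (_ : _ * _ = T ^+ d * h - \sum_j ps_const (c j) * (T ^+ d * f j)); last first.
    by rewrite sE addrK.
  by apply: NB => //; apply: closed_sum => // j; apply: NM.
exists (fun ij => match ij with inl i => b i | inr j => ps_const (c j) end).
by rewrite big_sumType /= sE bE.
Qed.

Lemma powser_ideal_fg : exists (I : finType) (g : I -> powser R), (forall i, N (g i)) /\
  forall a, N a -> exists c : I -> powser R, a = \sum_i c i * g i.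
Proof.
have [I [g [gN gE]]] := fg_all; exists I, g; split=> // a Na.
by have := gE a; rewrite expr0 mul1r; apply.
Qed.

End Ideal.

Lemma noetherian_powser : noetherian (powser R).
Proof. by move=> N; apply: powser_ideal_fg. Qed.

End NoetherianPowser.

Fixpoint mod_span (A : pzRingType) (M : lmodType A) (s : seq M) (m : M) : Prop :=
  if s is a :: s' then exists c, mod_span s' (m - c *: a) else m = 0.

Lemma mod_span_closed (A : pzRingType) (M : lmodType A) (s : seq M) :
  [/\ mod_span s 0, forall m m', mod_span s m -> mod_span s m' -> mod_span s (m + m') &
    forall a m, mod_span s m -> mod_span s (a *: m)].
Proof.
elim: s => [|e s [S0 SD SZ]]; first by split=> [|m m' -> ->|a m ->]; rewrite ?addr0 ?scaler0.
split=> [|m m' [c mc] [c' mc']|a m [c mc]] /=.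
- by exists 0; rewrite scale0r subr0.
- by exists (c + c'); rewrite scalerDl opprD addrACA; apply: SD.
by exists (a * c); rewrite -scalerA -scalerBr; apply: SZ.
Qed.

(** Induction on the spanning list: the possible coefficients of [e] form an ideal, and once
    finitely many elements of N realise its generators, what remains lies in the span of the
    tail. *)
Lemma noetherian_submodule (A : comNzRingType) (M : lmodType A) (s : seq M) :
  noetherian A -> forall N : M -> Prop, N 0 -> (forall m m', N m -> N m' -> N (m + m')) ->
  (forall a m, N m -> N (a *: m)) -> (forall m, N m -> mod_span s m) ->
  exists (I : finType) (g : I -> M), (forall i, N (g i)) /\
    forall m, N m -> exists c : I -> A, m = \sum_i c i *: g i.
Proof.
move=> noeth; elim: s => [|e s IH] N N0 ND NZ NS.
  exists void, (of_void M); split=> [[]|m /NS ->]; exists (fun=> 0).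
  by rewrite big1 => [|[]].
have [S0 SD SZ] := mod_span_closed s.
have [||c a|I [g [gN gE]]] := noeth (fun c => exists m, N m /\ mod_span s (m - c *: e)).
- by exists 0; rewrite scale0r subr0.
- move=> a b [m [Nm am]] [m' [Nm' bm']]; exists (m + m'); split; first exact: ND.
  by rewrite scalerDl opprD addrACA; apply: SD.
- move=> [m [Nm am]]; exists (c *: m); split; first exact: NZ.
  by rewrite -scalerA -scalerBr; apply: SZ.
have [f fE] := choice gN.
have [||a m [Nm sm]|m []//|J [h [hN hE]]] := IH (fun m => N m /\ mod_span s m).
- by [].
- by move=> m m' [? ?] [? ?]; split; [apply: ND | apply: SD].
- by split; [apply: NZ | apply: SZ].
exists (I + J)%type, (fun ij => match ij with inl i => f i | inr j => h j end).
split=> [[i|j]|m Nm]; [by case: (fE i) | by case: (hN j) |].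
have [c mc] := NS m Nm; have [|d dE] := gE c; first by exists m.
have [|b bE] := hE (m - \sum_i d i *: f i).
  split.
    rewrite -scaleN1r; apply/ND/NZ => //; apply: closed_sum => // i.
    by apply: NZ; case: (fE i).
  rewrite (_ : _ - _ = (m - c *: e) + \sum_i (- d i) *: (f i - g i *: e)).
    by apply: (SD) => //; apply: (closed_sum S0 SD) => i; apply: SZ; case: (fE i).
  rewrite -addrA; congr (_ + _); rewrite dE scaler_suml -!sumrN -big_split.
  by apply: eq_bigr => i _; rewrite /= scaleNr scalerBr scalerA opprB addrA addNr add0r.
exists (fun ij => match ij with inl i => d i | inr j => b j end).
by rewrite big_sumType /= -bE addrC subrK.
Qed.

Section Combination.
Variables (P A : comNzRingType) (io : {rmorphism P -> A}) (M : lmodType A).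
Variables (n : nat) (e : 'I_n -> M).

Definition combi (u : 'cV[P]_n) : M := \sum_i io (u i 0) *: e i.

Lemma combiD u v : combi (u + v) = combi u + combi v.
Proof. by rewrite -big_split; apply: eq_bigr => i _; rewrite mxE rmorphD scalerDl. Qed.

Lemma combiZ p u : combi (p *: u) = io p *: combi u.
Proof. by rewrite scaler_sumr; apply: eq_bigr => i _; rewrite mxE rmorphM scalerA. Qed.

Lemma combiB u v : combi (u - v) = combi u - combi v.
Proof. by rewrite combiD -[- v]scaleN1r combiZ rmorphN1 scaleN1r. Qed.

Lemma combi_mul m (F : 'I_m -> 'cV[P]_n) (u : 'cV[P]_m) :
  \sum_j io (u j 0) *: combi (F j) = combi ((\matrix_(i, j) F j i 0) *m u).
Proof.
rewrite (_ : _ *m u = \sum_j u j 0 *: F j).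
  have c0 : combi 0 = 0 by rewrite /combi big1 // => i _; rewrite mxE rmorph0 scale0r.
  by rewrite (big_morph combi combiD c0); apply: eq_bigr => j _; rewrite combiZ.
apply/colP => i; rewrite mxE summxE; apply: eq_bigr => j _.
by rewrite !mxE mulrC.
Qed.

End Combination.

Lemma combi_drop (P A : comNzRingType) (io : {rmorphism P -> A}) (M : lmodType A)
    n (e : 'I_n.+1 -> M) (u : 'cV[P]_n.+1) i c :
  u i 0 * c = 1 -> combi io e u = 0 ->
  (forall m, exists v, combi io e v = m) ->
  forall m, exists v, combi io (e \o lift i) v = m.
Proof.
move=> uc; rewrite /combi (bigD1_ord i) //= => u0 surj m.
have [v <-] := surj m; rewrite (bigD1_ord i) //=.
exists (\col_j (v (lift i j) 0 - v i 0 * c * u (lift i j) 0)).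
have -> : e i = - \sum_j io (c * u (lift i j) 0) *: e (lift i j).
  transitivity (io c *: (io (u i 0) *: e i)).
    by rewrite scalerA -rmorphM mulrC uc rmorph1 scale1r.
  move: u0 => /(canRL (addrK _)) ->; rewrite sub0r scalerN scaler_sumr.
  by congr (- _); apply: eq_bigr => j _; rewrite scalerA rmorphM.
rewrite scalerN scaler_sumr addrC -sumrB; apply: eq_bigr => j _.
by rewrite mxE rmorphB scalerBl scalerA -rmorphM mulrA.
Qed.

Section QuadBasisOfCombi.
Variables (P A : comNzRingType) (io : {rmorphism P -> A}) (z : A).

Lemma quad_mod_combi (M : lmodType A) n (e : 'I_n -> M) :
  (forall m, exists v, combi io e v = m) -> (forall v, combi io e v = 0 -> v = 0) ->
  exists Z : 'M_n, quad_mod io z M Z.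
Proof.
move=> surj inj; have [f fE] := choice (fun j => surj (z *: e j)).
exists (\matrix_(i, j) f j i 0), (combi io e); split=> //.
- exact: combiD.
- exact: combiZ.
move=> u; rewrite -combi_mul scaler_sumr; apply: eq_bigr => j _.
by rewrite fE !scalerA mulrC.
Qed.

End QuadBasisOfCombi.

Lemma col_span2 (R : comNzRingType) n (x y : R) (u : 'cV[R]_n) (a b : 'I_n -> R) :
  (forall i, u i 0 = x * a i + y * b i) -> u = x *: (\col_i a i) + y *: (\col_i b i).
Proof. by move=> uE; apply/colP => i; rewrite !mxE. Qed.

Lemma col_sub_scale (R : comNzRingType) n (y : R) (a : 'I_n -> R) (d : 'cV[R]_n) i :
  (\col_i a i - y *: d) i 0 = a i - y * d i 0.
Proof. by rewrite !mxE. Qed.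

Lemma col_span1 (R : comNzRingType) n (y : R) (u : 'cV[R]_n) (a : 'I_n -> R) :
  (forall i, u i 0 = y * a i) -> u = y *: (\col_i a i).
Proof. by move=> uE; apply/colP => i; rewrite !mxE. Qed.

(** * From a regular sequence over A to a basis over k[[x,y]] *)

Section CohenMacaulayFree.
Variable k : closedFieldType.
Local Notation A := (dinf_ring k).
Local Notation io := (dinf_of (k := k) : {rmorphism powser (powser k) -> dinf_ring k}).
Local Notation z := (dinf_z k).
Local Notation X := (dinf_x k).
Local Notation Y := (dinf_y k).
Local Notation P := (powser (powser k)).
Local Notation qe := (dinf_quad_ext k).

Lemma noetherian_dinf : noetherian A.
Proof.
apply: (noetherian_image (f := \pi_(dinf_ring k) : {rmorphism powser3 k -> A})).
  by move=> b; elim/quotP: b => s _; exists s.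
by do 3 apply: noetherian_powser; apply: noetherian_field.
Qed.

Lemma max_ideal_one_sub (a s : A) : max_ideal s -> exists b, (1 - a * s) * b = 1.
Proof.
have [res resE] := quad_res qe.
move=> /(max_idealE qe); rewrite -resE => s0.
have /quad_unit // : qx0 qe (1 - a * s) 0%N 0%N <> 0.
by rewrite -resE rmorphB rmorphM s0 mulr0 rmorph1 subr0; apply/eqP/oner_neq0.
Qed.

(** Up to (x, y), a non-unit is a multiple of z, and z^2 = x^2 y. This lets a regular sequence s0,
    s1 be compared with y, x. *)
Lemma max_ideal_sq (s : A) : max_ideal s -> exists a b, s ^+ 2 = io X * a + io Y * b.
Proof.
move=> /(max_idealE qe)/split_xy; move: (qxE qe s); set p := qx0 _ s; set q := qx1 _ s.
move=> sE [a [b pE]].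
exists (io a * (io p + 2%:R * io q * z)), (io b * (io p + 2%:R * io q * z) + io q ^+ 2 * io X ^+ 2).
have zz : z * z = io X ^+ 2 * io Y by case: qe => ->; rewrite rmorphM expr2 rmorphM.
have {}pE : io p = io X * io a + io Y * io b by rewrite pE rmorphD !rmorphM.
transitivity (io p * (io p + 2%:R * io q * z) + io q ^+ 2 * (z * z)).
  by rewrite sE; ring.
by rewrite zz {1}pE; ring.
Qed.

Variable M : lmodType A.
Variables s0 s1 : A.
Hypothesis (max0 : max_ideal s0) (max1 : max_ideal s1).
Hypothesis reg0 : forall m : M, s0 *: m = 0 -> m = 0.
Hypothesis reg1 : forall m m' : M, s1 *: m = s0 *: m' -> exists m'', m = s0 *: m''.

Section Generators.
Variables (l : seq M).
Hypothesis gen : forall m, mod_span l m.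

(** Krull's intersection argument: iterated division of m by s0 gives an ascending chain of cyclic
    submodules A a_i, which becomes stationary; then a_(j+1) = b s0 a_(j+1), and 1 - b s0 is a
    unit. *)
Lemma cm_divisible_eq0 (N : M -> Prop) : (forall m, N m -> exists m', N m' /\ m = s0 *: m') ->
  forall m, N m -> m = 0.
Proof.
move=> dv m Nm; have [f fE] : exists f : M -> M, forall m, N m -> N (f m) /\ m = s0 *: f m.
  have H (m' : M) : exists m'', N m' -> N m'' /\ m' = s0 *: m''.
    by have [/dv[m'' ?]|?] := EM (N m'); [exists m'' | exists 0].
  by have [f fE] := choice H; exists f.
pose a i := iter i f m; have Na i : N (a i) by elim: i => //= i /fE[].
have aS i : a i = s0 *: a i.+1 by case: (fE _ (Na i)).
have aD i j : a i = s0 ^+ j *: a (i + j)%N.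
  elim: j => [|j IH]; first by rewrite addn0 scale1r.
  by rewrite IH aS scalerA -exprSr addnS.
have [|m1 m2 [i [b ->]] [j [c ->]]|c m1 [i [b ->]]||I [g [gN gE]]] := @noetherian_submodule A M l noetherian_dinf
    (fun m => exists i b, m = b *: a i).
- by exists 0%N, 0; rewrite scale0r.
- exists (i + j)%N, (b * s0 ^+ j + c * s0 ^+ i); rewrite scalerDl -!scalerA -aD.
  by rewrite [(i + j)%N]addnC -aD.
- by exists i, (c * b); rewrite scalerA.
- by move=> m1 _.
have [h hE] := choice gN; pose j := \max_i h i.
have [|c cE] := gE (a j.+1); first by exists j.+1, 1; rewrite scale1r.
have [b bE] : exists b, a j.+1 = b *: a j.
  rewrite cE; apply: (@closed_sum _ (fun m => exists b, m = b *: a j)) => [|m1 m2 [b1 ->] [b2 ->]|i].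
  - by exists 0; rewrite scale0r.
  - by exists (b1 + b2); rewrite scalerDl.
  have hij : (h i <= j)%N by apply: leq_bigmax.
  have [b ->] := hE i; exists (c i * (b * s0 ^+ (j - h i)%N)).
  by rewrite (aD (h i) (j - h i)%N) subnKC // !scalerA mulrA.
have [d dE] := max_ideal_one_sub b max0.
have aj0 : a j.+1 = 0.
  rewrite -[a j.+1]scale1r -dE mulrC -scalerA scalerBl scale1r -scalerA -aS -bE.
  by rewrite subrr scaler0.
by have := aD 0%N j.+1; rewrite add0n aj0 scaler0.
Qed.

(** The kernel of y is divisible by s0: since some s0^i (s1^j + s0 r) is in (y), s1^j m is in s0 M,
    so m = s0 m' by regularity, and again y m' = 0. *)
Lemma cm_y_inj (m : M) : io Y *: m = 0 -> m = 0.
Proof.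
move: m; apply: (@cm_divisible_eq0 (fun m => io Y *: m = 0)) => m ym.
have Y0 : (io Y : A) <> 0.
  move=> e; have := io_inj qe (etrans e (esym (rmorph0 io))).
  by move/(congr1 (fun f : P => f 1%N 0%N))/eqP; rewrite oner_eq0.
have [i [j [r [t e]]]] := dinf_one_dim s0 Y0 max1.
have: s0 ^+ i *: ((s1 ^+ j + s0 * r) *: m) = 0 by rewrite scalerA e mulrC -scalerA ym scaler0.
move/(scale_expr_mem (P := fun m => m = 0) reg0).
rewrite scalerDl addrC => /eqP; rewrite addr_eq0 eq_sym eqr_oppLR => /eqP E.
have [m' mE] : exists m', m = s0 *: m'.
  apply: (scale_expr_mem (P := fun m => exists m', m = s0 *: m') (a := s1) (n := j)).
    by move=> m1 [m2 /reg1].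
  by exists (- (r *: m)); rewrite E scalerN scalerA.
exists m'; split=> //; apply: reg0; rewrite scalerA mulrC -scalerA -mE.
exact: ym.
Qed.

(** A Koszul argument: s0^2 and s1^2 lie in (x, y), hence s0^2 m = y n0 and s1^2 m = y n1.
    Cancelling y gives s1^2 n0 = s0^2 n1, so n0 = s0^2 n by regularity, and m = y n. *)
Lemma cm_x_inj (m m' : M) : io X *: m = io Y *: m' -> exists m'', m = io Y *: m''.
Proof.
move=> xy; have [a [b s0E]] := max_ideal_sq max0; have [c [d s1E]] := max_ideal_sq max1.
have sm s a' b' : s ^+ 2 = io X * a' + io Y * b' -> s ^+ 2 *: m = io Y *: (a' *: m' + b' *: m).
  move=> ->; rewrite scalerDl scalerDr mulrC -!scalerA xy; congr (_ + _).
  by rewrite !scalerA mulrC.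
have reg1' (m1 m2 : M) : s1 *: m1 = s0 ^+ 2 *: m2 -> exists m3, m1 = s0 ^+ 2 *: m3.
  rewrite expr2 -scalerA => e1; have [m3 m1E] := reg1 e1; move: e1; rewrite m1E.
  rewrite scalerA mulrC -scalerA => /eqP; rewrite -subr_eq0 -scalerBr => /eqP/reg0/eqP.
  by rewrite subr_eq0 => /eqP/reg1[m4 ->]; exists m4; rewrite scalerA.
have [n nE] : exists n, a *: m' + b *: m = s0 ^+ 2 *: n.
  apply: (scale_expr_mem (P := fun m => exists m', m = s0 ^+ 2 *: m') (a := s1) (n := 2%N)).
    by move=> m1 [m2 /reg1'].
  exists (c *: m' + d *: m); apply/eqP; rewrite -subr_eq0; apply/eqP/cm_y_inj.
  rewrite scalerBr !scalerA ![io Y * _]mulrC -!scalerA -(sm _ _ _ s0E) -(sm _ _ _ s1E).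
  by rewrite !scalerA mulrC subrr.
exists n; apply/eqP; rewrite -subr_eq0; apply/eqP/reg0/reg0.
rewrite scalerA -expr2 scalerBr (sm _ _ _ s0E) nE !scalerA mulrC subrr //.
Qed.

Section Minimal.
Variables (n : nat) (e : 'I_n -> M).
Hypothesis min : forall n' (e' : 'I_n' -> M), (n' < n)%N ->
  ~ forall m, exists v, combi io e' v = m.
Hypothesis surj : forall m, exists v, combi io e v = m.

Lemma cm_relation_nonunit u i : combi io e u = 0 -> u i 0 0%N 0%N = 0.
Proof.
move=> eu; apply: contrapT => /ps2_unit[c uc].
case: n e min surj u i eu uc => [|n1] e1 min1 surj1 u [i lti] //.
move: {lti}(Ordinal lti) => {}i eu uc; apply: (min1 n1 (e1 \o lift i)) => //.
exact: combi_drop uc eu surj1.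
Qed.

(** Each step gains one power of x modulo y. Write u = x a + y b; then x times the combination of a
    is in y M, so that combination is y m. If m is the combination of d, then a - y d is a relation,
    to which the induction hypothesis applies. *)
Lemma cm_relation_mod_y j u : combi io e u = 0 -> forall i q, (q < j)%N -> u i 0 0%N q = 0.
Proof.
elim: j u => [|j IH] u eu i q ltqj //.
have /choice[g gE] : forall i, exists g, u i 0 0%N = ps_var * g.
  by move=> i'; apply/ps_var_div/cm_relation_nonunit.
pose a : 'cV[P]_n := \col_i ps_const (g i); pose b : 'cV[P]_n := \col_i ps_tail (u i 0).
have uE : u = X *: a + Y *: b.
  by apply: col_span2 => i'; rewrite {1}[u i' 0]ps_split gE rmorphM.
have /cm_x_inj[m mE] : io X *: combi io e a = io Y *: (- combi io e b).
  apply/eqP; rewrite scalerN -addr_eq0 -(combiZ io e X a) -(combiZ io e Y b).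
  by rewrite -(combiD io e) -uE eu.
have [d dE] := surj m; have := IH (a - Y *: d).
rewrite (combiB io e) (combiZ io e Y d) dE mE subrr => /(_ erefl i) gi.
case: q ltqj => [|q] ltqj; rewrite gE coef_varM //.
by have := gi q ltqj; rewrite col_sub_scale coef_psD coef_psN coef_varM coef_psD coef_psN coef_ps0 subr0.
Qed.

(** Modulo y a relation is divisible by all powers of x, hence zero. So u is divisible by y, the
    quotient is again a relation because y is injective on M, and the descent does not end. *)
Lemma cm_relation_eq0 u : combi io e u = 0 -> u = 0.
Proof.
move=> eu; apply/colP => i; rewrite mxE; apply: ps_eq0_divX => j.
elim: j u eu i => [|j IH] u eu i; first by exists (u i 0); rewrite mul1r.
have /choice[g gE] : forall i, exists g, u i 0 = Y * g.
  move=> i'; apply: ps_var_div; apply/funext => q.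
  by rewrite (cm_relation_mod_y eu i' (ltnSn q)) coef_ps0.
have uE := col_span1 gE.
have [|h hE] := IH (\col_i g i) _ i.
  by apply: cm_y_inj; rewrite -combiZ -uE.
by exists h; rewrite gE exprS -mulrA -hE mxE.
Qed.

End Minimal.

Lemma cm_finite_gens n (e : 'I_n -> M) :
  (forall m, exists c : 'I_n -> A, m = \sum_i c i *: e i) ->
  exists n' (e' : 'I_n' -> M), forall m, exists v, combi io e' v = m.
Proof.
move=> eg; exists (n + n)%N, (fun i => match split i with inl i => e i | inr i => z *: e i end).
move=> m; have [c ->] := eg m.
exists (\col_i match split i with inl i => qx0 qe (c i) | inr i => qx1 qe (c i) end).
rewrite /combi big_split_ord /= -big_split; apply: eq_bigr => i _ /=.
rewrite !mxE (unsplitK (inl i)) (unsplitK (inr i)) scalerA -scalerDl.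
by rewrite -(qxE qe).
Qed.

Lemma cm_quad_mod n (e : 'I_n -> M) :
  (forall m, exists c : 'I_n -> A, m = \sum_i c i *: e i) ->
  exists n' (Z : 'M[P]_n'), quad_mod io z M Z.
Proof.
move=> /cm_finite_gens[n1 [e1 s1']].
have ex : exists r, `[< exists e' : 'I_r -> M, forall m, exists v, combi io e' v = m >].
  by exists n1; apply/asboolP; exists e1.
case: (ex_minnP ex) => r /asboolP[e' surj] min.
exists r; apply: (quad_mod_combi z surj); apply: cm_relation_eq0 => // n' e2 lt s2.
have: (r <= n')%N by apply: min; apply/asboolP; exists e2.
by rewrite leqNgt lt.
Qed.

End Generators.
End CohenMacaulayFree.

Lemma mod_span_map (A : comNzRingType) (M : lmodType A) (I : Type) (e : I -> M) (c : I -> A) s :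
  mod_span (map e s) (\sum_(i <- s) c i *: e i).
Proof.
elim: s => [|i s IH] /=; first by rewrite big_nil.
by exists (c i); rewrite big_cons addrAC subrr add0r.
Qed.

Lemma cohen_macaulay_quad_mod (k : closedFieldType) (M : lmodType (dinf_ring k)) :
  cohen_macaulay M -> exists n (Z : 'M[powser (powser k)]_n),
    quad_mod (dinf_of (k := k) : {rmorphism _ -> _}) (dinf_z k) M Z.
Proof.
move=> [[n [e eg]] [d [dep kr]]].
have d2 : d = 2%N.
  case: kr => -[p pd] bd; case: (dinf_krull_dim k) => -[q q2] bd2.
  by apply/eqP; rewrite eqn_leq (bd2 _ _ pd) (bd _ _ q2).
case: dep => -[s [[[reg _] mx]]]; rewrite d2 => ss _.
case: s ss reg mx => [|s0 [|s1 [|]]] // _ reg mx.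
apply: (@cm_quad_mod k M s0 s1 _ _ _ _ (map e (index_enum 'I_n)) _ n e eg).
- by apply: mx; rewrite inE eqxx.
- by apply: mx; rewrite !inE eqxx orbT.
- move=> m sm; apply/in_ideal_mul0; apply: (reg 0%N isT m); apply/in_ideal_mul0.
  exact: sm.
- move=> m m' sm; apply/in_ideal_mul1; apply: (reg 1%N isT m); apply/in_ideal_mul1.
  by exists m'; apply: sm.
move=> m; have [c ->] := eg m.
exact: mod_span_map.
Qed.

(** * Normal form modulo x *)

Section Smith.
Variable V : comNzRingType.
Hypothesis totV : forall a b : V, (exists c, b = a * c) \/ (exists c, a = b * c).

Lemma min_divisor (I : finType) (f : I -> V) (i0 : I) : exists i, forall j, exists c, f j = f i * c.
Proof.
suff [i iP] : exists i, forall j, j \in enum I -> exists c, f j = f i * c.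
  by exists i => j; apply: iP; rewrite mem_enum.
elim: (enum I) => [|j s [i IH]]; first by exists i0.
have [[c cE]|[c cE]] := totV (f i) (f j).
  by exists i => l; rewrite inE => /orP[/eqP ->|/IH //]; exists c.
exists j => l; rewrite inE => /orP[/eqP ->|/IH [d ->]]; first by exists 1; rewrite mulr1.
by exists (c * d); rewrite cE mulrA.
Qed.

Lemma block_mx_first m n (A : 'M[V]_(1 + m, 1 + n)) u c r : A 0 0 = u ->
  (forall a, A (rshift 1 a) 0 = u * c a) -> (forall b, A 0 (rshift 1 b) = u * r b) ->
  A = block_mx u%:M (u *: \row_b r b) (u *: \col_a c a) (drsubmx A).
Proof.
move=> A0 Ac Ar; rewrite -[LHS]submxK; congr block_mx.
- rewrite [LHS]mx11_scalar -A0 !mxE; congr (A _ _)%:M; exact: val_inj.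
- by apply/rowP => b; rewrite !mxE -Ar; congr (A _ _); apply: val_inj.
by apply/colP => a; rewrite !mxE -Ac; congr (A _ _); apply: val_inj.
Qed.

Definition smith_form m n (A : 'M[V]_(m, n)) : Prop :=
  exists (L L' : 'M[V]_m) (R R' : 'M[V]_n), [/\ L *m L' = 1%:M, R *m R' = 1%:M &
    forall (i : 'I_m) (j : 'I_n), i <> j :> nat -> (L *m A *m R) i j = 0].

Lemma smith_form_equiv m n (A : 'M[V]_(m, n)) (L L' : 'M_m) (R R' : 'M_n) :
  L *m L' = 1%:M -> R *m R' = 1%:M -> smith_form (L *m A *m R) -> smith_form A.
Proof.
move=> LL RR [L1 [L1' [R1 [R1' [LL1 RR1 D]]]]].
exists (L1 *m L), (L' *m L1'), (R *m R1), (R1' *m R'); split.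
- by rewrite mulmxA -(mulmxA L1) LL mulmx1.
- by rewrite mulmxA -(mulmxA R) RR1 mulmx1.
by move=> i j; rewrite !mulmxA in D * => /D.
Qed.

(** Total divisibility provides an entry dividing all the others; moved to the corner, it clears its
    row and column. *)
Lemma smith m n (A : 'M[V]_(m, n)) : smith_form A.
Proof.
elim: m n A => [|m IH] [|n] A; try by exists 1%:M, 1%:M, 1%:M, 1%:M; rewrite !mulmx1; split=> // -[i hi] [j hj].
have [[i j] ijP] := min_divisor (fun ij : 'I_m.+1 * 'I_n.+1 => A ij.1 ij.2) (0, 0).
have tp l (a b : 'I_l) : tperm_mx a b *m tperm_mx a b = 1%:M :> 'M[V]_l.
  by rewrite -perm_mxM tperm2 perm_mx1.
apply: (smith_form_equiv (tp _ i 0) (tp _ j 0)); rewrite -xrowE -xcolE.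
set A1 : 'M_(1 + m, 1 + n) := xcol _ _ _; pose u := A1 0 0.
have A1P (a : 'I_(1 + m)) (b : 'I_(1 + n)) : exists c, A1 a b = u * c.
  by rewrite /u !mxE !tpermR; apply: (ijP (_, _)).
have [c cE] := choice (fun a => A1P (rshift 1 a) 0).
have [r rE] := choice (fun b => A1P 0 (rshift 1 b)).
pose cv : 'cV_m := \col_a c a; pose rv : 'rV_n := \row_b r b.
have A1E : A1 = block_mx u%:M (u *: rv) (u *: cv) (drsubmx A1).
  exact: block_mx_first.
pose L : 'M[V]_(1 + m) := block_mx 1%:M 0 (- cv) 1%:M.
pose L' : 'M[V]_(1 + m) := block_mx 1%:M 0 cv 1%:M.
pose R : 'M[V]_(1 + n) := block_mx 1%:M (- rv) 0 1%:M.
pose R' : 'M[V]_(1 + n) := block_mx 1%:M rv 0 1%:M.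
have LL : L *m L' = 1%:M.
  rewrite mulmx_block (@scalar_mx_block _ 1 m); congr block_mx;
  by rewrite ?mul0mx ?mulmx0 ?addr0 ?add0r ?mulmx1 ?mul1mx // addNr.
have RR : R *m R' = 1%:M.
  rewrite mulmx_block (@scalar_mx_block _ 1 n); congr block_mx;
  by rewrite ?mul0mx ?mulmx0 ?addr0 ?add0r ?mulmx1 ?mul1mx // subrr.
apply: (smith_form_equiv LL RR).
pose A2 := drsubmx A1 - u *: (cv *m rv).
have -> : L *m A1 *m R = block_mx u%:M 0 0 A2.
  rewrite A1E !mulmx_block; congr block_mx; rewrite ?mul0mx ?mulmx0 ?addr0 ?add0r ?mulmx1 ?mul1mx //.
  - by rewrite mulmxN mul_scalar_mx addNr.
  - by rewrite mulNmx mul_mx_scalar addNr.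
  rewrite mulNmx mul_mx_scalar addNr mul0mx add0r /A2 addrC mulNmx.
  by rewrite -scalemxAr.
have [L2 [L2' [R2 [R2' [LL2 RR2 D2]]]]] := IH _ A2.
exists (block_mx 1%:M 0 0 L2), (block_mx 1%:M 0 0 L2'), (block_mx 1%:M 0 0 R2), (block_mx 1%:M 0 0 R2').
split.
- rewrite mulmx_block (@scalar_mx_block _ 1 m); congr block_mx;
  by rewrite ?mul0mx ?mulmx0 ?addr0 ?add0r ?mulmx1 ?mul1mx.
- rewrite mulmx_block (@scalar_mx_block _ 1 n); congr block_mx;
  by rewrite ?mul0mx ?mulmx0 ?addr0 ?add0r ?mulmx1 ?mul1mx.
move=> a b ab; rewrite !mulmx_block !(mul0mx, mulmx0, addr0, add0r) mulmx1 mul1mx.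
move: ab; case: (@split_ordP 1 m a) => a' ->; case: (@split_ordP 1 n b) => b' -> /= ab.
- by case: ab; rewrite !ord1.
- by rewrite block_mxEur mxE.
- by rewrite block_mxEdl mxE.
by rewrite block_mxEdr D2 // => e; apply: ab; rewrite e.
Qed.

Hypothesis domV : no_zero_div V.

(** In Smith form over a domain the kernel is spanned by the coordinates whose diagonal entry is
    zero, so it is a direct summand; [pi] projects onto it. *)
Lemma kernel_projection n (A : 'M[V]_n) : exists pi : 'M[V]_n,
  [/\ pi *m pi = pi, A *m pi = 0 & forall m (v : 'M_(n, m)), A *m v = 0 -> pi *m v = v].
Proof.
have [L [L' [R [R' [LL RR]]]]] := smith A; have R'R := mulmx1C RR.
move DE : (L *m A *m R) => D D0.
have AE : A = L' *m D *m R'.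
  by rewrite -DE !mulmxA (mulmx1C LL) mul1mx -mulmxA RR mulmx1.
pose E : 'M[V]_n := diag_mx (\row_i (D i i == 0)%:R).
have EE : E *m E = E.
  rewrite mulmx_diag; congr diag_mx; apply/rowP => i; rewrite !mxE.
  by case: eqP; rewrite ?mulr1 ?mulr0.
have DE0 : D *m E = 0.
  apply/matrixP => i j; rewrite mul_mx_diag mxE [RHS]mxE [X in _ * X]mxE; have [->|/eqP ij] := eqVneq i j.
    by case: eqP => [->|_]; rewrite ?mul0r ?mulr0.
  by rewrite D0 ?mul0r // => /val_inj.
exists (R *m E *m R'); split.
- by rewrite !mulmxA -(mulmxA _ R') R'R mulmx1 -(mulmxA R) EE.
- by rewrite AE -!mulmxA (mulmxA R') R'R mul1mx (mulmxA D) DE0 mul0mx mulmx0.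
move=> m v Av; suff Ev : E *m (R' *m v) = R' *m v.
  by rewrite -!mulmxA Ev mulmxA RR mul1mx.
have: D *m (R' *m v) = 0 by rewrite mulmxA -DE -(mulmxA _ R) RR mulmx1 -mulmxA Av mulmx0.
move: (R' *m v) => x Dx; apply/matrixP => i j; rewrite mul_diag_mx mxE [X in X * _]mxE.
case: eqP => [_|di]; first by rewrite mul1r.
move/matrixP/(_ i j): Dx; rewrite mxE [RHS]mxE (bigD1 i) //= big1 ?addr0 => [/domV[]// -> |l li].
  by rewrite mulr0.
by rewrite D0 ?mul0r // => /val_inj e; rewrite e eqxx in li.
Qed.

End Smith.

(** An exact differential on a finite-dimensional space is contractible. The homotopy (1 - p) g p is
    made from a generalized inverse g of T and the projection p = T g onto the image. *)
Lemma mx_homotopy (F : fieldType) n (T : 'M[F]_n) : T *m T = 0 ->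
  (forall X : 'M_n, T *m X = 0 -> exists U : 'M_n, X = T *m U) ->
  exists E, T *m E + E *m T = 1%:M.
Proof.
move=> TT ex; have [g TgT] : exists g, T *m g *m T = T by exists (pinvmx T); rewrite mulmxKpV.
have [|U UE] := ex (1%:M - g *m T); first by rewrite mulmxBr mulmx1 mulmxA TgT subrr.
move pE : (T *m g) => p; have pT : p *m T = T by rewrite -pE TgT.
have pp : p *m p = p by rewrite -{2}pE mulmxA pT.
have Tp : T *m p = 0 by rewrite -pE mulmxA TT mul0mx.
have pU : p *m (1%:M - g *m T) = 1%:M - g *m T by rewrite UE mulmxA pT.
exists ((1%:M - p) *m g *m p).
have -> : T *m ((1%:M - p) *m g *m p) = p.
  by rewrite !mulmxA mulmxBr mulmx1 Tp subr0 pE pp.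
have -> : (1%:M - p) *m g *m p *m T = 1%:M - p.
  move: pU; rewrite mulmxBr mulmx1 => pU; rewrite -mulmxA pT -mulmxA mulmxBl mul1mx.
  by apply: (addrI (p - g *m T)); rewrite addrA subrK pU [RHS]addrC addrA subrK.
by rewrite addrC subrK.
Qed.

(** * Lattices, and deformation to matrices over k[[y]] *)

Section Lattices.
Variables (P C : comNzRingType) (K : fieldType).
Variables (rho : {rmorphism P -> C}) (j : {rmorphism C -> P}).
Variables (sigma : {rmorphism C -> K}) (tau : {rmorphism K -> C}).
Variables (x : P) (y : C).
Hypothesis rhoj : forall c, rho (j c) = c.
Hypothesis sigmatau : forall c, sigma (tau c) = c.
Hypothesis rho_ker : forall p, rho p = 0 <-> exists q, p = x * q.
Hypothesis x_inj : forall p, x * p = 0 -> p = 0.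
Hypothesis sigma_ker : forall c, sigma c = 0 <-> exists d, c = y * d.
Hypothesis y_inj : forall c, y * c = 0 -> c = 0.
Hypothesis local_unit : forall p, sigma (rho p) <> 0 -> exists q, p * q = 1.

Lemma local_unitC c : sigma c <> 0 -> exists d, c * d = 1.
Proof.
rewrite -{1}(rhoj c) => /local_unit[q e]; exists (rho q).
by rewrite -{1}(rhoj c) -rmorphM e rmorph1.
Qed.

Lemma mx_rho_ker m n (A : 'M_(m, n)) : map_mx rho A = 0 -> exists B, A = x *: B.
Proof.
move=> A0; have dv (ij : 'I_m * 'I_n) : exists q, A ij.1 ij.2 = x * q.
  by apply/rho_ker; move/matrixP/(_ ij.1 ij.2): A0; rewrite !mxE.
have [b bE] := choice dv; exists (\matrix_(i, l) b (i, l)).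
by apply/matrixP => i l; rewrite !mxE; apply: (bE (i, l)).
Qed.

Lemma mx_sigma_ker m n (A : 'M_(m, n)) : map_mx sigma A = 0 -> exists B, A = y *: B.
Proof.
move=> A0; have dv (ij : 'I_m * 'I_n) : exists q, A ij.1 ij.2 = y * q.
  by apply/sigma_ker; move/matrixP/(_ ij.1 ij.2): A0; rewrite !mxE.
have [b bE] := choice dv; exists (\matrix_(i, l) b (i, l)).
by apply/matrixP => i l; rewrite !mxE; apply: (bE (i, l)).
Qed.

Lemma scalemx_reg_inj (R : comNzRingType) (a : R) m n (A B : 'M_(m, n)) :
  (forall b, a * b = 0 -> b = 0) -> a *: A = a *: B -> A = B.
Proof.
move=> inj e; apply/matrixP => i l; apply/eqP; rewrite -subr_eq0; apply/eqP/inj.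
by move/matrixP/(_ i l): e; rewrite !mxE mulrBr => ->; rewrite subrr.
Qed.

Lemma map_jK m n (A : 'M_(m, n)) : map_mx rho (map_mx j A) = A.
Proof. by apply/matrixP => i l; rewrite !mxE rhoj. Qed.
Lemma map_tauK m n (A : 'M_(m, n)) : map_mx sigma (map_mx tau A) = A.
Proof. by apply/matrixP => i l; rewrite !mxE sigmatau. Qed.

Lemma rho_x : rho x = 0.
Proof. by apply/rho_ker; exists 1; rewrite mulr1. Qed.
Lemma sigma_y : sigma y = 0.
Proof. by apply/sigma_ker; exists 1; rewrite mulr1. Qed.

Section Delta.
Variables (n : nat) (pi : 'M[C]_n).
Hypothesis pipi : pi *m pi = pi.

(** In a basis adapted to [pi] this is diag(1, x), and [lat_deltaV] is diag(x, 1): together they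
    factor x. *)
Definition lat_delta : 'M[P]_n := map_mx j pi + x *: map_mx j (1%:M - pi).
Definition lat_deltaV : 'M[P]_n := x *: map_mx j pi + map_mx j (1%:M - pi).
(* x Th restricted to the lattice lat_deltaV P^n = {v | v mod x in im (1 - pi)}. *)
Definition lattice (Th : 'M[C]_n) : 'M[P]_n := lat_delta *m map_mx j Th *m lat_deltaV.

Lemma mul_lat_delta m (N : 'M_(m, n)) : map_mx j N *m lat_delta =
  map_mx j (N *m pi) + x *: map_mx j (N *m (1%:M - pi)).
Proof. by rewrite /lat_delta mulmxDr -scalemxAr !map_mxM. Qed.
Lemma lat_delta_mul m (N : 'M_(n, m)) : lat_delta *m map_mx j N =
  map_mx j (pi *m N) + x *: map_mx j ((1%:M - pi) *m N).
Proof. by rewrite /lat_delta mulmxDl -scalemxAl !map_mxM. Qed.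

Lemma idem_compl : pi *m (1%:M - pi) = 0 /\ (1%:M - pi) *m pi = 0.
Proof. by rewrite mulmxBr mulmxBl mulmx1 mul1mx pipi subrr. Qed.
Lemma compl_idem : (1%:M - pi) *m (1%:M - pi) = 1%:M - pi.
Proof. by rewrite mulmxBr mulmx1 (idem_compl).2 subr0. Qed.

Lemma lat_deltaVK : lat_delta *m lat_deltaV = x%:M.
Proof.
rewrite mulmxDl !mulmxDr -!scalemxAr -!scalemxAl -!map_mxM pipi compl_idem.
rewrite (idem_compl).1 (idem_compl).2 !map_mx0 !scaler0 addr0 add0r -scalerDr -map_mxD.
by rewrite addrC subrK map_mx1 scalemx1.
Qed.
Lemma lat_deltaKV : lat_deltaV *m lat_delta = x%:M.
Proof.
rewrite mulmxDl !mulmxDr -!scalemxAr -!scalemxAl -!map_mxM pipi compl_idem.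
rewrite (idem_compl).1 (idem_compl).2 !map_mx0 !scaler0 addr0 add0r -scalerDr -map_mxD.
by rewrite addrC subrK map_mx1 scalemx1.
Qed.

Lemma lat_delta_inj m (A B : 'M_(m, n)) : A *m lat_delta = B *m lat_delta -> A = B.
Proof.
move/(congr1 (mulmx^~ lat_deltaV)); rewrite -!mulmxA lat_deltaVK !mul_mx_scalar.
exact: scalemx_reg_inj.
Qed.
Lemma lat_delta_inj' m (A B : 'M_(n, m)) : lat_delta *m A = lat_delta *m B -> A = B.
Proof.
move/(congr1 (mulmx lat_deltaV)); rewrite !mulmxA lat_deltaKV !mul_scalar_mx.
exact: scalemx_reg_inj.
Qed.

Lemma latticeE Th : lattice Th *m lat_delta = x *: (lat_delta *m map_mx j Th).
Proof. by rewrite /lattice -mulmxA lat_deltaKV mul_mx_scalar. Qed.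

Lemma det_lat_delta_inj p : p * \det lat_delta = 0 -> p = 0.
Proof.
move=> e; suff: x ^+ n * p = 0 by elim: (n) => [|i IH]; rewrite ?mul1r // exprS -mulrA => /x_inj.
by rewrite -det_scalar -lat_deltaVK det_mulmx mulrC mulrA e mul0r.
Qed.

Lemma rho_lat_delta : map_mx rho lat_delta = pi.
Proof. by rewrite map_mxD map_jK map_mxZ rho_x scale0r addr0. Qed.
Lemma rho_lat_deltaV : map_mx rho lat_deltaV = 1%:M - pi.
Proof. by rewrite map_mxD map_mxZ rho_x scale0r add0r map_jK. Qed.

Lemma rho_lattice Th : map_mx rho (lattice Th) = pi *m Th *m (1%:M - pi).
Proof. by rewrite !map_mxM map_jK rho_lat_delta rho_lat_deltaV. Qed.

End Delta.

(* A map of lattices G with pi G (1 - pi1) = 0 descends to the sublattices, as F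
   with F Delta1 = Delta G; hence the determinants are compatible. *)
Lemma lattice_map n1 n (pi1 : 'M[C]_n1) (pi : 'M[C]_n) Th1 Th (G : 'M_(n, n1)) :
  pi1 *m pi1 = pi1 -> pi *m pi = pi -> Th *m G = G *m Th1 ->
  pi *m G *m (1%:M - pi1) = 0 ->
  exists F, F *m lat_delta pi1 = lat_delta pi *m map_mx j G /\
    F *m lattice pi1 Th1 = lattice pi Th *m F.
Proof.
move=> id1 id GTh piG.
pose F := lat_delta pi *m map_mx j (G *m pi1) + map_mx j ((1%:M - pi) *m G *m (1%:M - pi1)).
have FE : F *m lat_delta pi1 = lat_delta pi *m map_mx j G.
  have e1 : map_mx j (G *m pi1) *m lat_delta pi1 = map_mx j (G *m pi1).
    rewrite mul_lat_delta -!mulmxA id1 (idem_compl id1).1.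
    by rewrite mulmx0 map_mx0 scaler0 addr0.
  have e2 : map_mx j ((1%:M - pi) *m G *m (1%:M - pi1)) *m lat_delta pi1 =
      x *: map_mx j ((1%:M - pi) *m G *m (1%:M - pi1)).
    rewrite mul_lat_delta -!mulmxA (idem_compl id1).2 (compl_idem id1).
    by rewrite !mulmx0 map_mx0 add0r.
  have e3 : lat_delta pi *m map_mx j (G *m (1%:M - pi1)) =
      x *: map_mx j ((1%:M - pi) *m G *m (1%:M - pi1)).
    by rewrite lat_delta_mul !mulmxA piG map_mx0 add0r.
  rewrite mulmxDl -mulmxA e1 e2 -e3 -mulmxDr -map_mxD -mulmxDr.
  by rewrite [pi1 + _]addrC subrK mulmx1.
exists F; split=> //; apply: (lat_delta_inj id1); rewrite -mulmxA latticeE // -scalemxAr mulmxA FE.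
by rewrite -(mulmxA _ F) FE mulmxA latticeE // -scalemxAl -!mulmxA -!map_mxM GTh.
Qed.

Lemma lattice_det n1 n (pi1 : 'M[C]_n1) (pi : 'M[C]_n) F1 F2 G1 G2 :
  pi1 *m pi1 = pi1 ->
  F1 *m lat_delta pi1 = lat_delta pi *m map_mx j G1 ->
  F2 *m lat_delta pi = lat_delta pi1 *m map_mx j G2 ->
  \det (F2 *m F1) = j (\det (G2 *m G1)).
Proof.
move=> id1 e1 e2; apply/eqP; rewrite -subr_eq0; apply/eqP/(det_lat_delta_inj id1).
rewrite mulrBl -det_mulmx -mulmxA e1 mulmxA e2 -mulmxA -map_mxM det_mulmx det_map_mx.
by rewrite mulrC subrr.
Qed.

(** Z Delta is x times a matrix W because Z kills im pi modulo x. W in turn factors through Delta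
    because its reduction modulo x lands in the kernel im pi, which follows from Z Z = x^2 y. *)
Lemma rationalize n (Z : 'M[P]_n) (pi : 'M[C]_n) : Z *m Z = (x ^+ 2 * j y)%:M ->
  pi *m pi = pi -> map_mx rho Z *m pi = 0 ->
  (forall m (v : 'M_(n, m)), map_mx rho Z *m v = 0 -> pi *m v = v) ->
  exists Th, Z *m lat_delta pi = x *: (lat_delta pi *m Th) /\ Th *m Th = (j y)%:M.
Proof.
move=> ZZ id Zpi kerZ; set Zb := map_mx rho Z in Zpi kerZ.
have [|B BE] := @mx_rho_ker _ _ (Z *m map_mx j pi); first by rewrite map_mxM map_jK.
have ZB : Z *m B = x *: (j y *: map_mx j pi).
  apply: (scalemx_reg_inj x_inj); rewrite scalemxAr -BE mulmxA ZZ mul_scalar_mx.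
  by rewrite !scalerA expr2.
have piB : pi *m map_mx rho B = map_mx rho B.
  by apply: kerZ; rewrite -map_mxM ZB map_mxZ rho_x scale0r.
have piZ : pi *m Zb = Zb.
  by apply: kerZ; rewrite -map_mxM ZZ map_scalar_mx rmorphM rmorphXn rho_x expr0n mul0r raddf0.
pose W := B + Z *m map_mx j (1%:M - pi).
have ZD : Z *m lat_delta pi = x *: W.
  by rewrite mulmxDr BE -scalemxAr scalerDr.
have [|Th ThE] := @mx_rho_ker _ _ (lat_deltaV pi *m W).
  rewrite map_mxM rho_lat_deltaV /W map_mxD map_mxM map_jK -/Zb mulmxDr mulmxA.
  by rewrite [_ *m Zb]mulmxBl mulmxBl !mul1mx piB piZ !subrr mul0mx addr0.
have WE : W = lat_delta pi *m Th.
  apply: (scalemx_reg_inj x_inj); rewrite scalemxAr -ThE mulmxA lat_deltaVK //.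
  by rewrite mul_scalar_mx.
exists Th; rewrite -WE; split=> //; apply: (lat_delta_inj' id).
apply: (scalemx_reg_inj x_inj); apply: (scalemx_reg_inj x_inj).
transitivity (Z *m Z *m lat_delta pi); last first.
  by rewrite ZZ mul_scalar_mx mul_mx_scalar !scalerA; congr (_ *: _); ring.
by rewrite -[RHS]mulmxA ZD WE -scalemxAr (mulmxA Z) ZD WE -scalemxAl mulmxA.
Qed.

(** Th and its reduction jT both square to y, so Th E + E jT intertwines them for every E. Lifting a
    homotopy E of the reduction modulo (x, y) makes this intertwiner congruent to 1 there, hence
    invertible modulo x. *)
Lemma deform n (Th : 'M[P]_n) : Th *m Th = (j y)%:M ->
  exists G H, G = 1%:M + x *: H /\ Th *m G = G *m map_mx j (map_mx rho Th).
Proof.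
move=> ThTh; set Tb := map_mx rho Th; have TbTb : Tb *m Tb = y%:M.
  by rewrite -map_mxM ThTh map_scalar_mx rhoj.
pose T0 := map_mx sigma Tb.
have [||E0 E0E] := @mx_homotopy K n T0.
- by rewrite -map_mxM TbTb map_scalar_mx sigma_y raddf0.
(* Exactness: the lift satisfies Tb Xt = y U; applying Tb once more and cancelling y gives Xt = Tb
   U. *)
- move=> X TX; pose Xt := map_mx tau X.
  have [|U UE] := @mx_sigma_ker _ _ (Tb *m Xt); first by rewrite map_mxM map_tauK.
  exists (map_mx sigma U); rewrite -map_mxM -[LHS]map_tauK; congr map_mx.
  apply: (scalemx_reg_inj y_inj); rewrite scalemxAr -UE mulmxA TbTb.
  by rewrite mul_scalar_mx.
pose E := map_mx j (map_mx tau E0); pose jT := map_mx j Tb.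
pose G := Th *m E + E *m jT.
have jTjT : jT *m jT = (j y)%:M by rewrite -map_mxM TbTb map_scalar_mx.
have ThG : Th *m G = G *m jT.
  rewrite mulmxDr mulmxDl mulmxA ThTh -[E *m jT *m jT]mulmxA jTjT.
  by rewrite mul_scalar_mx mul_mx_scalar addrC mulmxA.
pose Gb := map_mx rho G.
have s1 : map_mx sigma Gb = 1%:M.
  by rewrite /Gb map_mxD !map_mxM !map_jK map_mxD !map_mxM map_tauK.
have [|d dE] := @local_unitC (\det Gb).
  by rewrite -det_map_mx s1 det1; apply/eqP/oner_neq0.
have [Gi [GGi GiG]] := det_unit_inv dE.
have TbG : Tb *m Gb = Gb *m Tb by rewrite -[LHS]map_mxM ThG map_mxM map_jK.
have TbGi : Tb *m Gi = Gi *m Tb.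
  by rewrite -[LHS]mul1mx -GiG -mulmxA (mulmxA Gb) -TbG -mulmxA GGi mulmx1.
have [|H HE] := @mx_rho_ker _ _ (G *m map_mx j Gi - 1%:M).
  by rewrite map_mxB map_mxM map_jK GGi map_mx1 subrr.
(* Multiplying by the inverse of the reduction of G, which commutes with Tb, makes the intertwiner
   congruent to 1 modulo x. *)
exists (G *m map_mx j Gi), H; split; first by rewrite -HE addrC subrK.
by rewrite mulmxA ThG -mulmxA -map_mxM TbGi map_mxM mulmxA.
Qed.

Hypothesis totC : forall a b : C, (exists c, b = a * c) \/ (exists c, a = b * c).
Hypothesis domC : no_zero_div C.

(** The last two clauses record what the study of the pair requires: the reduced matrix still has no
    unit entry, and its kernel is still im pi. *)
Lemma lattice_normal_form n (Z : 'M[P]_n) : Z *m Z = (x ^+ 2 * j y)%:M ->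
  map_mx sigma (map_mx rho Z) = 0 ->
  exists Th pi U U', [/\ Th *m Th = y%:M, pi *m pi = pi, U' *m U = 1%:M &
    U' *m Z = lattice pi Th *m U'] /\
    (map_mx sigma (pi *m Th *m (1%:M - pi)) = 0 /\
    forall m (v : 'M_(n, m)), pi *m Th *m (1%:M - pi) *m v = 0 -> pi *m v = v).
Proof.
move=> ZZ Z0; have [pi [id Zpi kerZ]] := kernel_projection totC domC (map_mx rho Z).
have [Th0 [ZD Th0E]] := rationalize ZZ id Zpi kerZ.
have [G [H [GE ThG]]] := deform Th0E; set Th := map_mx rho Th0 in ThG.
have ThTh : Th *m Th = y%:M by rewrite -map_mxM Th0E map_scalar_mx rhoj.
move NE : (pi *m map_mx rho H *m (1%:M - pi)) => N.
have NN : N *m N = 0.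
  rewrite -NE -!mulmxA (mulmxA (1%:M - pi) pi) (idem_compl id).2.
  by rewrite mul0mx !mulmx0.
have piN : pi *m N = N by rewrite -NE !mulmxA id.
have [U [UD rU]] : exists U, U *m lat_delta pi = lat_delta pi *m G /\ map_mx rho U = 1%:M + N.
  (* This is Delta G Delta^-1; it is integral because G = 1 + x H and x Delta^-1 is [lat_deltaV]. *)
  exists (1%:M + lat_delta pi *m H *m lat_deltaV pi); split.
    by rewrite mulmxDl mul1mx -mulmxA lat_deltaKV // mul_mx_scalar GE mulmxDr mulmx1 scalemxAr.
  by rewrite map_mxD map_mx1 !map_mxM rho_lat_delta rho_lat_deltaV NE.
have ZU : Z *m U = U *m lattice pi Th.
  apply: (lat_delta_inj id); rewrite -[LHS]mulmxA UD mulmxA ZD -scalemxAl -[_ *m G]mulmxA ThG.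
  by rewrite mulmxA -UD -[RHS]mulmxA latticeE // -scalemxAr mulmxA.
(* Modulo x the matrix U is the unipotent 1 + N, so its determinant is a unit. *)
have UV : (1%:M - N) *m (1%:M + N) = 1%:M.
  by rewrite mulmxDr mulmx1 mulmxBl mul1mx NN subr0 subrK.
have [|d dE] := @local_unit (\det U).
  rewrite -!det_map_mx rU => e; have := congr1 (fun A => sigma (\det A)) UV.
  by rewrite det_mulmx rmorphM -!det_map_mx e mulr0 det_map_mx det1 rmorph1 => /esym/eqP; rewrite oner_eq0.
have [U' [UU' U'U]] := det_unit_inv dE.
have ZUb : map_mx rho Z *m (1%:M + N) = (1%:M + N) *m (pi *m Th *m (1%:M - pi)).
  by rewrite -rU -map_mxM ZU map_mxM rho_lattice.
exists Th, pi, U, U'; split; first split=> //.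
  by rewrite -[LHS]mulmx1 -UU' mulmxA -(mulmxA U') ZU !mulmxA U'U mul1mx.
split=> [|m v v0].
  rewrite (_ : pi *m Th *m (1%:M - pi) = (1%:M - N) *m (map_mx rho Z *m (1%:M + N))).
    by rewrite !map_mxM Z0 mul0mx mulmx0.
  by rewrite ZUb (mulmxA (1%:M - N)) UV mul1mx.
have : pi *m ((1%:M + N) *m v) = (1%:M + N) *m v.
  by apply: kerZ; rewrite mulmxA ZUb -mulmxA v0 mulmx0.
rewrite mulmxA mulmxDr mulmx1 piN.
by rewrite !mulmxDl mul1mx => /addIr.
Qed.

End Lattices.

(** * Pairs over k[[y]] *)

Definition mxpow (R : pzSemiRingType) n (A : 'M[R]_n) a : 'M[R]_n := iter a (mulmx A) 1%:M.

Lemma mxpowS (R : pzSemiRingType) n (A : 'M[R]_n) a : mxpow A a.+1 = A *m mxpow A a.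
Proof. by []. Qed.

Lemma mxpow_comm (R : pzSemiRingType) m n (A : 'M[R]_m) (B : 'M_n) (G : 'M_(m, n)) a :
  A *m G = G *m B -> mxpow A a *m G = G *m mxpow B a.
Proof.
move=> AG; elim: a => [|a IH]; first by rewrite /mxpow /= mul1mx mulmx1.
by rewrite !mxpowS -mulmxA IH !mulmxA AG.
Qed.

(** * Invariant factors of N / k[[t]]V *)

Section LocalAnalysis.
Variables (C B : comNzRingType) (io : {rmorphism C -> B}) (t : B) (y : C).
Hypothesis qe : quad_ext io t y.
Hypothesis totB : forall a b : B, (exists c, b = a * c) \/ (exists c, a = b * c).
Hypothesis valB : forall d : B, d = 0 \/ exists a e e', d = t ^+ a * e /\ e * e' = 1.

Variables (n : nat) (Th pi : 'M[C]_n).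
Hypothesis ThTh : Th *m Th = y%:M.

Lemma scale_tt m l (A : 'M[B]_(m, l)) : t *: (t *: A) = io y *: A.
Proof. by rewrite scalerA; case: qe => ->. Qed.

(** Evaluation u1 + t u2 |-> u1 + Th u2 from B^n to C^n, with t acting as Th: it kills the image of
    t - Th and sends the B-span of im pi into im pi + Th im pi. *)
Lemma eval_relation u1 u2 (a b : 'cV[B]_n) :
  map_mx io u1 + t *: map_mx io u2 = (t%:M - map_mx io Th) *m a + map_mx io pi *m b ->
  exists b0 b1, u1 + Th *m u2 = pi *m b0 + Th *m (pi *m b1).
Proof.
rewrite (mx_qx_split qe a) (mx_qx_split qe b).
move: (map_mx (qx0 qe) a) (map_mx (qx1 qe) a) => a0 a1.
move: (map_mx (qx0 qe) b) (map_mx (qx1 qe) b) => b0 b1 e.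
have := @mx_qx_eq0 _ _ _ _ _ qe _ _ (y *: a1 - Th *m a0 + pi *m b0 - u1)
  (a0 - Th *m a1 + pi *m b1 - u2).
rewrite !(map_mxD, map_mxN, map_mxM, map_mxZ) => H.
have [|/eqP e1 /eqP e2] := H.
  move: e; rewrite !mulmxDr !mulmxBl !mul_scalar_mx -!scalemxAr scale_tt.
  move: (map_mx io Th *m map_mx io a0) (map_mx io Th *m map_mx io a1) => ? ?.
  move: (map_mx io pi *m map_mx io b0) (map_mx io pi *m map_mx io b1) => ? ?.
  move: (map_mx io u1) (map_mx io u2) (map_mx io a0) (map_mx io a1) => U1 U2 A0 A1 e.
  apply/colP => i; move/colP/(_ i)/eqP: e; rewrite -subr_eq0 => /eqP.
  by rewrite !mxE => e; rewrite -[RHS]oppr0 -e; ring.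
rewrite !subr_eq0 in e1 e2; move/eqP: e1 => <-; move/eqP: e2 => <-.
exists b0, b1; rewrite !mulmxDr mulmxN (mulmxA Th Th) ThTh mul_scalar_mx.
move: (Th *m a0) (Th *m _) (pi *m b0) => ? ? ?.
by apply/colP => i; rewrite !mxE; ring.
Qed.

Lemma eval_pow g0 g1 a : exists p q : 'cV[C]_n,
  t ^+ a *: (map_mx io g0 + t *: map_mx io g1) = map_mx io p + t *: map_mx io q /\
  p + Th *m q = mxpow Th a *m (g0 + Th *m g1).
Proof.
elim: a => [|a [p [q [e1 e2]]]]; first by exists g0, g1; rewrite expr0 scale1r mul1mx.
exists (y *: q), p; split; first by rewrite exprS -scalerA e1 scalerDr scale_tt map_mxZ addrC.
by rewrite mxpowS -mulmxA -e2 mulmxDr (mulmxA Th Th) ThTh mul_scalar_mx addrC.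
Qed.

(* With t acting on C^n as Th, la is a B-linear map from C^n to B/(d) that kills
   the image of pi and sends g to 1. *)
Definition cyclic_summand (la : 'rV[B]_n) (g : 'cV[C]_n) (d : B) : Prop :=
  [/\ exists s, la *m map_mx io g = (1 + d * s)%:M,
      exists S, la *m map_mx io Th - t *: la = d *: S &
      exists S, la *m map_mx io pi = d *: S].

(** The matrix A presents the B-module C^n / B im pi. If all invariant factors are units this
    quotient is zero, the first case. Otherwise row i of L is a form la with values in the cyclic
    factor B/(d), and column i of L^-1 evaluates to g; L L^-1 = 1 gives la g = 1 modulo d. *)
Lemma local_analysis :
  (forall u : 'cV[C]_n, exists b0 b1, u = pi *m b0 + Th *m (pi *m b1)) \/
  exists la g d, cyclic_summand la g d /\ (d = 0 \/ exists a, d = t ^+ a.+1 /\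
    exists b0 b1, mxpow Th a.+1 *m g = pi *m b0 + Th *m (pi *m b1)).
Proof.
pose A : 'M[B]_(n, n + n) := row_mx (t%:M - map_mx io Th) (map_mx io pi).
have [L [L' [R [R' [LL RR]]]]] := smith totB A; move DE : (L *m A *m R) => D D0.
have AE : A *m R = L' *m D by rewrite -DE !mulmxA (mulmx1C LL) mul1mx.
have [unit|] := EM (forall i, exists e, D i (lshift n i) * e = 1).
  left=> u; have [e eE] := choice unit.
  pose v := L *m map_mx io u.
  pose w : 'cV[B]_(n + n) := col_mx (\col_i (e i * v i 0)) 0.
  have Dw : D *m w = v.
    apply/colP => i; rewrite mxE big_split_ord /= [X in _ + X]big1 ?addr0; last first.
      by move=> l _; rewrite col_mxEd mxE mulr0.
    rewrite (bigD1 i) //= big1 ?addr0 => [|l li]; rewrite col_mxEu mxE.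
      by rewrite mulrA eE mul1r.
    by rewrite D0 ?mul0r // => /val_inj il; rewrite il eqxx in li.
  have: A *m (R *m w) = map_mx io u by rewrite mulmxA AE -mulmxA Dw mulmxA (mulmx1C LL) mul1mx.
  rewrite -[R *m w]vsubmxK mul_row_col => E.
  have [|b0 [b1 bE]] := @eval_relation u 0 (usubmx (R *m w)) (dsubmx (R *m w)).
    by rewrite map_mx0 scaler0 addr0 E.
  by exists b0, b1; rewrite -bE mulmx0 addr0.
move=> nu; have [i nui] : exists i, ~ exists e, D i (lshift n i) * e = 1.
  by apply: contrapT => H; apply: nu => i; apply: contrapT => Hi; apply: H; exists i.
have laA : row i L *m A = D i (lshift n i) *: row (lshift n i) R'.
  rewrite -row_mul (_ : L *m A = D *m R'); last by rewrite -DE -mulmxA RR mulmx1.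
  rewrite row_mul (rowE (lshift n i)) scalemxAl; congr (_ *m _).
  apply/rowP => l; rewrite !mxE; case: (eqVneq l (lshift n i)) => [->|ll] /=; first by rewrite mulr1.
  by rewrite mulr0 D0 // => e; case/eqP: ll; apply: val_inj.
have Ag : A *m (R *m delta_mx (lshift n i) (0 : 'I_1)) = D i (lshift n i) *: col i L'.
  rewrite mulmxA AE -mulmxA -colE (colE i) scalemxAr; congr (_ *m _).
  apply/colP => l; rewrite !mxE; case: (eqVneq l i) => [->|ll] /=; first by rewrite mulr1.
  by rewrite mulr0 D0 // => /val_inj e; rewrite e eqxx in ll.
have lag : row i L *m col i L' = 1%:M.
  transitivity (((L *m L') i i)%:M : 'M[B]_1); last by rewrite LL mxE eqxx.
  by rewrite [LHS]mx11_scalar !mxE; congr (_%:M); apply: eq_bigr => l _; rewrite !mxE.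
move: {DE D0 AE} (D i (lshift n i)) nui laA Ag => d nud laA Ag.
move: {LL RR} (row i L) (col i L') lag (row (lshift n i) R') laA (R *m _) Ag => la gB lag S laA w Ag.
right; exists la, (map_mx (qx0 qe) gB + Th *m map_mx (qx1 qe) gB).
have gE := mx_qx_split qe gB; move: (map_mx (qx0 qe) gB) (map_mx (qx1 qe) gB) gE => g0 g1 gE.
rewrite -[S]hsubmxK scale_row_mx mul_mx_row in laA; case/eq_row_mx: laA => laT laP.
have {}laT : la *m map_mx io Th - t *: la = - d *: lsubmx S.
  by rewrite scaleNr -laT mulmxBr mul_mx_scalar opprB.
suff [d' [c [dd' dv]]] : exists d' c, d = d' * c /\ (d' = 0 \/ exists a, d' = t ^+ a.+1 /\
    exists b0 b1, mxpow Th a.+1 *m (g0 + Th *m g1) = pi *m b0 + Th *m (pi *m b1)).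
  exists d'; split=> //; split; last by exists (c *: rsubmx S); rewrite laP dd' scalerA.
    exists (- c * (lsubmx S *m map_mx io g1) 0 0).
    rewrite map_mxD map_mxM mulmxDr mulmxA.
    rewrite -[la *m map_mx io Th](subrK (t *: la)) laT mulmxDl addrCA.
    rewrite -scalemxAl scalemxAr -mulmxDr -gE lag.
    rewrite -scalemxAl [_ *m map_mx io g1]mx11_scalar scale_scalar_mx -raddfD /= addrC dd'.
    by move: (lsubmx S *m _) => W; congr (_%:M); rewrite [_%:M _ _]mxE eqxx mulr1n; ring.
  by exists (- c *: lsubmx S); rewrite laT dd' scalerA mulrN.
have [d0|[a [e [e' [dE ee']]]]] := valB d; first by exists 0, 1; rewrite mulr1; split=> //; left.
case: a dE => [|a] dE; first by case: nud; exists e'; rewrite dE mul1r.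
exists (t ^+ a.+1), e; split=> //; right; exists a; split=> //.
have [p [q [e1 e2]]] := eval_pow g0 g1 a.+1; rewrite -e2.
apply: (@eval_relation p q (usubmx (e' *: w)) (dsubmx (e' *: w))).
rewrite -e1 -gE -mul_row_col vsubmxK -scalemxAr Ag scalerA dE.
by rewrite mulrCA [e' * e]mulrC ee' mulr1.
Qed.

End LocalAnalysis.

Section QuadRows.
Variables (C B : comNzRingType) (io : {rmorphism C -> B}) (t : B) (y : C).
Hypothesis qe : quad_ext io t y.

(* Multiplication by t on B in the C-basis (1, t). *)
Definition mxK : 'M[C]_(1 + 1) := block_mx 0 y%:M 1%:M 0.

(** A row over B as two rows of C-coordinates; multiplication by t becomes left multiplication by
    [mxK]. *)
Definition quad_col m (mu : 'rV[B]_m) : 'M[C]_(1 + 1, m) :=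
  col_mx (map_mx (qx0 qe) mu) (map_mx (qx1 qe) mu).

Lemma mxKK : mxK *m mxK = y%:M.
Proof.
rewrite mulmx_block !(mul0mx, mulmx0, addr0, add0r) mulmx1 ?mul1mx.
by rewrite -scalar_mx_block.
Qed.

Lemma quad_colE m (a b : 'rV[C]_m) : quad_col (map_mx io a + t *: map_mx io b) = col_mx a b.
Proof.
congr col_mx; apply/rowP => i; rewrite !mxE [t * _]mulrC.
  by case: (qxP qe (a 0 i) (b 0 i)).
by case: (qxP qe (a 0 i) (b 0 i)).
Qed.

Lemma quad_col0 m : quad_col (0 : 'rV[B]_m) = 0.
Proof. by have := quad_colE (0 : 'rV_m) 0; rewrite map_mx0 scaler0 addr0 col_mx0. Qed.

Lemma quad_colD m (a b : 'rV[B]_m) : quad_col (a + b) = quad_col a + quad_col b.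
Proof.
rewrite {1}(mx_qx_split qe a) {1}(mx_qx_split qe b) addrACA -scalerDr -!map_mxD.
by rewrite quad_colE add_col_mx.
Qed.

Lemma quad_colM m l (a : 'rV[B]_m) (X : 'M[C]_(m, l)) :
  quad_col (a *m map_mx io X) = quad_col a *m X.
Proof.
rewrite {1}(mx_qx_split qe a) mulmxDl -scalemxAl -!map_mxM quad_colE.
by rewrite mul_col_mx.
Qed.

Lemma quad_colt m (a : 'rV[B]_m) : quad_col (t *: a) = mxK *m quad_col a.
Proof.
have tt : t * t = io y by case: qe.
rewrite {1}(mx_qx_split qe a) scalerDr scalerA tt -map_mxZ addrC quad_colE.
by rewrite mul_block_col !mul0mx add0r addr0 mul1mx mul_scalar_mx.
Qed.

Lemma quad_colX m (a : 'rV[B]_m) e : quad_col (t ^+ e *: a) = mxpow mxK e *m quad_col a.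
Proof.
elim: e => [|e IH]; first by rewrite expr0 scale1r mul1mx.
by rewrite exprS -scalerA quad_colt IH mulmxA.
Qed.

Lemma quad_col1 : quad_col 1%:M = col_mx 1%:M 0.
Proof. by rewrite -quad_colE map_mx0 scaler0 addr0 map_mx1. Qed.

Lemma row_K_basis : row_mx (col_mx 1%:M 0) (mxK *m col_mx 1%:M 0) = 1%:M :> 'M[C]_(1 + 1).
Proof.
rewrite mul_block_col !mulmx1 !mulmx0 !addr0 (@scalar_mx_block _ 1 1).
by rewrite block_mxEh.
Qed.

End QuadRows.

(** * Splitting a standard pair off (N, V) *)

Section Pairs.
Variables (C B : comNzRingType) (io : {rmorphism C -> B}) (t : B) (y : C).
Hypothesis qe : quad_ext io t y.
Hypothesis totB : forall a b : B, (exists c, b = a * c) \/ (exists c, a = b * c).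
Hypothesis valB : forall d : B, d = 0 \/ exists a e e', d = t ^+ a * e /\ e * e' = 1.
Variables (K : fieldType) (sigma : {rmorphism C -> K}).
Hypothesis sigma_y : sigma y = 0.
Hypothesis y_inj : forall c, y * c = 0 -> c = 0.
Hypothesis local_unitC : forall c, sigma c <> 0 -> exists d, c * d = 1.

Local Notation mxK := (mxK y).

(** Morphisms of pairs (N, V), where V is the image of 1 - pi: the two vanishing conditions say that
    G1 and G2 carry these submodules into each other. *)
Definition pair_retract n n1 (Th pi : 'M[C]_n) (Th1 pi1 : 'M[C]_n1) : Prop :=
  exists (G1 : 'M_(n, n1)) (G2 : 'M_(n1, n)),
  [/\ Th *m G1 = G1 *m Th1, Th1 *m G2 = G2 *m Th, pi *m G1 *m (1%:M - pi1) = 0,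
      pi1 *m G2 *m (1%:M - pi) = 0 & sigma (\det (G2 *m G1)) = 1].

(** The pair with invariant factor t: N = B with C-basis 1, t, and V = C t, so that N / B V =
    B/(t). *)
Definition beta_pi : 'M[C]_(1 + 1) := block_mx 1%:M 0 0 0.
Definition gd_pi : 'M[C]_((1 + 1) + (1 + 1)) := block_mx 1%:M 0 0 0.
(** Theta sends (0, u) to (K^a u, - K u); with V the second block, N / B V is B/(t^a). The sign
    makes the off-diagonal terms of the square cancel. *)
Definition gd_theta a : 'M[C]_((1 + 1) + (1 + 1)) := block_mx mxK (mxpow mxK a) 0 (- mxK).

Section Cases.
Variables (n : nat) (Th pi : 'M[C]_n).
Hypothesis ThTh : Th *m Th = y%:M.
Hypothesis pipi : pi *m pi = pi.

Lemma row_K_comm (g : 'cV_n) : Th *m row_mx g (Th *m g) = row_mx g (Th *m g) *m mxK.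
Proof.
rewrite mul_mx_row mul_row_block !mulmx0 mulmx1 add0r addr0 mulmxA ThTh.
by rewrite mul_mx_scalar mul_scalar_mx.
Qed.

Lemma cyclic_quad_col la g a : cyclic_summand io t Th (1%:M - pi) la g (t ^+ a) ->
  [/\ exists s, quad_col qe la *m g = col_mx 1%:M 0 + mxpow mxK a *m s,
      exists S, quad_col qe la *m Th = mxK *m quad_col qe la + mxpow mxK a *m S &
      exists S, quad_col qe la *m (1%:M - pi) = mxpow mxK a *m S].
Proof.
move=> [[s sE] [S SE] [S' S'E]]; split.
- exists (quad_col qe s%:M); rewrite -quad_colM sE raddfD /= quad_colD quad_col1; congr (_ + _).
  by rewrite -scale_scalar_mx quad_colX.
- exists (quad_col qe S); rewrite -quad_colM -quad_colt -quad_colX -quad_colD -SE.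
  by rewrite addrC subrK.
by exists (quad_col qe S'); rewrite -quad_colM S'E quad_colX.
Qed.

(** For d = 0 the form la is a B-linear map N -> B that vanishes on V and sends g to 1, so B splits
    off with zero submodule. *)
Lemma pair_alpha la g : cyclic_summand io t Th (1%:M - pi) la g 0 ->
  pair_retract Th pi mxK (1%:M : 'M_(1 + 1)).
Proof.
move=> [[s sE] [S SE] [S' S'E]].
have lg : quad_col qe la *m g = col_mx 1%:M 0.
  by rewrite -quad_colM sE mul0r addr0 quad_col1.
have lT : quad_col qe la *m Th = mxK *m quad_col qe la.
  by rewrite -quad_colM -quad_colt; congr quad_col; apply/eqP; rewrite -subr_eq0 SE scale0r.
exists (row_mx g (Th *m g)), (quad_col qe la); split=> //.
- exact: row_K_comm.
- by rewrite subrr mulmx0.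
- by rewrite mul1mx -quad_colM S'E scale0r quad_col0.
by rewrite mul_mx_row lg mulmxA lT -mulmxA lg row_K_basis det1 rmorph1.
Qed.

(** Congruences modulo t are made exact: g is changed by an element of V so that Th g' lies in V,
    and the coordinate of la on 1, composed with pi, is a form h0 that vanishes on V with h0 Th
    divisible by y. The composite is then a scalar congruent to 1 modulo y. *)
Lemma pair_beta la g b0 b1 : cyclic_summand io t Th (1%:M - pi) la g t ->
  Th *m g = (1%:M - pi) *m b0 + Th *m ((1%:M - pi) *m b1) ->
  pair_retract Th pi mxK beta_pi.
Proof.
move=> cs gE; have [[s sE] [S SE] [S' S'E]] := cyclic_quad_col (a := 1%N) cs.
have [id1 id2] := idem_compl pipi.
move: (quad_col qe la) sE SE S'E => La; rewrite mxpowS [mxpow _ 0]/(1%:M) mulmx1 => {}sE {}SE {}S'E.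
pose g' := g - (1%:M - pi) *m b1.
have pTg : pi *m (Th *m g') = 0.
  by rewrite mulmxBr gE addrK mulmxA id1 mul0mx.
have usubK m (A : 'M_(1 + 1, m)) : usubmx (mxK *m A) = y *: dsubmx A.
  by rewrite -{1}[A]vsubmxK mul_block_col mul0mx add0r col_mxKu mul_scalar_mx.
pose h0 := usubmx La *m pi.
have uM m (X : 'M_(n, m)) : usubmx La *m X = usubmx (La *m X) by rewrite -[in RHS](vsubmxK La) mul_col_mx col_mxKu.
have uD m (X Y : 'M[C]_(1 + 1, m)) : usubmx (X + Y) = usubmx X + usubmx Y.
  by apply/matrixP => i l; rewrite !mxE.
have h0E : h0 = usubmx La - y *: dsubmx S'.
  by rewrite -usubK -S'E -uM mulmxBr mulmx1 opprB addrC subrK.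
have [h1 h1E] : exists h1 : 'rV_n, h0 *m Th = y *: h1.
  exists (dsubmx La + dsubmx S - dsubmx S' *m Th).
  by rewrite h0E mulmxBl uM SE uD !usubK -scalemxAl !scalerDr scalerN.
have h1T : h1 *m Th = h0.
  apply: (scalemx_reg_inj y_inj); rewrite scalemxAl -h1E -mulmxA ThTh.
  by rewrite mul_mx_scalar.
have h0pi : h0 *m (1%:M - pi) = 0 by rewrite -mulmxA id1 mulmx0.
have h0T0 : h0 *m (Th *m g') = 0 by rewrite -mulmxA pTg mulmx0.
have h1g : h1 *m g' = 0.
  by apply: (scalemx_reg_inj y_inj); rewrite scalemxAl -h1E -mulmxA h0T0 scaler0.
have h0g : h0 *m g' = (1 + y * (dsubmx s - dsubmx S' *m g) 0 0)%:M.
  rewrite mulmxBr mulmxA h0pi mul0mx subr0 h0E mulmxBl uM sE uD col_mxKu usubK.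
  rewrite -scalemxAl -addrA -scalerBr [X in _ *: X]mx11_scalar scale_scalar_mx.
  by rewrite -raddfD.
exists (row_mx g' (Th *m g')), (col_mx h0 h1); split.
- exact: row_K_comm.
- rewrite mul_block_col !mul0mx add0r addr0 mul1mx mul_scalar_mx mul_col_mx.
  by rewrite h1E h1T.
- rewrite (_ : 1%:M - beta_pi = block_mx 0 0 0 1%:M); last first.
    by rewrite (@scalar_mx_block _ 1 1) opp_block_mx add_block_mx !oppr0 !addr0 subrr.
  by rewrite -mulmxA mul_row_block !mulmx0 mulmx1 !add0r mul_mx_row mulmx0 pTg row_mx0.
- rewrite mul_block_col !mul0mx addr0 mul1mx addr0 mul_col_mx h0pi mul0mx.
  by rewrite col_mx0.
rewrite mul_col_row h0T0 h1g mulmxA h1T h0g -scalar_mx_block det_scalar.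
by rewrite rmorphXn rmorphD rmorphM sigma_y mul0r addr0 rmorph1 expr1n.
Qed.

(** From the standard pair, the first block goes to g, Th g and the second to the vectors of V that
    express t^(a+2) g. The map back consists of ga = la pi, which vanishes on V, and of eta, its
    defect of linearity divided by D = K^(a+2). *)
Lemma pair_gd la g a b0 b1 : cyclic_summand io t Th (1%:M - pi) la g (t ^+ a.+2) ->
  mxpow Th a.+2 *m g = (1%:M - pi) *m b0 + Th *m ((1%:M - pi) *m b1) ->
  pair_retract Th pi (gd_theta a.+2) gd_pi.
Proof.
move=> /cyclic_quad_col[[s sE] [S SE] [S' S'E]] gE.
have [id1 id2] := idem_compl pipi.
move: (quad_col qe la) sE SE S'E => La sE SE S'E.
move Kd : (mxpow mxK a.+2) => D in sE SE S'E *.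
have DK : mxK *m D = D *m mxK by rewrite -Kd; apply/esym/mxpow_comm.
have yD : D = y *: mxpow mxK a by rewrite -Kd !mxpowS mulmxA mxKK mul_scalar_mx.
have ginj m (X : 'M_(1 + 1, m)) : D *m X = 0 -> X = 0.
  rewrite -Kd; elim: (a.+2) X => [|e IH] X; first by rewrite mul1mx.
  rewrite mxpowS -mulmxA => e0; apply: IH; apply: (scalemx_reg_inj y_inj); rewrite scaler0.
  by rewrite -mul_scalar_mx -mxKK -mulmxA e0 mulmx0.
pose ga := La *m pi; pose eta := S - S' *m Th + mxK *m S'.
have gaE : ga = La - D *m S' by rewrite -S'E mulmxBr mulmx1 opprB addrC subrK.
have gaT : ga *m Th = mxK *m ga + D *m eta.
  rewrite gaE /eta mulmxBl SE mulmxBr !mulmxDr mulmxN !mulmxA -DK.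
  move: (mxK *m La) (D *m S) (D *m S' *m Th) (mxK *m D *m S') => ? ? ? ?.
  by apply/matrixP => i l; rewrite !mxE; ring.
have etaT : eta *m Th = - mxK *m eta.
  apply/eqP; rewrite -subr_eq0 mulNmx opprK; apply/eqP/ginj; rewrite mulmxDr mulmxA.
  rewrite (mulmxA D mxK) -DK -(mulmxA mxK D).
  have -> : D *m eta = ga *m Th - mxK *m ga by rewrite gaT addrC addKr.
  rewrite mulmxBl mulmxBr -(mulmxA ga) ThTh (mulmxA mxK mxK) mxKK mul_mx_scalar mul_scalar_mx.
  rewrite -(mulmxA mxK ga).
  by rewrite addrA subrK subrr.
pose Ga := row_mx g (Th *m g).
pose om := (1%:M - pi) *m b1; pose om' := (1%:M - pi) *m b0; pose Om := row_mx om om'.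
have GaK : Th *m Ga = Ga *m mxK by exact: row_K_comm.
have piOm : pi *m Om = 0 by rewrite mul_mx_row !mulmxA id1 !mul0mx row_mx0.
have OmK : Th *m Om = Ga *m D - Om *m mxK.
  have -> : Ga *m D = mxpow Th a.+2 *m Ga by rewrite -Kd; apply/esym/mxpow_comm.
  rewrite [mxpow _ _ *m _]mul_mx_row mulmxA (mxpow_comm (B := Th)) // -mulmxA gE.
  rewrite mul_row_block !mulmx0 mulmx1 add0r addr0 mul_mx_row opp_row_mx add_row_mx.
  congr row_mx; first by rewrite addrC addKr.
  by rewrite mulmxDr (mulmxA Th Th) ThTh mul_scalar_mx mul_mx_scalar addrK.
have gaOm : ga *m Om = 0 by rewrite -mulmxA piOm mulmx0.
have gaGa : exists Q, ga *m Ga = 1%:M + y *: Q.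
  exists (mxpow mxK a *m (row_mx s (mxK *m s + S *m g) - S' *m Ga)).
  rewrite scalemxAl -yD mulmxBr gaE mulmxBl mulmxA addrA; congr (_ - _).
  rewrite [La *m _]mul_mx_row mulmxA SE mulmxDl -mulmxA sE mulmxDr -(row_K_basis y).
  rewrite mul_mx_row add_row_mx; congr row_mx.
  by rewrite mulmxDr !mulmxA DK addrA.
have [Q QE] := gaGa.
exists (row_mx Ga Om), (col_mx ga eta); split.
- rewrite mul_row_block mulmx0 addr0 mul_mx_row GaK OmK Kd mulmxN.
  by rewrite addrC.
- rewrite mul_block_col mul0mx add0r Kd mul_col_mx etaT gaT.
  by [].
- rewrite (_ : 1%:M - gd_pi = block_mx 0 0 0 1%:M); last first.
    by rewrite (@scalar_mx_block _ 2 2) opp_block_mx add_block_mx !oppr0 !addr0 subrr.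
  by rewrite -mulmxA mul_row_block !mulmx0 mulmx1 !add0r mul_mx_row mulmx0 piOm row_mx0.
- rewrite mul_block_col !mul0mx addr0 mul1mx addr0 mul_col_mx mul0mx -mulmxA id1 mulmx0.
  by rewrite col_mx0.
rewrite mul_col_row gaOm det_lblock.
(* The composite is block triangular as ga Om = 0. From D (eta Om) = (ga Ga) D and the regularity of
   det D, the diagonal blocks have the same determinant, which is 1 modulo y. *)
have -> : \det (eta *m Om) = \det (ga *m Ga).
  have e : D *m (eta *m Om) = ga *m Ga *m D.
    have: ga *m Th *m Om = mxK *m ga *m Om + D *m eta *m Om by rewrite gaT mulmxDl.
    rewrite -(mulmxA ga) -(mulmxA mxK ga) gaOm mulmx0 add0r -(mulmxA D eta) OmK mulmxBr.
    by rewrite (mulmxA ga Ga) (mulmxA ga Om) gaOm mul0mx subr0 => <-.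
  have dinj f c : \det (mxpow mxK f) * c = 0 -> c = 0.
    elim: f => [|f IH]; first by rewrite det1 mul1r.
    rewrite mxpowS det_mulmx -mulrA => e0; apply: IH; apply: y_inj; apply: y_inj.
    by rewrite mulrA -expr2 -det_scalar -mxKK det_mulmx -mulrA e0 mulr0.
  apply/eqP; rewrite -subr_eq0; apply/eqP/(dinj a.+2); rewrite Kd mulrBr -det_mulmx e.
  by rewrite det_mulmx mulrC subrr.
rewrite rmorphM -det_map_mx QE map_mxD map_mx1 map_mxZ sigma_y scale0r addr0.
by rewrite det1 mulr1.
Qed.

End Cases.

Lemma pair_trichotomy n (Th pi : 'M[C]_n.+1) : Th *m Th = y%:M -> pi *m pi = pi ->
  map_mx sigma (pi *m Th *m (1%:M - pi)) = 0 ->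
  (forall m (v : 'M_(n.+1, m)), pi *m Th *m (1%:M - pi) *m v = 0 -> pi *m v = v) ->
  [\/ pair_retract Th pi mxK (1%:M : 'M_(1 + 1)), pair_retract Th pi mxK beta_pi |
      exists a, pair_retract Th pi (gd_theta a.+2) gd_pi].
Proof.
move=> ThTh pipi s0 kerpi; have [id1 id2] := idem_compl pipi.
have [gen|[la [g [d [cyc [d0|[a [da [b0 [b1 gE]]]]]]]]]] :=
    local_analysis qe totB valB (1%:M - pi) ThTh; first last.
- case: a da gE => [|a] da gE; rewrite da in cyc.
    constructor 2; apply: (pair_beta ThTh pipi cyc (b0 := b0) (b1 := b1)).
    by move: gE; rewrite mxpowS [mxpow _ 0]/(1%:M) mulmx1.
  by constructor 3; exists a; apply: (pair_gd ThTh pipi cyc gE).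
- by rewrite d0 in cyc; constructor 1; apply: (pair_alpha ThTh cyc).
(* The case N = B V: applying pi to v0 + Th v1 with v0, v1 in V leaves pi Th v1, which is zero
   modulo y. So pi = 0 modulo y, 1 - pi is invertible and pi = 0, against the kernel condition. *)
exfalso; have spi : map_mx sigma pi = 0.
  apply/matrixP => i l; have [b0 [b1 e]] := gen (delta_mx l 0).
  have := congr1 (fun v : 'cV_n.+1 => map_mx sigma (pi *m v) i 0) e.
  rewrite -colE mulmxDr !mulmxA id1 mul0mx add0r map_mxM s0 mul0mx.
  by rewrite !mxE.
have [|e eE] := @local_unitC (\det (1%:M - pi)).
  by rewrite -det_map_mx map_mxB spi map_mx1 subr0 det1; apply/eqP/oner_neq0.
have [V [piV _]] := det_unit_inv eE.
have pi0 : pi = 0 by rewrite -[pi]mulmx1 -piV mulmxA id1 mul0mx.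
have := kerpi 1%N (delta_mx 0 0); rewrite pi0 !mul0mx => /(_ erefl)/matrixP/(_ 0 0)/esym/eqP.
by rewrite !mxE !eqxx oner_eq0.
Qed.

End Pairs.

Lemma intertwine_inv (R : comNzRingType) n (A B U U' : 'M[R]_n) :
  U' *m U = 1%:M -> U' *m A = B *m U' -> U *m B = A *m U.
Proof.
move=> U'U e; rewrite -[LHS]mulmx1 -U'U mulmxA -(mulmxA U) -e mulmxA.
by rewrite (mulmx1C U'U) mul1mx.
Qed.

Section Instance.
Variable k : closedFieldType.
Local Notation K := (powser k).
Local Notation P := (powser (powser k)).
Local Notation A := (dinf_ring k).
Local Notation X := (dinf_x k).
Local Notation Y := (dinf_y k).
Local Notation io := (dinf_of (k := k) : {rmorphism powser (powser k) -> dinf_ring k}).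
Local Notation z := (dinf_z k).

Definition rhoX : {rmorphism P -> K} := ps_map (@ps_coef0 k).
Definition injY : {rmorphism K -> P} := ps_map (@ps_const k).
Definition sigma0 : {rmorphism K -> k} := @ps_coef0 k.
Definition tau0 : {rmorphism k -> K} := @ps_const k.

Lemma rhoX_injY c : rhoX (injY c) = c. Proof. by []. Qed.
Lemma sigma0_tau0 c : sigma0 (tau0 c) = c. Proof. by []. Qed.

Lemma rhoX_ker p : rhoX p = 0 <-> exists q, p = X * q.
Proof.
split=> [p0|[q ->]]; last by rewrite rmorphM (_ : rhoX X = 0) ?mul0r //; apply/funext => -[|n].
have dv n : exists g, p n = ps_var * g.
  by apply: ps_var_div; move/(congr1 (fun f => f n)): p0; rewrite coef_ps0.
by have [g gE] := choice dv; exists g; apply/funext => n; rewrite gE coef_constM.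
Qed.

Lemma sigma0_ker c : sigma0 c = 0 <-> exists d, c = ps_var * d.
Proof. by split=> [/ps_var_div //|[d ->]]; rewrite rmorphM; apply: mul0r. Qed.

Lemma varK_inj (c : K) : ps_var * c = 0 -> c = 0.
Proof. by move=> e; apply: ps_var_inj; rewrite e mulr0. Qed.

Lemma sigma0_rhoX_unit p : sigma0 (rhoX p) <> 0 -> exists q, p * q = 1.
Proof. exact: ps2_unit. Qed.

Lemma valK (d : K) : d = 0 \/ exists a e e', d = ps_var ^+ a * e /\ e * e' = 1.
Proof.
have [?|/ps_order[a [e [dE /ps_field_unit[e' ee']]]]] := EM (d = 0); first by left.
by right; exists a, e, e'.
Qed.

Lemma totK (a b : K) : (exists c, b = a * c) \/ (exists c, a = b * c).
Proof.
have [->|[i [e [e' [-> ee']]]]] := valK a; first by right; exists 0; rewrite mulr0.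
have [->|[j [f [f' [-> ff']]]]] := valK b; first by left; exists 0; rewrite mulr0.
have [le|/ltnW le] := leqP i j; [left|right].
  exists (ps_var ^+ (j - i)%N * f * e'); rewrite -{1}(subnKC le) exprD.
  transitivity (ps_var ^+ i * ps_var ^+ (j - i) * f * (e * e')); last by ring.
  by rewrite ee' mulr1.
exists (ps_var ^+ (i - j)%N * e * f'); rewrite -{1}(subnKC le) exprD.
transitivity (ps_var ^+ j * ps_var ^+ (i - j) * e * (f * f')); last by ring.
by rewrite ff' mulr1.
Qed.

Lemma injY_var : injY ps_var = Y.
Proof. exact: ps_map_var. Qed.

Local Notation lattice := (lattice injY X).
Local Notation vK := (ps_var : powser k).

Definition Z_alpha : 'M[P]_(1 + 1) := lattice (1%:M : 'M_(1 + 1)) (mxK vK).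
Definition Z_beta : 'M[P]_(1 + 1) := lattice (beta_pi _) (mxK vK).
Definition Z_gd a : 'M[P]_((1 + 1) + (1 + 1)) := lattice (gd_pi _) (gd_theta vK a).

(** A retract of pairs induces maps of the lattices, and their composite has the same determinant as
    that of the pairs, so it stays a unit. *)
Lemma lattice_retract (M N : lmodType A) n n1 (Z : 'M_n) (Th pi : 'M_n) (Th1 pi1 : 'M_n1.+1) U U' :
  pi *m pi = pi -> pi1 *m pi1 = pi1 -> U' *m U = 1%:M -> U' *m Z = lattice pi Th *m U' ->
  pair_retract sigma0 Th pi Th1 pi1 -> indecomposable M ->
  quad_mod io z M Z -> quad_mod io z N (lattice pi1 Th1) -> mod_iso M N.
Proof.
move=> id id1 U'U UZ [G1 [G2 [e1 e2 e3 e4 e5]]] indM qM qN.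
have [F1 [F1E F1c]] := lattice_map injY (@X_mul_inj k) id1 id e1 e3.
have [F2 [F2E F2c]] := lattice_map injY (@X_mul_inj k) id id1 e2 e4.
have [|d dE] := @ps_field_unit k (\det (G2 *m G1)).
  by move: e5; rewrite /sigma0 /= /ps_coef0 => ->; apply/eqP/oner_neq0.
have detE := lattice_det (@X_mul_inj k) id1 F1E F2E.
have qM' : quad_mod io z M (lattice pi Th).
  exact: (quad_mod_conj (mulmx1C U'U) (intertwine_inv U'U UZ) qM).
apply: (quad_mod_retract (dinf_quad_ext k) F1c F2c (c := injY d) _ indM qM' qN).
by rewrite detE -rmorphM dE rmorph1.
Qed.

Lemma quad_mod_sq (M : lmodType A) n (Z : 'M_n) : quad_mod io z M Z ->
  Z *m Z = (X ^+ 2 * injY vK)%:M.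
Proof. by move=> [e b]; rewrite injY_var; apply: (quad_basis_sq (dinf_quad_ext k) b). Qed.

Lemma quad_mod_trichotomy (M Na Nb : lmodType A) (Ng : nat -> lmodType A) n (Z : 'M_n.+1) :
  quad_mod io z Na Z_alpha -> quad_mod io z Nb Z_beta ->
  (forall a, quad_mod io z (Ng a) (Z_gd a.+2)) ->
  indecomposable M -> (forall i j, Z i j 0%N 0%N = 0) -> quad_mod io z M Z ->
  [\/ mod_iso M Na, mod_iso M Nb | exists a, mod_iso M (Ng a)].
Proof.
move=> qa qb qg indM Z0 qM; have ZZ := quad_mod_sq qM.
have [|Th [pi [U [U' [[ThTh id U'U UZ] [s0 ker]]]]]] := lattice_normal_form rhoX_injY sigma0_tau0
  rhoX_ker (@X_mul_inj k) sigma0_ker varK_inj sigma0_rhoX_unit totK (@ps_field_no_zero_div k) ZZ.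
  by apply/matrixP => i j; rewrite !mxE; apply: Z0.
have bb : beta_pi _ *m beta_pi _ = beta_pi K.
  by rewrite mulmx_block !(mul0mx, mulmx0, addr0, mulmx1).
have gg : gd_pi _ *m gd_pi _ = gd_pi K.
  by rewrite mulmx_block !(mul0mx, mulmx0, addr0, mulmx1).
have sy : sigma0 vK = 0 by [].
have luC (c : K) : sigma0 c <> 0 -> exists d, c * d = 1 by apply: ps_field_unit.
have [r|r|[a r]] := pair_trichotomy (dbl_quad_ext k) totK valK sy varK_inj luC ThTh id s0 ker.
- by constructor 1; apply: (lattice_retract id (mulmx1 1%:M) U'U UZ r indM qM qa).
- by constructor 2; apply: (lattice_retract id bb U'U UZ r indM qM qb).
by constructor 3; exists a; apply: (lattice_retract id gg U'U UZ r indM qM (qg a)).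
Qed.

End Instance.

(** * Free summands *)

Lemma det_block11 (R : comNzRingType) (a b c d : R) :
  \det (block_mx a%:M b%:M c%:M d%:M : 'M_(1 + 1)) = a * d - b * c.
Proof.
set M : 'M_(1 + 1) := block_mx _ _ _ _.
pose i1 : 'I_(1 + 1) := lift ord0 ord0.
have o0 : ord0 = lshift 1 ord0 :> 'I_(1 + 1) by apply: val_inj.
have o1 : i1 = rshift 1 ord0 by apply: val_inj.
have E00 : M ord0 ord0 = a by rewrite o0 block_mxEul mxE.
have E01 : M ord0 i1 = b by rewrite o1 o0 block_mxEur mxE.
have E10 : M i1 ord0 = c by rewrite o1 o0 block_mxEdl mxE.
have E11 : M i1 i1 = d by rewrite o1 block_mxEdr mxE.
move: M E00 E01 E10 E11 => M E00 E01 E10 E11.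
rewrite (expand_det_row _ ord0) !big_ord_recl big_ord0 /cofactor !det_mx11 !mxE.
have l0 : lift i1 0 = ord0 by apply: val_inj.
have l1 : lift ord0 0 = i1 by [].
rewrite -/i1 l0 ?l1.
by rewrite E00 E01 E10 E11 /= /bump /=; ring.
Qed.

(** The map from A sends 1 to the j-th basis vector; the map back is v |-> la Z v + (la v) z with la
    the i-th coordinate. The composite is multiplication by Z_ij + c z, whose determinant is its
    norm. *)
Lemma quad_free_retract (P : comNzRingType) (w : P) n (Z : 'M[P]_n) i j :
  Z *m Z = w%:M -> exists (F1 : 'M_(n, 1 + 1)) (F2 : 'M_(1 + 1, n)) (c : P),
  [/\ F1 *m mxK w = Z *m F1, F2 *m Z = mxK w *m F2 &
      \det (F2 *m F1) = Z i j ^+ 2 - w * c ^+ 2].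
Proof.
move=> ZZ; pose g : 'cV[P]_n := delta_mx j 0; pose la : 'rV[P]_n := delta_mx 0 i.
exists (row_mx g (Z *m g)), (col_mx (la *m Z) la), ((i == j)%:R); split.
- exact/esym/row_K_comm.
- by rewrite mul_col_mx -mulmxA ZZ mul_block_col !mul0mx add0r addr0 mul1mx mul_scalar_mx mul_mx_scalar.
have laZg : la *m Z *m g = (Z i j)%:M.
  by rewrite [LHS]mx11_scalar -rowE -colE !mxE.
have lag : la *m g = ((i == j)%:R)%:M.
  by rewrite [LHS]mx11_scalar -rowE !mxE eqxx andbT.
rewrite mul_col_row mulmxA laZg lag -(mulmxA la Z Z) ZZ mul_mx_scalar -scalemxAl lag.
by rewrite scale_scalar_mx (mulmxA la) laZg det_block11; ring.
Qed.

Section LatticeShape.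
Variables (P C : comNzRingType) (j : {rmorphism C -> P}) (x : P) (y : C).

Lemma lattice_one n (Th : 'M[C]_n) : lattice j x 1%:M Th = x *: map_mx j Th.
Proof.
rewrite /lattice /lat_delta /lat_deltaV subrr map_mx0 scaler0 !addr0 map_mx1 mul1mx.
by rewrite scalemx1 mul_mx_scalar.
Qed.

Lemma lattice_block m l (a : 'M[C]_m) b c (d : 'M_l) :
  lattice j x (block_mx 1%:M 0 0 0) (block_mx a b c d) =
  block_mx (x *: map_mx j a) (map_mx j b) (x ^+ 2 *: map_mx j c) (x *: map_mx j d).
Proof.
have E : 1%:M - block_mx 1%:M 0 0 0 = block_mx 0 0 0 1%:M :> 'M[C]_(m + l).
  by rewrite scalar_mx_block opp_block_mx add_block_mx !oppr0 !addr0 subrr.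
rewrite /lattice /lat_delta /lat_deltaV E !map_block_mx !map_mx0 !map_mx1 !scale_block_mx.
rewrite !scaler0 !add_block_mx !addr0 !add0r !mulmx_block !mul0mx !mulmx0 !addr0 !add0r.
by rewrite !mul1mx !mulmx1 !scalemx1 !mul_mx_scalar !mul_scalar_mx scalerA expr2.
Qed.

Lemma lattice_sq n (pi Th : 'M[C]_n) : pi *m pi = pi -> Th *m Th = y%:M ->
  lattice j x pi Th *m lattice j x pi Th = (x ^+ 2 * j y)%:M.
Proof.
move=> id ThTh; rewrite [X in _ *m X]/lattice !mulmxA latticeE // -!scalemxAl.
rewrite -(mulmxA _ (map_mx j Th) (map_mx j Th)) -map_mxM ThTh map_scalar_mx mul_mx_scalar.
by rewrite -scalemxAl lat_deltaVK // !scale_scalar_mx; congr (_%:M); ring.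
Qed.

Lemma gd_theta_sq a : gd_theta y a *m gd_theta y a = y%:M.
Proof.
rewrite mulmx_block !mul0mx !mulmx0 !addr0 !add0r mulmxN mulNmx mulmxN opprK !mxKK.
rewrite (mxpow_comm (B := mxK y)) ?subrr //; last first.
by rewrite (@scalar_mx_block _ 2 2).
Qed.

End LatticeShape.

Lemma quad_mod_ring (P A : comNzRingType) (io : {rmorphism P -> A}) (z : A) (w : P) :
  quad_ext io z w -> quad_mod io z (A^o) (mxK w).
Proof.
move=> qe; have zz : z * z = io w by case: qe.
exists (fun u => io (usubmx u 0 0) + io (dsubmx u 0 0) * z : A^o); split=> [u v|p u|u|u|m].
- by rewrite !mxE !rmorphD mulrDl addrACA.
- by rewrite !mxE !rmorphM -mulrA -mulrDr.
- rewrite -[X in mxK w *m X]vsubmxK mul_block_col !mul0mx add0r addr0 mul1mx mul_scalar_mx.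
  have wE : (w *: dsubmx u) 0 0 = w * dsubmx u 0 0 by rewrite mxE.
  rewrite col_mxKu col_mxKd wE rmorphM -zz.
  rewrite -[LHS]/(z * (io (usubmx u 0 0) + io (dsubmx u 0 0) * z)); ring.
- case: qe => _ _ un /un[u0 d0]; rewrite -[u]vsubmxK [usubmx u]mx11_scalar u0.
  by rewrite [dsubmx u]mx11_scalar d0 raddf0 col_mx0.
exists (col_mx (qx0 qe m)%:M (qx1 qe m)%:M).
by rewrite col_mxKu col_mxKd !mxE eqxx !mulr1n -qxE.
Qed.

Lemma regular_free (A : comNzRingType) : free_mod A^o.
Proof.
exists 1%N; have [|f fE] := @linear_ex A A^o 'cV[A]_1 (fun a => const_mx a).
  by move=> a u v; apply/matrixP => i j; rewrite !mxE.
apply: (@mod_iso_bij _ _ _ f) => [x|v]; rewrite ?fE.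
  by move/matrixP/(_ 0 0); rewrite !mxE.
by exists (v 0 0); rewrite fE; apply/matrixP => i j; rewrite !ord1 mxE.
Qed.

Section FreeSummand.
Variable k : closedFieldType.
Local Notation P := (powser (powser k)).
Local Notation A := (dinf_ring k).
Local Notation io := (dinf_of (k := k) : {rmorphism powser (powser k) -> dinf_ring k}).
Local Notation z := (dinf_z k).
Local Notation w := (dinf_w k).

Lemma quad_mod_free (M : lmodType A) n (Z : 'M[P]_n) i j :
  indecomposable M -> quad_mod io z M Z -> Z i j 0%N 0%N <> 0 -> free_mod M.
Proof.
move=> indM qM Zij; have ZZ : Z *m Z = w%:M.
  by case: (qM) => e b; apply: (quad_basis_sq (dinf_quad_ext k) b).
have [F1 [F2 [c [e1 e2 e3]]]] := quad_free_retract i j ZZ.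
have [|d dE] := @ps2_unit k (\det (F2 *m F1)).
  rewrite e3 !expr2 !coef_psD !coef_psN /dinf_w !coef0_ps_mul mulr0 mul0r subr0.
  by move/eqP; rewrite mulf_eq0 orbb => /eqP.
have isoM := quad_mod_retract (dinf_quad_ext k) e1 e2 dE indM qM
  (quad_mod_ring (dinf_quad_ext k)).
by have [m isoA] := regular_free A; exists m; apply: mod_iso_trans isoM isoA.
Qed.

End FreeSummand.

(** * Indecomposability *)

Lemma block11_ex (R : comNzRingType) (E : 'M[R]_(1 + 1)) : exists b c d,
  E = block_mx (E 0 0)%:M b%:M c%:M d%:M.
Proof.
exists (ursubmx E 0 0), (dlsubmx E 0 0), (drsubmx E 0 0).
rewrite -[LHS]submxK; congr block_mx; try exact: mx11_scalar.
by rewrite [LHS]mx11_scalar !mxE; congr (E _ _)%:M; apply: val_inj.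
Qed.

Lemma scalar11_inj (R : comNzRingType) (a b : R) : a%:M = b%:M :> 'M_1 -> a = b.
Proof. by move/matrixP/(_ 0 0); rewrite !mxE. Qed.

(** What commutes with multiplication by t is multiplication by some a + c t, with the norm as
    determinant. *)
Lemma det_comm_mxK (R : comNzRingType) (y : R) (E : 'M[R]_(1 + 1)) :
  E *m mxK y = mxK y *m E -> exists c, \det E = E 0 0 ^+ 2 - y * c ^+ 2.
Proof.
have [b [c [d EE]]] := block11_ex E; move: (E 0 0) EE => a ->.
rewrite !mulmx_block !mul0mx !mulmx0 !mulmx1 !mul1mx !addr0 !add0r.
rewrite !mul_mx_scalar ?mul_scalar_mx !scale_scalar_mx.
case/eq_block_mx => /scalar11_inj -> _ /scalar11_inj -> _; exists c.
by rewrite det_block11; ring.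
Qed.

Section Commutant.
Variables (P C : comNzRingType) (K : fieldType).
Variables (rho : {rmorphism P -> C}) (j : {rmorphism C -> P}) (sigma : {rmorphism C -> K}).
Variables (x : P) (y : C).
Hypothesis rhoj : forall c, rho (j c) = c.
Hypothesis rho_ker : forall p, rho p = 0 <-> exists q, p = x * q.
Hypothesis x_inj : forall p, x * p = 0 -> p = 0.
Hypothesis sigma_y : sigma y = 0.
Hypothesis y_inj : forall c, y * c = 0 -> c = 0.
Hypothesis local_unit : forall p, sigma (rho p) <> 0 -> exists q, p * q = 1.

Local Notation eps := (sigma \o rho : {rmorphism P -> K}).

(* The commutant of Z is local with residue field K, evaluated at a diagonal entry. *)
Definition local_commutant n (i : 'I_n) (Z : 'M[P]_n) : Prop :=
  exists r, forall E, E *m Z = Z *m E -> eps (\det E) = eps (E i i) ^+ r.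

(** An idempotent of unit determinant is 1. If the chosen diagonal entry of E vanishes in the
    residue field this applies to 1 - E, otherwise to E. *)
Lemma local_commutant_idem n (i : 'I_n) (Z : 'M[P]_n) : local_commutant i Z ->
  forall E, E *m Z = Z *m E -> E *m E = E -> E = 0 \/ E = 1%:M.
Proof.
move=> [r detE] E EZ EE.
have inv F : F *m F = F -> eps (\det F) <> 0 -> F = 1%:M.
  move=> FF /local_unit[c /det_unit_inv[F' [FF' _]]].
  by rewrite -FF' -{2}FF -mulmxA FF' mulmx1.
have [e0|/eqP e0] := eqVneq (eps (E i i)) 0; last first.
  by right; apply: inv => //; rewrite detE //; apply/eqP; rewrite expf_neq0 //; apply/eqP.
left; have : 1%:M - E = 1%:M.
  apply: inv; first by rewrite mulmxBr mulmx1 mulmxBl mul1mx EE subrr subr0.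
  rewrite detE; last by rewrite mulmxBr mulmxBl mulmx1 mul1mx EZ.
  rewrite !mxE eqxx [eps (_ - _)]rmorphB rmorph1 [X in _ - X]e0 subr0 expr1n.
  by apply/eqP/oner_neq0.
by move/eqP; rewrite subr_eq -subr_eq0 opprD addrA subrr sub0r oppr_eq0 => /eqP.
Qed.

Lemma eps_jy : eps (j y) = 0.
Proof. by rewrite /= rhoj sigma_y. Qed.
Lemma eps_x : eps x = 0.
Proof. by rewrite /= (rho_x rho_ker) rmorph0. Qed.

Lemma local_commutant_alpha : @local_commutant (1 + 1) 0 (lattice j x 1%:M (mxK y)).
Proof.
exists 2%N => E; rewrite lattice_one -scalemxAr -scalemxAl => /(scalemx_reg_inj x_inj) EK.
have KE : map_mx j (mxK y) = mxK (j y).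
  by rewrite map_block_mx !map_mx0 !map_scalar_mx rmorph1.
rewrite KE in EK; have [c ->] := det_comm_mxK EK.
by rewrite rmorphB rmorphXn rmorphM eps_jy mul0r subr0.
Qed.

(** For E with rows (a, b) and (c, d), commuting gives x^2 b = y c and y a = y d up to order of
    factors; so x divides c, a = d modulo x, and the determinant is a^2 in the residue field. *)
Lemma local_commutant_beta : @local_commutant (1 + 1) 0 (lattice j x (beta_pi C) (mxK y)).
Proof.
exists 2%N => E; rewrite lattice_block !map_mx0 !scaler0 !map_scalar_mx rmorph1 scalemx1.
have [b [c [d EE]]] := block11_ex E; move: (E 0 0) EE => a ->.
rewrite !mulmx_block !mul0mx !mulmx0 !addr0 !add0r !mul_mx_scalar !scale_scalar_mx.
case/eq_block_mx => /scalar11_inj e1 /scalar11_inj e2 _ _.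
have [q cq] : exists q, c = x * q.
  apply/rho_ker/y_inj; rewrite -{1}(rhoj y) -rmorphM.
  by apply/rho_ker; exists (x * b); rewrite mulrC -e1; ring.
rewrite det_block11 cq [eps (_ - _)]rmorphB !rmorphM eps_x mul0r mulr0 subr0 expr2.
have: rho (a - d) = 0.
  by apply: y_inj; rewrite -{1}(rhoj y) -rmorphM mulrBr e2 mulrC subrr rmorph0.
by rewrite rmorphB => /eqP; rewrite subr_eq0 => /eqP ad; rewrite /= ad.
Qed.

(** D E3 = 0 modulo x makes E3 divisible by x. After cancelling x, E1 commutes with K in the residue
    field because y divides D, so det E1 is there the square of its corner; and E1 D = D E4 modulo x
    gives det E4 = det E1. *)
Lemma local_commutant_gd a : @local_commutant ((1 + 1) + (1 + 1)) 0 (lattice j x (gd_pi C) (gd_theta y a.+2)).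
Proof.
exists 4%N => E; rewrite lattice_block map_mx0 scaler0 map_mxN scalerN.
move Dm : (mxpow _ _) => D.
have DD : D = y *: mxpow (mxK y) a by rewrite -Dm !mxpowS mulmxA mxKK mul_scalar_mx.
have Dinj m (X : 'M[C]_(1 + 1, m)) : D *m X = 0 -> X = 0.
  rewrite -Dm; elim: (a.+2) X => [|e IH] X; first by rewrite mul1mx.
  rewrite mxpowS -mulmxA => e0; apply: IH; apply: (scalemx_reg_inj y_inj); rewrite scaler0.
  by rewrite -mul_scalar_mx -(mxKK y) -mulmxA e0 mulmx0.
have detD c : \det D * c = 0 -> c = 0.
  rewrite -Dm; elim: (a.+2) c => [|f IH] c; first by rewrite det1 mul1r.
  rewrite mxpowS det_mulmx -mulrA => e0; apply: IH; apply: y_inj; apply: y_inj.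
  by rewrite mulrA -expr2 -det_scalar -(mxKK y) det_mulmx -mulrA e0 mulr0.
have E00 : E 0 0 = ulsubmx E 0 0 by rewrite !mxE; congr (E _ _); apply: val_inj.
rewrite {}E00 -{1 2 3}[E]submxK.
move: (ulsubmx E) (@ursubmx _ 2 2 2 2 E) (@dlsubmx _ 2 2 2 2 E) (@drsubmx _ 2 2 2 2 E) => E1 E2 E3 E4.
rewrite !mulmx_block !mul0mx !mulmx0 !addr0 !add0r.
case/eq_block_mx => e11 e12 _ _.
have rx m l (X : 'M[P]_(m, l)) : map_mx rho (x *: X) = 0 by rewrite map_mxZ (rho_x rho_ker) scale0r.
have [|F3 F3E] := @mx_rho_ker _ _ _ _ rho_ker _ _ E3.
  apply: Dinj; have := congr1 (map_mx rho) e11.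
  by rewrite map_mxD !map_mxM !rx (map_jK rhoj) mulmx0 mul0mx add0r => <-.
have e11' : E1 *m map_mx j (mxK y) = map_mx j (mxK y) *m E1 + map_mx j D *m F3.
  by apply: (scalemx_reg_inj x_inj); rewrite scalemxAr e11 F3E scalerDr scalemxAl scalemxAr.
have det1E : eps (\det E1) = eps (E1 0 0) ^+ 2.
  have [|c] := @det_comm_mxK _ (sigma y) (map_mx sigma (map_mx rho E1)).
    have sK : map_mx sigma (mxK y) = mxK (sigma y).
      by rewrite map_block_mx !map_mx0 !map_scalar_mx rmorph1.
    have := congr1 (fun X => map_mx sigma (map_mx rho X)) e11'.
    rewrite map_mxD !map_mxM !(map_jK rhoj) map_mxD !map_mxM sK => ->.
    by rewrite [in X in _ + X]DD map_mxZ sigma_y scale0r mul0mx addr0.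
  by rewrite sigma_y mul0r subr0 !det_map_mx !mxE.
have det4E : eps (\det E4) = eps (\det E1).
  have := congr1 (map_mx rho) e12.
  rewrite !map_mxD !map_mxM map_mxN !rx oppr0 mulmx0 addr0 mul0mx add0r (map_jK rhoj).
  move/(congr1 determinant); rewrite !det_mulmx => e; rewrite /= -!det_map_mx.
  rewrite !(det_map_mx sigma); congr (sigma _); apply/eqP; rewrite -subr_eq0; apply/eqP/detD.
  by rewrite mulrBr -e mulrC subrr.
rewrite -det_map_mx map_block_mx (_ : map_mx eps E3 = 0) ?det_ublock; last first.
  by apply/matrixP => i l; rewrite F3E !mxE rmorphM eps_x mul0r.
by rewrite !det_map_mx det4E det1E -expr2 -exprM.
Qed.

End Commutant.

(** * Presentations *)

Lemma map_mxpow (R R' : comNzRingType) (f : {rmorphism R -> R'}) n (M : 'M[R]_n) a :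
  map_mx f (mxpow M a) = mxpow (map_mx f M) a.
Proof. by elim: a => [|a IH]; rewrite ?map_mx1 // !mxpowS map_mxM IH. Qed.

Lemma map_mxK (R R' : comNzRingType) (f : {rmorphism R -> R'}) y :
  map_mx f (mxK y) = mxK (f y).
Proof. by rewrite map_block_mx !map_mx0 !map_scalar_mx rmorph1. Qed.

Lemma mxpow_K_double (R : comNzRingType) (y : R) m : mxpow (mxK y) m.*2 = (y ^+ m)%:M.
Proof.
elim: m => [|m IH]; first by rewrite expr0.
by rewrite doubleS !mxpowS mulmxA mxKK IH mul_scalar_mx scale_scalar_mx exprS.
Qed.

Lemma map_mx_of_rows (R R' : comNzRingType) (f : {rmorphism R -> R'}) n rows :
  map_mx f (mx_of_rows n rows) = mx_of_rows n (map (map f) rows).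
Proof.
apply/matrixP => i j; rewrite !mxE.
have -> : nth [::] (map (map f) rows) i = map f (nth [::] rows i).
  have [lt|ge] := ltnP i (size rows); first by rewrite (nth_map [::]).
  by rewrite !nth_default ?size_map.
have [lt|ge] := ltnP j (size (nth [::] rows i)); first by rewrite (nth_map 0).
by rewrite [RHS]nth_default ?size_map // [X in f X]nth_default // rmorph0.
Qed.

Lemma rows2E (R : comNzRingType) (a b c d : R) :
  mx_of_rows 2 [:: [:: a; b]; [:: c; d]] = block_mx a%:M b%:M c%:M d%:M :> 'M_(1 + 1).
Proof.
apply/matrixP => i j.
case: (@split_ordP 1 1 i) => i' ->; case: (@split_ordP 1 1 j) => j' ->; rewrite !ord1;
by rewrite ?(block_mxEul, block_mxEur, block_mxEdl, block_mxEdr) !mxE.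
Qed.

Lemma rows4E (R : comNzRingType) (a11 a12 a13 a14 a21 a22 a23 a24 a31 a32 a33 a34 a41 a42 a43 a44 : R) :
  mx_of_rows 4 [:: [:: a11; a12; a13; a14]; [:: a21; a22; a23; a24];
    [:: a31; a32; a33; a34]; [:: a41; a42; a43; a44]] =
  block_mx (block_mx a11%:M a12%:M a21%:M a22%:M) (block_mx a13%:M a14%:M a23%:M a24%:M)
    (block_mx a31%:M a32%:M a41%:M a42%:M) (block_mx a33%:M a34%:M a43%:M a44%:M)
   :> 'M_((1 + 1) + (1 + 1)).
Proof.
apply/matrixP => i j.
case: (@split_ordP 2 2 i) => i' ->; case: (@split_ordP 2 2 j) => j' ->;
case: (@split_ordP 1 1 i') => i'' ->; case: (@split_ordP 1 1 j') => j'' ->; rewrite !ord1;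
do 2 rewrite ?(block_mxEul, block_mxEur, block_mxEdl, block_mxEdr);
by rewrite !mxE.
Qed.

Ltac mx2_entries :=
  apply/matrixP => -[[|[|//]] ?] -[[|[|//]] ?];
  rewrite !mxE ?big_ord_recl ?big_ord0 ?mxE -?val_eqE /=; ring.

Ltac mx4_entries :=
  apply/matrixP => -[[|[|[|[|//]]]] ?] -[[|[|[|[|//]]]] ?];
  rewrite !mxE ?big_ord_recl ?big_ord0 ?mxE -?val_eqE /=; ring.

Section Presentations.
Variables (R : comNzRingType) (x y z : R).

Definition alpha_rows : 'M[R]_2 := mx_of_rows 2 [:: [:: z; x * y]; [:: x; z]].
Definition betaP_rows : 'M[R]_2 := mx_of_rows 2 [:: [:: x ^+ 2; z]; [:: z; y]].
Definition betaM_rows : 'M[R]_2 := mx_of_rows 2 [:: [:: y; - z]; [:: - z; x ^+ 2]].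
Definition gamma_rows m : 'M[R]_4 := mx_of_rows 4
  [:: [:: z; x * y; 0; - y ^+ m.+1]; [:: x; z; y ^+ m; 0];
      [:: 0; 0; z; x * y]; [:: 0; 0; x; z]].
Definition delta_rows m : 'M[R]_4 := mx_of_rows 4
  [:: [:: z; x * y; - y ^+ m; 0]; [:: x; z; 0; y ^+ m];
      [:: 0; 0; z; x * y]; [:: 0; 0; x; z]].

Definition alpha_pres : 'M[R]_(1 + 1) := z%:M - x *: mxK y.
Definition beta_pres : 'M[R]_(1 + 1) := z%:M - block_mx 0 y%:M (x ^+ 2)%:M 0.
Definition gd_pres a : 'M[R]_((1 + 1) + (1 + 1)) :=
  z%:M - block_mx (x *: mxK y) (mxpow (mxK y) a) 0 (- (x *: mxK y)).

Lemma alpha_presE : alpha_pres = mx_of_rows 2 [:: [:: z; - (x * y)]; [:: - x; z]].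
Proof.
rewrite rows2E /alpha_pres /mxK (@scalar_mx_block _ 1 1) scale_block_mx opp_block_mx add_block_mx.
by rewrite !scaler0 !subr0 !sub0r !scale_scalar_mx mulr1 -!raddfN.
Qed.

Lemma beta_presE : beta_pres = mx_of_rows 2 [:: [:: z; - y]; [:: - x ^+ 2; z]].
Proof.
rewrite rows2E /beta_pres (@scalar_mx_block _ 1 1) opp_block_mx add_block_mx.
by rewrite !subr0 !sub0r -!raddfN.
Qed.

(** K^(2m) is the scalar y^m, the off-diagonal block of delta_m; K^(2m+1) = y^m K has the entries
    y^(m+1) and y^m of gamma_m. *)
Lemma gd_pres_even m : gd_pres m.*2 = mx_of_rows 4
  [:: [:: z; - (x * y); - y ^+ m; 0]; [:: - x; z; 0; - y ^+ m];
      [:: 0; 0; z; x * y]; [:: 0; 0; x; z]].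
Proof.
rewrite rows4E /gd_pres mxpow_K_double (@scalar_mx_block _ 2 2) !(@scalar_mx_block _ 1 1).
rewrite /mxK !scale_block_mx !opp_block_mx !add_block_mx.
by rewrite !raddfN !raddf0 block_mx0 !scale_scalar_mx !mulr1 -?exprSr ?scaler0 ?oppr0 ?opprK ?addr0 ?add0r.
Qed.

Lemma gd_pres_odd m : gd_pres m.*2.+1 = mx_of_rows 4
  [:: [:: z; - (x * y); 0; - y ^+ m.+1]; [:: - x; z; - y ^+ m; 0];
      [:: 0; 0; z; x * y]; [:: 0; 0; x; z]].
Proof.
rewrite rows4E /gd_pres mxpowS mxpow_K_double mul_mx_scalar (@scalar_mx_block _ 2 2) !(@scalar_mx_block _ 1 1).
rewrite /mxK !scale_block_mx !opp_block_mx !add_block_mx.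
by rewrite !raddfN !raddf0 block_mx0 !scale_scalar_mx !mulr1 -?exprSr ?scaler0 ?oppr0 ?opprK ?addr0 ?add0r.
Qed.

Lemma mod_iso_coker_invol n (phi psi U V : 'M[R]_n) :
  U *m U = 1%:M -> V *m V = 1%:M -> U *m phi = psi *m V -> mod_iso (coker phi) (coker psi).
Proof.
move=> UU VV e; apply: (mod_iso_coker UU e (V' := V)).
by rewrite -[LHS]mulmx1 -VV mulmxA -(mulmxA U) -e mulmxA UU mul1mx.
Qed.

Definition signs2 (a b : R) : 'M[R]_2 := mx_of_rows 2 [:: [:: a; 0]; [:: 0; b]].
Definition signs4 (a b c d : R) : 'M[R]_4 := mx_of_rows 4
  [:: [:: a; 0; 0; 0]; [:: 0; b; 0; 0]; [:: 0; 0; c; 0]; [:: 0; 0; 0; d]].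

Lemma alphaP_iso : mod_iso (coker alpha_rows) (coker alpha_pres).
Proof.
apply: (mod_iso_coker_invol (U := signs2 1 (-1)) (V := signs2 1 (-1))); rewrite ?alpha_presE;
mx2_entries.
Qed.

Lemma betaP_iso : mod_iso (coker betaP_rows) (coker beta_pres).
Proof.
apply: (mod_iso_coker (U := mx_of_rows 2 [:: [:: 0; 1]; [:: -1; 0]])
  (U' := mx_of_rows 2 [:: [:: 0; -1]; [:: 1; 0]]) (V := signs2 1 (-1)) (V' := signs2 1 (-1)));
rewrite ?beta_presE; mx2_entries.
Qed.

Lemma betaM_iso : mod_iso (coker betaM_rows) (coker beta_pres).
Proof.
apply: (mod_iso_coker_invol (U := 1%:M) (V := mx_of_rows 2 [:: [:: 0; -1]; [:: -1; 0]]));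
rewrite ?beta_presE ?mul1mx //; mx2_entries.
Qed.

Lemma gammaP_iso m : mod_iso (coker (gamma_rows m)) (coker (gd_pres m.*2.+1)).
Proof.
apply: (mod_iso_coker_invol (U := signs4 1 (-1) 1 1) (V := signs4 1 (-1) 1 1));
rewrite ?gd_pres_odd; mx4_entries.
Qed.

Lemma deltaP_iso m : mod_iso (coker (delta_rows m)) (coker (gd_pres m.*2)).
Proof.
apply: (mod_iso_coker_invol (U := signs4 1 (-1) 1 1) (V := signs4 1 (-1) 1 1));
rewrite ?gd_pres_even; mx4_entries.
Qed.

End Presentations.

Section OppositePresentations.
Variables (R : comNzRingType) (x y z : R).

(** For alpha, gamma and delta the second matrix of the factorization is the first one with - z for
    z. Signs on rows and columns lead to the same presentation z - Z, whence M(phi, psi) and M(psi,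
    phi) are isomorphic. *)
Lemma alphaM_iso : mod_iso (coker (alpha_rows x y (- z))) (coker (alpha_pres x y z)).
Proof.
apply: (mod_iso_coker_invol (U := signs2 (-1) (-1)) (V := signs2 1 1));
rewrite ?alpha_presE; mx2_entries.
Qed.

Lemma gammaM_iso m : mod_iso (coker (gamma_rows x y (- z) m)) (coker (gd_pres x y z m.*2.+1)).
Proof.
apply: (mod_iso_coker_invol (U := signs4 (-1) (-1) (-1) 1) (V := signs4 1 1 1 (-1)));
rewrite ?gd_pres_odd; mx4_entries.
Qed.

Lemma deltaM_iso m : mod_iso (coker (delta_rows x y (- z) m)) (coker (gd_pres x y z m.*2)).
Proof.
apply: (mod_iso_coker_invol (U := signs4 (-1) (-1) 1 (-1)) (V := signs4 1 1 (-1) 1));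
rewrite ?gd_pres_even; mx4_entries.
Qed.

End OppositePresentations.

Section MapRows.
Variables (R R' : comNzRingType) (f : {rmorphism R -> R'}) (x y z : R).

Lemma map_alpha_rows : map_mx f (alpha_rows x y z) = alpha_rows (f x) (f y) (f z).
Proof. by rewrite map_mx_of_rows /= rmorphM. Qed.
Lemma map_betaP_rows : map_mx f (betaP_rows x y z) = betaP_rows (f x) (f y) (f z).
Proof. by rewrite map_mx_of_rows /= rmorphXn. Qed.
Lemma map_betaM_rows : map_mx f (betaM_rows x y z) = betaM_rows (f x) (f y) (f z).
Proof. by rewrite map_mx_of_rows /= rmorphXn rmorphN. Qed.
Lemma map_gamma_rows m : map_mx f (gamma_rows x y z m) = gamma_rows (f x) (f y) (f z) m.
Proof. by rewrite map_mx_of_rows /= rmorphM rmorphN !rmorphXn rmorph0. Qed.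
Lemma map_delta_rows m : map_mx f (delta_rows x y z m) = delta_rows (f x) (f y) (f z) m.
Proof. by rewrite map_mx_of_rows /= rmorphM rmorphN !rmorphXn rmorph0. Qed.

End MapRows.

Section LatticePresentation.
Variables (C P A : comNzRingType) (j : {rmorphism C -> P}) (io : {rmorphism P -> A}).
Variables (x : P) (y : C) (z : A).

Lemma lattice_alpha_pres :
  z%:M - map_mx io (lattice j x 1%:M (mxK y)) = alpha_pres (io x) (io (j y)) z.
Proof. by rewrite lattice_one map_mxZ !map_mxK. Qed.

Lemma lattice_beta_pres :
  z%:M - map_mx io (lattice j x (beta_pi C) (mxK y)) = beta_pres (io x) (io (j y)) z.
Proof.
rewrite lattice_block !map_mx0 !scaler0 !map_scalar_mx rmorph1 scalemx1 map_block_mx.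
by rewrite !map_mx0 !map_scalar_mx rmorphXn.
Qed.

Lemma lattice_gd_pres a :
  z%:M - map_mx io (lattice j x (gd_pi C) (gd_theta y a)) = gd_pres (io x) (io (j y)) z a.
Proof.
rewrite lattice_block map_mx0 scaler0 map_block_mx !map_mxZ map_mx0 !map_mxN.
by rewrite !map_mxpow !map_mxK scalerN.
Qed.

End LatticePresentation.

Section LatticeResidue.
Variables (P C : comNzRingType) (K : fieldType).
Variables (rho : {rmorphism P -> C}) (j : {rmorphism C -> P}) (sigma : {rmorphism C -> K}).
Variables (x : P) (y : C).
Hypothesis rhoj : forall c, rho (j c) = c.
Hypothesis rho_ker : forall p, rho p = 0 <-> exists q, p = x * q.
Hypothesis sigma_y : sigma y = 0.

Local Notation eps := (sigma \o rho : {rmorphism P -> K}).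
Let epsx : eps x = 0. Proof. exact: (eps_x sigma rho_ker). Qed.
Let epsy : eps (j y) = 0. Proof. exact: (eps_jy rhoj sigma_y). Qed.

Lemma lattice_alpha_residue : map_mx eps (lattice j x 1%:M (mxK y)) = 0.
Proof. by rewrite lattice_one map_mxZ epsx scale0r. Qed.

Lemma lattice_beta_residue : map_mx eps (lattice j x (beta_pi C) (mxK y)) = 0.
Proof.
rewrite lattice_block map_block_mx !map_mxZ rmorphXn epsx !map_mx0 !map_scalar_mx epsy.
by rewrite expr0n !scale0r raddf0 block_mx0.
Qed.

Lemma lattice_gd_residue a :
  map_mx eps (lattice j x (gd_pi C) (gd_theta y a.+2)) = 0.
Proof.
rewrite lattice_block map_block_mx !map_mxZ rmorphXn epsx !mxpowS mulmxA mxKK mul_scalar_mx.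
by rewrite !map_mxZ epsy expr0n !scale0r block_mx0.
Qed.

End LatticeResidue.

Section DinfModules.
Variable k : closedFieldType.
Local Notation P := (powser (powser k)).
Local Notation A := (dinf_ring k).
Local Notation io := (dinf_of (k := k) : {rmorphism powser (powser k) -> dinf_ring k}).
Local Notation z := (dinf_z k).
Local Notation X := (dinf_x k).
Local Notation Y := (dinf_y k).
Local Notation vK := (ps_var : powser k).
Local Notation piS := (\pi_(dinf_ring k) : {rmorphism powser3 k -> dinf_ring k}).

Lemma beta_pi_idem (R : comNzRingType) : beta_pi R *m beta_pi R = beta_pi R.
Proof. by rewrite mulmx_block !(mul0mx, mulmx0, addr0, mulmx1). Qed.
Lemma gd_pi_idem (R : comNzRingType) : gd_pi R *m gd_pi R = gd_pi R.
Proof. by rewrite mulmx_block !(mul0mx, mulmx0, addr0, mulmx1). Qed.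

Lemma dinf_lattice_sq n (pi Th : 'M[powser k]_n) : pi *m pi = pi -> Th *m Th = vK%:M ->
  lattice (injY k) X pi Th *m lattice (injY k) X pi Th = (dinf_w k)%:M.
Proof. by move=> id ThTh; rewrite (lattice_sq _ _ id ThTh) injY_var. Qed.

Lemma alpha_pres_quad_mod : quad_mod io z (coker (alpha_pres (io X) (io Y) z)) (Z_alpha k).
Proof.
rewrite -(injY_var k) -lattice_alpha_pres; apply: (coker_quad_mod (dinf_quad_ext k)).
exact: dinf_lattice_sq (mulmx1 _) (mxKK _).
Qed.

Lemma beta_pres_quad_mod : quad_mod io z (coker (beta_pres (io X) (io Y) z)) (Z_beta k).
Proof.
rewrite -(injY_var k) -lattice_beta_pres; apply: (coker_quad_mod (dinf_quad_ext k)).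
exact: dinf_lattice_sq (beta_pi_idem _) (mxKK _).
Qed.

Lemma gd_pres_quad_mod a : quad_mod io z (coker (gd_pres (io X) (io Y) z a)) (Z_gd k a).
Proof.
rewrite -(injY_var k) -lattice_gd_pres; apply: (coker_quad_mod (dinf_quad_ext k)).
exact: dinf_lattice_sq (gd_pi_idem _) (gd_theta_sq _ _).
Qed.

Lemma indec_nonfree_cm_quad (N : lmodType A) n (i : 'I_n.+1) (Z : 'M[P]_n.+1) :
  local_commutant (rhoX k) (sigma0 k) i Z ->
  map_mx (sigma0 k \o rhoX k : {rmorphism P -> k}) Z = 0 ->
  quad_mod io z N Z -> indec_nonfree_cm N.
Proof.
move=> loc Z0 qN; split; first exact: quad_mod_cm qN.
  apply: (quad_mod_indecomposable _ qN).
  exact: (local_commutant_idem (@sigma0_rhoX_unit k) loc).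
apply: quad_mod_nonfree qN => a b.
by move/matrixP/(_ a b): Z0; rewrite !mxE.
Qed.

Let sigma_vK : sigma0 k vK = 0. Proof. by []. Qed.

Lemma Z_alpha_module (N : lmodType A) : quad_mod io z N (Z_alpha k) -> indec_nonfree_cm N.
Proof.
apply: indec_nonfree_cm_quad; last first.
  exact: (lattice_alpha_residue (injY k) (sigma0 k) _ (@rhoX_ker k)).
exact: (local_commutant_alpha (@rhoX_injY k) (@X_mul_inj k) sigma_vK).
Qed.

Lemma Z_beta_module (N : lmodType A) : quad_mod io z N (Z_beta k) -> indec_nonfree_cm N.
Proof.
apply: indec_nonfree_cm_quad; last first.
  exact: (lattice_beta_residue (@rhoX_injY k) (@rhoX_ker k) sigma_vK).
exact: (local_commutant_beta (sigma0 k) (@rhoX_injY k) (@rhoX_ker k) (@varK_inj k)).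
Qed.

Lemma Z_gd_module a (N : lmodType A) : quad_mod io z N (Z_gd k a.+2) -> indec_nonfree_cm N.
Proof.
apply: indec_nonfree_cm_quad; last first.
  exact: (lattice_gd_residue (@rhoX_injY k) (@rhoX_ker k) sigma_vK).
exact: (local_commutant_gd (@rhoX_injY k) (@rhoX_ker k) (@X_mul_inj k) sigma_vK (@varK_inj k)).
Qed.

Lemma mf_alphaP : mod_iso (mf_module (alphaP k) (alphaM k)) (coker (alpha_pres (io X) (io Y) z)).
Proof. rewrite /mf_module (map_alpha_rows piS); exact: alphaP_iso. Qed.
Lemma mf_alphaM : mod_iso (mf_module (alphaM k) (alphaP k)) (coker (alpha_pres (io X) (io Y) z)).
Proof. rewrite /mf_module (map_alpha_rows piS) rmorphN; exact: alphaM_iso. Qed.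
Lemma mf_betaP : mod_iso (mf_module (betaP k) (betaM k)) (coker (beta_pres (io X) (io Y) z)).
Proof. rewrite /mf_module (map_betaP_rows piS); exact: betaP_iso. Qed.
Lemma mf_betaM : mod_iso (mf_module (betaM k) (betaP k)) (coker (beta_pres (io X) (io Y) z)).
Proof. rewrite /mf_module (map_betaM_rows piS); exact: betaM_iso. Qed.
Lemma mf_gammaP m : mod_iso (mf_module (gammaP k m) (gammaM k m))
  (coker (gd_pres (io X) (io Y) z m.*2.+1)).
Proof. rewrite /mf_module (map_gamma_rows piS); exact: gammaP_iso. Qed.
Lemma mf_gammaM m : mod_iso (mf_module (gammaM k m) (gammaP k m))
  (coker (gd_pres (io X) (io Y) z m.*2.+1)).
Proof. rewrite /mf_module (map_gamma_rows piS) rmorphN; exact: gammaM_iso. Qed.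
Lemma mf_deltaP m : mod_iso (mf_module (deltaP k m) (deltaM k m))
  (coker (gd_pres (io X) (io Y) z m.*2)).
Proof. rewrite /mf_module (map_delta_rows piS); exact: deltaP_iso. Qed.
Lemma mf_deltaM m : mod_iso (mf_module (deltaM k m) (deltaP k m))
  (coker (gd_pres (io X) (io Y) z m.*2)).
Proof. rewrite /mf_module (map_delta_rows piS) rmorphN; exact: deltaM_iso. Qed.

End DinfModules.

(** * The punctured spectrum *)

Section LocalizedCokernel.
Variables (A : comNzRingType) (S : mult_set A).

Section Sums.
Variable M : lmodType A.

Lemma mkfracD (m m' : M) (s : {s : A | S s}) : mkfrac (m + m') s = mkfrac m s + mkfrac m' s.
Proof.
by rewrite addfrac; apply: mkfrac_eq; rewrite /= -scalerDr !scalerA.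
Qed.

Lemma mkfrac0 (s : {s : A | S s}) : mkfrac (0 : M) s = 0.
Proof. by apply: mkfrac_eq; rewrite !scaler0. Qed.

Lemma mkfrac_sum (I : finType) (F : I -> M) (s : {s : A | S s}) :
  mkfrac (\sum_i F i) s = \sum_i mkfrac (F i) s.
Proof. by apply: (big_morph (fun m => mkfrac m s)) => [m m'|]; rewrite ?mkfracD ?mkfrac0. Qed.

End Sums.

Lemma common_denominator (I : finType) (c : I -> loc_ring S) :
  exists (a : I -> A) (s : {s : A | S s}), forall i, c i = mkfrac (a i : A^o) s.
Proof.
suff [a [s sE]] : exists (a : I -> A) (s : {s : A | S s}), forall i, i \in enum I -> c i = mkfrac (a i : A^o) s.
  by exists a, s => i; apply: sE; rewrite mem_enum.
elim: (enum I) => [|i l [a [s IH]]]; first by exists (fun=> 0), (den_one S).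
have [b [t bt]] : exists b t, c i = mkfrac (b : A^o) t.
  by elim/mkfrac_ind: (c i) => b t; exists b, t.
exists (fun j => if j == i then sval s * b else sval t * a j), (den_mul s t) => j.
rewrite inE; case: eqP => [-> _|_ /= /IH ->]; rewrite ?bt; apply: mkfracr_eq; rewrite /=; ring.
Qed.

(* Lam and Sig are inverse isomorphisms, up to u, between coker phi and A^r. *)
Lemma loc_coker_free n r (phi Psi : 'M[A]_n) (Lam : 'M_(r, n)) (Sig : 'M_(n, r)) u :
  S u -> Lam *m phi = 0 -> Lam *m Sig = u%:M -> Sig *m Lam = u%:M + phi *m Psi ->
  @free_mod (loc_ring S) (loc_mod S (coker phi)).
Proof.
move=> Su Lphi LS SL; exists r; apply: mod_iso_sym.
pose b i := mkfrac (to_coker phi (col i Sig)) (den_one S).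
have [|g gE] := @linear_ex (loc_ring S) 'cV[loc_ring S]_r (loc_mod S (coker phi))
    (fun c => \sum_i c i 0 *: b i).
  move=> a c d; rewrite scaler_sumr -big_split; apply: eq_bigr => i _ /=.
  by rewrite !mxE scalerDl scalerA.
have gfrac (a : 'cV[A]_r) s : g (\col_i mkfrac (a i 0 : A^o) s) = mkfrac (to_coker phi (Sig *m a)) s.
  rewrite gE (_ : Sig *m a = \sum_i a i 0 *: col i Sig); last first.
    apply/colP => i; rewrite mxE summxE; apply: eq_bigr => l _.
    by rewrite !mxE mulrC.
  rewrite (big_morph (to_coker phi) (to_cokerD phi) (raddf0 _)) mkfrac_sum.
  apply: eq_bigr => i _; rewrite mxE -[LHS]/(loc_scale _ _) loc_scaleE.
  rewrite -[_ *: to_coker _ _]/(coker_scale _ _) coker_scaleE.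
  by apply: mkfrac_eq; rewrite /= mulr1.
apply: (@mod_iso_bij _ _ _ g).
  move=> c; have [a [s cE]] := common_denominator (fun i => c i 0).
  have -> : c = \col_i mkfrac ((\col_i a i) i 0 : A^o) s.
    by apply/colP => i; rewrite !mxE cE.
  rewrite gfrac -[0](mkfrac0 _ s) => /mkfracP[t St].
  rewrite !scalerA -[LHS]/(coker_scale _ _) -[0](_ : to_coker phi 0 = 0); last exact: raddf0.
  rewrite -[RHS]/(coker_scale _ _) !coker_scaleE scaler0 => /to_cokerP[v].
  rewrite subr0 => /(congr1 (mulmx Lam)); rewrite mulmxA Lphi mul0mx -scalemxAr mulmxA LS.
  rewrite mul_scalar_mx scalerA => e; apply/colP => i; rewrite !mxE -(mkfrac0 A^o s).
  apply/mkfracP; exists (t * sval s * u).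
    by rewrite !denomM // (valP s).
  move/colP/(_ i): e; rewrite !mxE => e.
  rewrite !scaler0 /GRing.scale /= mulrCA e mulr0 //.
elim/mkfrac_ind => q s; elim/coker_ind: q => v.
exists (\col_i mkfrac ((Lam *m v) i 0 : A^o) (den_mul s (exist _ u Su))).
rewrite gfrac mulmxA SL; apply: mkfrac_eq; rewrite /=.
rewrite -[LHS]/(coker_scale _ _) -[RHS]/(coker_scale _ _) !coker_scaleE.
apply/to_cokerP; exists (sval s *: (Psi *m v)).
rewrite mulmxDl mul_scalar_mx scalerDr scalerA addrAC subrr add0r.
by rewrite -mulmxA scalemxAr.
Qed.

End LocalizedCokernel.

Section FreeAwayFromX.
Variables (R : comNzRingType) (x y z : R).
Hypothesis zz : z ^+ 2 = x ^+ 2 * y.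

(** After inverting u the cokernel is free of rank r: Sig gives the generators that remain, and Lam
    expresses u times each original generator through them. *)
Definition splits_over n (phi : 'M[R]_n) (u : R) : Prop :=
  exists r (Lam : 'M_(r, n)) (Sig : 'M_(n, r)) Psi,
  [/\ Lam *m phi = 0, Lam *m Sig = u%:M & Sig *m Lam = u%:M + phi *m Psi].

Ltac entries := rewrite !mxE ?big_ord_recl ?big_ord0 ?mxE -?val_eqE /= ?exprS; ring: zz.

Let rows r n (l : seq (seq R)) : 'M[R]_(r, n) := \matrix_(i, j) nth 0 (nth [::] l i) j.

Lemma betaP_splits_y : splits_over (betaP_rows x y z) y.
Proof.
exists 1%N, (rows 1 2 [:: [:: y; - z]]), (rows 2 1 [:: [:: 1]; [:: 0]]),
  (rows 2 2 [:: [:: 0; 0]; [:: 0; -1]]).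
split.
- apply/matrixP => -[[|//] ?] -[[|[|//]] ?]; entries.
- apply/matrixP => -[[|//] ?] -[[|//] ?]; entries.
- apply/matrixP => -[[|[|//]] ?] -[[|[|//]] ?]; entries.
Qed.

Lemma betaP_splits_x : splits_over (betaP_rows x y z) (x ^+ 2).
Proof.
exists 1%N, (rows 1 2 [:: [:: - z; x ^+ 2]]), (rows 2 1 [:: [:: 0]; [:: 1]]),
  (rows 2 2 [:: [:: -1; 0]; [:: 0; 0]]).
split.
- apply/matrixP => -[[|//] ?] -[[|[|//]] ?]; entries.
- apply/matrixP => -[[|//] ?] -[[|//] ?]; entries.
- apply/matrixP => -[[|[|//]] ?] -[[|[|//]] ?]; entries.
Qed.

Ltac entries24 :=
  split; [ apply/matrixP => -[[|[|//]] ?] -[[|[|[|[|//]]]] ?]; entries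
         | apply/matrixP => -[[|[|//]] ?] -[[|[|//]] ?]; entries
         | apply/matrixP => -[[|[|[|[|//]]]] ?] -[[|[|[|[|//]]]] ?]; entries ].

Lemma delta_splits_y m : splits_over (delta_rows x y z m) (y ^+ m).
Proof.
exists 2%N, (rows 2 4 [:: [:: z; - (x * y); y ^+ m; 0]; [:: x; - z; 0; y ^+ m]]),
  (rows 4 2 [:: [:: 0; 0]; [:: 0; 0]; [:: 1; 0]; [:: 0; 1]]),
  (rows 4 4 [:: [:: 0; 0; 0; 0]; [:: 0; 0; 0; 0]; [:: 1; 0; 0; 0]; [:: 0; -1; 0; 0]]).
by entries24.
Qed.

Lemma delta_splits_x m : splits_over (delta_rows x y z m) x.
Proof.
exists 2%N, (rows 2 4 [:: [:: x; - z; 0; y ^+ m]; [:: 0; 0; x; - z]]),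
  (rows 4 2 [:: [:: 1; 0]; [:: 0; 0]; [:: 0; 1]; [:: 0; 0]]),
  (rows 4 4 [:: [:: 0; -1; 0; 0]; [:: 0; 0; 0; 0]; [:: 0; 0; 0; -1]; [:: 0; 0; 0; 0]]).
by entries24.
Qed.

(** Columns three and four solve for y^m e2 and y^(m+1) e1 in terms of e3 and e4, so y^(m+1) is a
    common denominator. *)
Lemma gamma_splits_y m : splits_over (gamma_rows x y z m) (y ^+ m.+1).
Proof.
exists 2%N, (rows 2 4 [:: [:: x * y; - (y * z); y ^+ m.+1; 0]; [:: z; - (x * y); 0; y ^+ m.+1]]),
  (rows 4 2 [:: [:: 0; 0]; [:: 0; 0]; [:: 1; 0]; [:: 0; 1]]),
  (rows 4 4 [:: [:: 0; 0; 0; 0]; [:: 0; 0; 0; 0]; [:: 0; - y; 0; 0]; [:: 1; 0; 0; 0]]).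
by entries24.
Qed.

(** The first column gives x e2 = - z e1 and the third x e4 = - z e3 - y^m e2; eliminating e2 from
    the latter costs a second factor x. *)
Lemma gamma_splits_x m : splits_over (gamma_rows x y z m) (x ^+ 2).
Proof.
exists 2%N, (rows 2 4 [:: [:: x ^+ 2; - (x * z); 0; y ^+ m * z]; [:: 0; 0; x ^+ 2; - (x * z)]]),
  (rows 4 2 [:: [:: 1; 0]; [:: 0; 0]; [:: 0; 1]; [:: 0; 0]]),
  (rows 4 4 [:: [:: 0; - x; 0; y ^+ m]; [:: 0; 0; 0; 0]; [:: 0; 0; 0; - x]; [:: 0; 0; 0; 0]]).
by entries24.
Qed.

End FreeAwayFromX.

Section LocallyFree.
Variable k : closedFieldType.
Local Notation A := (dinf_ring k).
Local Notation io := (dinf_of (k := k) : {rmorphism powser (powser k) -> dinf_ring k}).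
Local Notation z := (dinf_z k).
Local Notation X := (dinf_x k).
Local Notation Y := (dinf_y k).
Local Notation piS := (\pi_(dinf_ring k) : {rmorphism powser3 k -> dinf_ring k}).

Lemma dinf_zz : z ^+ 2 = io X ^+ 2 * io Y.
Proof. by rewrite expr2; case: (dinf_quad_ext k) => -> _ _; rewrite rmorphM rmorphXn. Qed.

(** A prime containing x and y contains z, because z^2 = x^2 y, and is then the maximal ideal. *)
Lemma prime_not_max (p : prime_idealr A) :
  ~ (forall a : A, a \in p <-> max_ideal a) -> io X \notin p \/ io Y \notin p.
Proof.
move=> np; have [yp|] := boolP (io Y \in p); last by right.
left; apply/negP => xp; apply: np => a; split; first exact: prime_max_ideal.
have zp : z \in p.
  by apply: (@prime_expr _ p z 2); rewrite dinf_zz idealMr.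
move=> /(max_idealE (dinf_quad_ext k))/split_xy[b [c E]].
rewrite (qxE (dinf_quad_ext k) a) E rmorphD !rmorphM.
by rewrite !rpredD // ?[io X * _]mulrC ?[io Y * _]mulrC ?idealMr // mulrC idealMr.
Qed.

Lemma splits_locally_free n (phi : 'M[A]_n) i j :
  splits_over phi (io X ^+ i) -> splits_over phi (io Y ^+ j) ->
  locally_free_punctured (coker phi).
Proof.
move=> [r [L [S [Psi [e1 e2 e3]]]]] [r' [L' [S' [Psi' [e1' e2' e3']]]]] p /prime_not_max[xp|yp].
  apply: (loc_coker_free _ e1 e2 e3).
  by apply/negP => /prime_expr; apply/negP.
apply: (loc_coker_free _ e1' e2' e3').
by apply/negP => /prime_expr; apply/negP.
Qed.

Lemma mf_beta_locally_free : locally_free_punctured (mf_module (betaP k) (betaM k)).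
Proof.
rewrite /mf_module (map_betaP_rows piS).
exact: (splits_locally_free (i := 2) (j := 1) (betaP_splits_x dinf_zz) (betaP_splits_y dinf_zz)).
Qed.

Lemma mf_gamma_locally_free m : locally_free_punctured (mf_module (gammaP k m) (gammaM k m)).
Proof.
rewrite /mf_module (map_gamma_rows piS).
exact: (splits_locally_free (i := 2) (gamma_splits_x dinf_zz m) (gamma_splits_y dinf_zz m)).
Qed.

Lemma mf_delta_locally_free m : locally_free_punctured (mf_module (deltaP k m) (deltaM k m)).
Proof.
rewrite /mf_module (map_delta_rows piS).
exact: (splits_locally_free (i := 1) (delta_splits_x dinf_zz m) (delta_splits_y dinf_zz m)).
Qed.

End LocallyFree.

(** * Normalization *)

(** The hypothesis says that a/s is almost integral: one denominator d serves all its powers. This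
    property passes to power series rings, which integral closedness in general does not. *)
Definition completely_integrally_closed (D : comNzRingType) : Prop :=
  forall s d a : D, s <> 0 -> d <> 0 ->
  (forall n, exists r, d * a ^+ n = s ^+ n * r) -> exists r, a = s * r.

Lemma field_cic (k : fieldType) : completely_integrally_closed k.
Proof.
move=> s d a /eqP s0 _ _; exists (s^-1 * a).
by rewrite mulrA mulfV ?mul1r.
Qed.

(** * Complete integral closedness of power series rings *)

Section PowserCIC.
Variable D : comNzRingType.
Hypothesis domD : no_zero_div D.
Hypothesis cicD : completely_integrally_closed D.
Local Notation T := (@ps_var D : powser D).
Implicit Types a s d u v : powser D.

Let coef0_neq0 u v : u 0%N <> 0 -> v 0%N <> 0 -> (u * v) 0%N <> 0.
Proof. by move=> u0 v0; rewrite coef0_ps_mul => /domD[]. Qed.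

Let coef0_expr u n : (u ^+ n) 0%N = u 0%N ^+ n.
Proof. exact: (rmorphXn (@ps_coef0 D : {rmorphism powser D -> D})). Qed.

Let expr_neq0 (c : D) n : c <> 0 -> c ^+ n <> 0.
Proof.
move=> c0; elim: n => [|n IH]; first by rewrite expr0; apply/eqP/oner_neq0.
by rewrite exprS => /domD[].
Qed.

Let TX_inj m u v : T ^+ m * u = T ^+ m * v -> u = v.
Proof. by elim: m => [|m IH]; rewrite ?mul1r // exprS -!mulrA => /ps_var_inj/IH. Qed.

Let TX_dvd m u v r : v 0%N <> 0 -> T ^+ m * u = v * r -> exists r', r = T ^+ m * r'.
Proof.
move=> v0 e; have [->|/ps_order[h [r1 [rE r10]]]] := EM (r = 0).
  by exists 0; rewrite mulr0.
have [le|lt] := leqP m h.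
  by exists (T ^+ (h - m)%N * r1); rewrite rE mulrA -exprD subnKC.
exfalso; apply: (coef0_neq0 v0 r10).
have <- : T ^+ (m - h)%N * u = v * r1.
  by apply: (@TX_inj h); rewrite mulrA -exprD subnKC ?(ltnW lt) // e rE mulrCA.
by rewrite coef_varXM leqn0 subn_eq0 leqNgt lt.
Qed.

Let almost s d a := forall n, exists r, d * a ^+ n = s ^+ n * r.

Let almost_sub s d a c : almost s d a -> almost s d (a - s * c).
Proof.
move=> al n; have [r rE] := choice al.
exists (\sum_(i < n.+1) r (n - i)%N * (- c) ^+ i *+ 'C(n, i)).
rewrite -mulrN exprDn !mulr_sumr; apply: eq_bigr => i _.
rewrite exprMn !mulrnAr; congr (_ *+ _).
have -> : s ^+ n = s ^+ (n - i) * s ^+ i by rewrite -exprD subnK // -ltnS.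
by rewrite (mulrA d) rE; ring.
Qed.

(** The constant terms satisfy the condition in D, so s(0) divides a(0). Subtracting s c and
    removing the factor T keeps the condition, since T is prime and does not divide s. *)
Let almost_step s d a : s 0%N <> 0 -> d 0%N <> 0 -> almost s d a ->
  exists cb : D * powser D, a = s * ps_const cb.1 + T * cb.2 /\ almost s d cb.2.
Proof.
move=> s0 d0 al; have [|c cE] := cicD (a := a 0%N) s0 d0.
  move=> n; have [r rE] := al n; exists (r 0%N).
  by rewrite -!coef0_expr -!coef0_ps_mul rE.
have [|b bE] := @ps_var_div _ (a - s * ps_const c).
  by rewrite coef_ps_sub coef0_ps_mul cE coef_const subrr.
exists (c, b); rewrite /= -bE addrC subrK; split=> // n.
have [r rE] := almost_sub (ps_const c) al n.
rewrite bE exprMn mulrCA in rE.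
have [|r' r'E] := TX_dvd _ rE; first by rewrite coef0_expr; apply: expr_neq0.
by exists r'; apply: (@TX_inj n); rewrite rE r'E mulrCA.
Qed.

Let almost_dvd s d a : s 0%N <> 0 -> d 0%N <> 0 -> almost s d a -> exists u, a = s * u.
Proof.
move=> s0 d0 al.
have [st stE] : exists st : powser D -> D * powser D, forall a, almost s d a ->
    a = s * ps_const (st a).1 + T * (st a).2 /\ almost s d (st a).2.
  have H b : exists cb : D * powser D, almost s d b ->
      b = s * ps_const cb.1 + T * cb.2 /\ almost s d cb.2.
    have [/(almost_step s0 d0)[cb ?]|?] := EM (almost s d b); first by exists cb.
    by exists (0, 0).
  by have [st stE] := choice H; exists st.
have [b [u [b0 bE]]] := stream_unfold st a.
have bS n : almost s d (b n) /\ b n = s * ps_const (u n) + T * b n.+1.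
  have bn : almost s d (b n).
    by elim: n => [|n /stE[_]]; rewrite ?b0 ?bE.
  by split=> //; have [] := stE _ bn; rewrite bE.
exists (u : powser D); apply/eqP; rewrite -subr_eq0; apply/eqP/ps_eq0_divX => n.
suff [r rE] : exists r, a = s * (u : powser D) + T ^+ n * r by exists r; rewrite rE addrC addKr.
pose tl n : powser D := fun i => u (i + n)%N.
suff aE : a = s * (u : powser D) + T ^+ n * (b n - s * tl n) by eexists; apply: aE.
elim: n => [|n IH].
  rewrite expr0 mul1r b0 (_ : tl 0%N = u); first by rewrite addrC subrK.
  by apply/funext => i; rewrite /tl addn0.
have tlE : tl n = ps_const (u n) + T * tl n.+1.
  rewrite {1}[tl n]ps_split; congr (_ + _ * _).
  by apply/funext => i; rewrite /tl /ps_tail addSnnS.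
by rewrite {1}IH (bS n).2 tlE exprS; ring.
Qed.

Lemma powser_cic : completely_integrally_closed (powser D).
Proof.
move=> s d a /ps_order[e [s' [-> s0]]] /ps_order[f [d' [-> d0]]] al.
have [->|/ps_order[g [a' [aE a0]]]] := EM (a = 0); first by exists 0; rewrite mulr0.
have a'n n : (d' * a' ^+ n) 0%N <> 0.
  by apply: coef0_neq0 => //; rewrite coef0_expr; apply: expr_neq0.
have alE n : exists r, T ^+ (f + g * n) * (d' * a' ^+ n) = T ^+ (e * n) * (s' ^+ n * r).
  have [r rE] := al n; exists r; transitivity (T ^+ f * d' * a ^+ n).
    by rewrite aE exprMn exprD exprM; ring.
  by rewrite rE exprMn exprM; ring.
have len n : (e * n <= f + g * n)%N.
  rewrite leqNgt; apply/negP => lt; have [r rE] := alE n.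
  have E : T ^+ (e * n) = T ^+ (f + g * n) * T ^+ (e * n - (f + g * n)).
    by rewrite -exprD subnKC // ltnW.
  apply: (a'n n); rewrite E -mulrA in rE.
  rewrite (TX_inj rE) coef_varXM leqn0 subn_eq0 leqNgt lt //.
(* At n = f + 1 the inequality e (f + 1) <= f + g (f + 1) already excludes e > g. *)
have le : (e <= g)%N by have := len f.+1; nia.
have [|u uE] := @almost_dvd s' d' (T ^+ (g - e) * a') s0 d0.
  move=> n; have [r rE] := alE n.
  have rE' : T ^+ f * (d' * (T ^+ (g - e) * a') ^+ n) = s' ^+ n * r.
    apply: (@TX_inj (e * n)); rewrite -rE exprMn -exprM.
    have -> : (f + g * n = e * n + f + (g - e) * n)%N by nia.
    by rewrite !exprD; ring.
  have [|r' r'E] := TX_dvd _ rE'; first by rewrite coef0_expr; apply: expr_neq0.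
  by exists r'; apply: (@TX_inj f); rewrite rE' r'E mulrCA.
exists u; rewrite aE -(subnKC le) exprD -!mulrA; congr (_ * _); exact: uE.
Qed.

End PowserCIC.

(** Dividing X^n by the monic equation of q writes q^n through powers q^i with i < m, so s^m clears
    the denominators of all q^n at once. *)
Lemma integral_denominator (A T : comNzRingType) (phi : {rmorphism A -> T}) q a s :
  injective phi -> phi s * q = phi a -> integralOver phi q ->
  exists m, forall n, exists b, s ^+ m * a ^+ n = s ^+ n * b.
Proof.
move=> inj sq [p mp /rootP pq]; pose m := size p; exists m => n.
have pn0 := monic_neq0 mp.
have := Pdiv.RingMonic.rdivp_eq mp 'X^n; set r := Pdiv.Ring.rmodp _ _ => E.
have szr : (size r < m)%N by apply: Pdiv.Ring.ltn_rmodpN0.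
have qn : q ^+ n = (map_poly phi r).[q].
  have := congr1 (fun f => (map_poly phi f).[q]) E.
  by rewrite /= map_polyXn hornerXn rmorphD rmorphM hornerD hornerM pq mulr0 add0r.
pose b := \sum_(i < size r) r`_i * s ^+ (m - i) * a ^+ i; exists b.
apply: (inj); rewrite !rmorphM !rmorphXn -sq exprMn [phi b]rmorph_sum.
rewrite qn horner_coef mulrCA; congr (_ * _).
rewrite mulr_sumr (size_map_inj_poly inj (rmorph0 phi)); apply: eq_bigr => i _.
rewrite coef_map !rmorphM !rmorphXn -sq exprMn -{1}(subnK (_ : i <= m)%N) ?exprD; last first.
  by apply: ltnW; apply: leq_trans szr; apply: ltnW; apply: ltn_ord.
by rewrite /=; ring.
Qed.

Lemma quad_mod_pair (P A : comNzRingType) (io : {rmorphism P -> A}) (z : A) (x y : P)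
    (M : lmodType A) (m0 m1 : M) :
  z *: m0 = io x *: m1 -> z *: m1 = io (x * y) *: m0 ->
  (forall p q, io p *: m0 + io q *: m1 = 0 -> p = 0 /\ q = 0) ->
  (forall m, exists p q, m = io p *: m0 + io q *: m1) ->
  quad_mod io z M (x *: mxK y).
Proof.
move=> z0 z1 un gen.
exists (fun u => io (usubmx u 0 0) *: m0 + io (dsubmx u 0 0) *: m1); split=> [u v|p u|u|u|m].
- by rewrite !mxE !rmorphD !scalerDl addrACA.
- by rewrite !mxE !rmorphM scalerDr !scalerA.
- have -> : x *: mxK y *m u = col_mx ((x * y) *: dsubmx u) (x *: usubmx u).
    rewrite -[u in LHS]vsubmxK -scalemxAl mul_block_col !mul0mx add0r addr0 mul1mx mul_scalar_mx.
    by rewrite scale_col_mx scalerA.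
  rewrite col_mxKu col_mxKd; have ZE (c : P) (w : 'cV[P]_1) : (c *: w) 0 0 = c * w 0 0 by rewrite mxE.
  rewrite !ZE scalerDr !scalerA ![z * _]mulrC -!scalerA z0 z1 !scalerA addrC.
  by rewrite -!rmorphM; congr (io _ *: _ + io _ *: _); ring.
- move=> /un[u0 d0]; rewrite -[u]vsubmxK [usubmx u]mx11_scalar u0.
  by rewrite [dsubmx u]mx11_scalar d0 raddf0 col_mx0.
have [p [q ->]] := gen m; exists (col_mx p%:M q%:M).
by rewrite col_mxKu col_mxKd !mxE eqxx !mulr1n.
Qed.

Section FractionField.
Variable A : comNzRingType.
Hypothesis domA : no_zero_div A.
Local Notation phi := (to_frac A).
Local Notation nzd := (MultSet (@nonzerodiv1 A) (@nonzerodivM A) (@nonzerodiv0 A)).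

Let den s (Ss : nonzerodiv s) : {s : A | nzd s} := exist (fun s => nzd s) s Ss.

Lemma nonzerodiv_neq0 (a : A) : a <> 0 -> nonzerodiv a.
Proof. by move=> a0; apply/asboolP => b /domA[]. Qed.

Lemma to_frac_inj : injective phi.
Proof.
move=> a b /mkfracP[u /asboolP reg]; rewrite /= !scale1r => e.
apply/eqP; rewrite -subr_eq0; apply/eqP/reg; rewrite mulrBr.
by apply/eqP; rewrite subr_eq0; apply/eqP; apply: e.
Qed.

Lemma to_frac_cancel (s : A) q q' : s <> 0 -> phi s * q = phi s * q' -> q = q'.
Proof.
move=> /nonzerodiv_neq0 Ss e.
have inv : phi s * (mkfrac (1 : A^o) (den Ss) : total_frac A) = 1.
  rewrite -[LHS]/(loc_mul _ _) loc_mulE; apply: mkfracr_eq; rewrite /=; ring.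
by rewrite -[q]mul1r -inv mulrAC e mulrAC inv mul1r.
Qed.

Lemma to_frac_ex (q : total_frac A) : exists a s, s <> 0 /\ phi s * q = phi a.
Proof.
elim/mkfrac_ind: q => a [s Ss]; exists a, s; split.
  by move=> s0; move/asboolP: Ss => /(_ 1); rewrite s0 mul0r => /(_ erefl)/eqP; rewrite oner_eq0.
by rewrite -[LHS]/(loc_mul _ _) loc_mulE; apply: mkfracr_eq; rewrite /=; ring.
Qed.

Lemma to_frac_div (a s : A) : s <> 0 -> exists q, phi s * q = phi a.
Proof.
move=> /nonzerodiv_neq0 Ss; exists (mkfrac (a : A^o) (den Ss)).
by rewrite -[LHS]/(loc_mul _ _) loc_mulE; apply: mkfracr_eq; rewrite /=; ring.
Qed.

End FractionField.

Section DinfNormalization.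
Variable k : closedFieldType.
Local Notation A := (dinf_ring k).
Local Notation P := (powser (powser k)).
Local Notation io := (dinf_of (k := k) : {rmorphism powser (powser k) -> dinf_ring k}).
Local Notation z := (dinf_z k).
Local Notation X := (dinf_x k).
Local Notation Y := (dinf_y k).
Local Notation phi := (to_frac A).
Local Notation qe := (dinf_quad_ext k).

Lemma io_X_neq0 : io X <> 0.
Proof.
move=> e; apply: (@X_neq0 k); apply: (io_inj qe).
by rewrite rmorph0; exact: e.
Qed.

Lemma ps2_cic : completely_integrally_closed P.
Proof.
apply: powser_cic; first exact: ps_field_no_zero_div.
by apply: powser_cic; [exact: fieldT_no_zero_div | exact: field_cic].
Qed.

(** In k[[x,t]], which is completely integrally closed, s divides a with a quotient R. The even and
    odd parts of R in t, together with t = z/x, give the two coefficients. *)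
Lemma dinf_integral_closure (q t : total_frac A) : phi (io X) * t = phi z ->
  integralOver phi q -> exists p r, q = phi (io p) + phi (io r) * t.
Proof.
move=> tE iq; have [a [s [s0 sq]]] := to_frac_ex q.
have [m mE] := integral_denominator (to_frac_inj (A := A)) sq iq.
have [emb embE] := quad_emb qe; have embI := quad_emb_inj embE.
have es : emb s <> 0 by move/embI.
have esm : emb s ^+ m <> 0.
  elim: (m) => [|i IH]; first by rewrite expr0; apply/eqP/oner_neq0.
  by rewrite exprS => /(@ps2_no_zero_div k)[].
have [|R RE] := @ps2_cic (emb s) (emb s ^+ m) (emb a) es esm.
  by move=> n; have [b bE] := mE n; exists (emb b); rewrite -!rmorphXn -!rmorphM bE.
pose p := ps_even R; pose r := ps_odd R; exists p, r.
have key : io X * a = s * (io (X * p) + io r * z).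
  have eX : emb (io X) = ps_dbl X.
    by rewrite embE (qx_io qe X).1 (qx_io qe X).2 rmorph0 mul0r addr0.
  have ez : emb (io (X * p) + io r * z) = ps_dbl (X * p) + ps_dbl r * (X * ps_var).
    by rewrite embE (qxP qe _ _).1 (qxP qe _ _).2.
  apply/eqP; rewrite -subr_eq0; apply/eqP/embI.
  rewrite rmorphB [emb (_ * a)]rmorphM [emb (s * _)]rmorphM ez eX RE [R]ps_dblK -/p -/r.
  have XE : ps_dbl X = X by exact: ps_dbl_const.
  have Mp : ps_dbl (X * p) = X * ps_dbl p by rewrite rmorphM -[in RHS]XE.
  by rewrite Mp XE; ring.
apply: (@to_frac_cancel _ (@dinf_no_zero_div k) (s * io X)).
  by case/(@dinf_no_zero_div k) => // /io_X_neq0.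
rewrite [phi (s * io X)]rmorphM mulrAC sq.
have -> : phi a * phi (io X) = phi (s * (io (X * p) + io r * z)) by rewrite -key rmorphM mulrC.
have ioM : io (X * p) = io X * io p by exact: rmorphM.
rewrite [LHS]rmorphM [phi (_ + _)]rmorphD ioM [phi (io X * _)]rmorphM [phi (io r * z)]rmorphM.
by rewrite -[phi z]tE; ring.
Qed.

(** The normalization has basis 1, t = z/x over k[[x,y]], t being integral as t^2 = y. There z 1 = x
    t and z t = x y, which is the matrix of alpha. *)
Lemma normalization_quad_mod : quad_mod io z (normalization A) (Z_alpha k).
Proof.
rewrite /Z_alpha lattice_one map_mxK injY_var.
have [t tE] := to_frac_div (@dinf_no_zero_div k) z io_X_neq0.
have tt : t ^+ 2 = phi (io Y).
  apply: (@to_frac_cancel _ (@dinf_no_zero_div k) (io X ^+ 2)).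
    by rewrite expr2; case/(@dinf_no_zero_div k) => /io_X_neq0.
  rewrite -[RHS]rmorphM -dinf_zz [phi (z ^+ 2)]rmorphXn -[phi z]tE exprMn.
  by rewrite [phi (io X ^+ 2)]rmorphXn.
have it : int_closure t.
  apply/asboolP; exists ('X^2 - (io Y)%:P); first exact: monicXnsubC.
  rewrite rmorphB /= map_polyXn map_polyC /= /root hornerD hornerN hornerXn hornerC.
  by rewrite tt subrr.
pose T : normalization A := exist _ t it.
have valZ (a : A) (r : normalization A) : val (a *: r) = phi a * val r by [].
apply: (@quad_mod_pair _ _ io z X Y (normalization A) (1 : normalization A) T).
- by apply: val_inj; rewrite !valZ /= mulr1 tE.
- apply: val_inj; rewrite !valZ /= mulr1 -tE -mulrA -expr2 tt -rmorphM -rmorphM //.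
- move=> p q /(congr1 val); rewrite /= mulr1 => e.
  have: phi (io (X * p) + io q * z) = phi 0.
    rewrite rmorphD !rmorphM rmorph0 -tE.
    transitivity (phi (io X) * (phi (io p) + phi (io q) * t)); first by ring.
    by rewrite e mulr0.
  move/(to_frac_inj (A := A)) => e0; case: (qe) => _ _ /(_ _ _ e0)[/X_mul_inj ? ?].
  by [].
move=> [q iq]; move/asboolP: (iq) => /(dinf_integral_closure tE)[p [r qE]].
by exists p, r; apply: val_inj; rewrite /= mulr1 qE.
Qed.

End DinfNormalization.

(** * Conclusion *)

Section Factorizations.
Variables (R : comNzRingType) (x y z : R).

Lemma alpha_factorization :
  matrix_factorization (x ^+ 2 * y - z ^+ 2) (alpha_rows x y z) (alpha_rows x y (- z)).
Proof. by split; mx2_entries. Qed.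

Lemma beta_factorization :
  matrix_factorization (x ^+ 2 * y - z ^+ 2) (betaP_rows x y z) (betaM_rows x y z).
Proof. by split; mx2_entries. Qed.

Lemma gamma_factorization m :
  matrix_factorization (x ^+ 2 * y - z ^+ 2) (gamma_rows x y z m) (gamma_rows x y (- z) m).
Proof.
rewrite /matrix_factorization /gamma_rows; move: (y ^+ m) (exprS y m) => ym ->.
by split; mx4_entries.
Qed.

Lemma delta_factorization m :
  matrix_factorization (x ^+ 2 * y - z ^+ 2) (delta_rows x y z m) (delta_rows x y (- z) m).
Proof. by split; mx4_entries. Qed.

End Factorizations.

Lemma quad_mod_indec_size (k : closedFieldType) (M : lmodType (dinf_ring k)) n
    (Z : 'M[powser (powser k)]_n) :
  indecomposable M -> quad_mod (dinf_of (k := k)) (dinf_z k) M Z -> exists m, n = m.+1.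
Proof.
case: n Z => [|n] Z [[x x0] _] [e b]; last by exists n.
have [u ux] := qb_surj b x; case/eqP: x0.
by rewrite -ux (flatmx0 u) -[in LHS](flatmx0 0) (qb0 b).
Qed.

Lemma dinf_classification (k : closedFieldType) (M : lmodType (dinf_ring k)) :
  indec_nonfree_cm M ->
  [\/ mod_iso M (mf_module (alphaP k) (alphaM k)),
      mod_iso M (mf_module (betaP k) (betaM k)),
      (exists m : nat, (1 <= m)%N /\ mod_iso M (mf_module (gammaP k m) (gammaM k m))) |
      (exists m : nat, (1 <= m)%N /\ mod_iso M (mf_module (deltaP k m) (deltaM k m)))].
Proof.
move=> [/cohen_macaulay_quad_mod[n [Z qM]] indM nf].
have [m nE] := quad_mod_indec_size indM qM; subst n.
have Z0 i j : Z i j 0%N 0%N = 0.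
  by apply: contrapT => Zij; apply: nf; apply: (quad_mod_free indM qM Zij).
case: (quad_mod_trichotomy (alpha_pres_quad_mod k) (beta_pres_quad_mod k)
         (fun a => gd_pres_quad_mod k a.+2) indM Z0 qM) => [H|H|[a H]].
- by apply: Or41; apply: mod_iso_trans H (mod_iso_sym (mf_alphaP k)).
- by apply: Or42; apply: mod_iso_trans H (mod_iso_sym (mf_betaP k)).
(* Even exponents belong to delta and odd ones to gamma; an exponent at least 2 makes the index m'
   positive. *)
have [m' [m'0 aE]] : exists m', (0 < m')%N /\ (a.+2 = m'.*2.+1 \/ a.+2 = m'.*2).
  by exists a./2.+1; split; last by lia.
case: aE => aE.
  apply: Or43; exists m'; split; first exact: m'0.
  by have := mod_iso_sym (mf_gammaP k m'); rewrite -aE; apply: mod_iso_trans.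
apply: Or44; exists m'; split; first exact: m'0.
by have := mod_iso_sym (mf_deltaP k m'); rewrite -aE; apply: mod_iso_trans.
Qed.

Section DinfSummands.
Variable k : closedFieldType.

Lemma mf_alpha_module : indec_nonfree_cm (mf_module (alphaP k) (alphaM k)).
Proof. exact: Z_alpha_module (quad_mod_transport (mf_alphaP k) (alpha_pres_quad_mod k)). Qed.

Lemma mf_beta_module : indec_nonfree_cm (mf_module (betaP k) (betaM k)).
Proof. exact: Z_beta_module (quad_mod_transport (mf_betaP k) (beta_pres_quad_mod k)). Qed.

Lemma mf_gamma_module m : indec_nonfree_cm (mf_module (gammaP k m.+1) (gammaM k m.+1)).
Proof.
exact: (@Z_gd_module k m.*2.+1) (quad_mod_transport (mf_gammaP k m.+1) (gd_pres_quad_mod k _)).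
Qed.

Lemma mf_delta_module m : indec_nonfree_cm (mf_module (deltaP k m.+1) (deltaM k m.+1)).
Proof.
exact: (@Z_gd_module k m.*2) (quad_mod_transport (mf_deltaP k m.+1) (gd_pres_quad_mod k _)).
Qed.

Lemma mf_alpha_normalization :
  mod_iso (mf_module (alphaP k) (alphaM k)) (normalization (dinf_ring k)).
Proof.
have qM := quad_mod_transport (mf_alphaP k) (alpha_pres_quad_mod k).
exact: (quad_mod_iso (dinf_quad_ext k) qM (normalization_quad_mod k)).
Qed.

End DinfSummands.


Theorem theorem5p7 (k : closedFieldType) :
  let A := dinf_ring k in
  let f := dinf_eq k in
  let Malpha := mf_module (alphaP k) (alphaM k) in
  let Malpha' := mf_module (alphaM k) (alphaP k) in
  let Mbeta := mf_module (betaP k) (betaM k) in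
  let Mbeta' := mf_module (betaM k) (betaP k) in
  let Mgamma m := mf_module (gammaP k m) (gammaM k m) in
  let Mgamma' m := mf_module (gammaM k m) (gammaP k m) in
  let Mdelta m := mf_module (deltaP k m) (deltaM k m) in
  let Mdelta' m := mf_module (deltaM k m) (deltaP k m) in
  [/\ matrix_factorization f (alphaP k) (alphaM k),
      matrix_factorization f (betaP k) (betaM k),
      (forall m : nat, (1 <= m)%N ->
         matrix_factorization f (gammaP k m) (gammaM k m)) &
      (forall m : nat, (1 <= m)%N ->
         matrix_factorization f (deltaP k m) (deltaM k m))] /\
  [/\ indec_nonfree_cm Malpha,
      indec_nonfree_cm Mbeta,
      (forall m : nat, (1 <= m)%N -> indec_nonfree_cm (Mgamma m)) &
      (forall m : nat, (1 <= m)%N -> indec_nonfree_cm (Mdelta m))] /\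
  (forall M : lmodType A, indec_nonfree_cm M ->
     [\/ mod_iso M Malpha,
         mod_iso M Mbeta,
         (exists m : nat, (1 <= m)%N /\ mod_iso M (Mgamma m)) |
         (exists m : nat, (1 <= m)%N /\ mod_iso M (Mdelta m))]) /\
  mod_iso Malpha (normalization A) /\
  [/\ mod_iso Malpha Malpha',
      mod_iso Mbeta Mbeta',
      (forall m : nat, (1 <= m)%N -> mod_iso (Mgamma m) (Mgamma' m)) &
      (forall m : nat, (1 <= m)%N -> mod_iso (Mdelta m) (Mdelta' m))] /\
  [/\ locally_free_punctured Mbeta,
      (forall m : nat, (1 <= m)%N -> locally_free_punctured (Mgamma m)) &
      (forall m : nat, (1 <= m)%N -> locally_free_punctured (Mdelta m))].
Proof.
split; first split=> [||m _|m _].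
- exact: alpha_factorization.
- exact: beta_factorization.
- exact: gamma_factorization.
- exact: delta_factorization.
split; first split=> [||[//|m] _|[//|m] _].
- exact: mf_alpha_module.
- exact: mf_beta_module.
- exact: mf_gamma_module.
- exact: mf_delta_module.
split; first exact: dinf_classification.
split; first exact: mf_alpha_normalization.
split.
  split=> [||m _|m _].
  - exact: mod_iso_trans (mf_alphaP k) (mod_iso_sym (mf_alphaM k)).
  - exact: mod_iso_trans (mf_betaP k) (mod_iso_sym (mf_betaM k)).
  - exact: mod_iso_trans (mf_gammaP k m) (mod_iso_sym (mf_gammaM k m)).
  - exact: mod_iso_trans (mf_deltaP k m) (mod_iso_sym (mf_deltaM k m)).
split=> [|m _|m _].
- exact: mf_beta_locally_free.
- exact: mf_gamma_locally_free.
- exact: mf_delta_locally_free.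
Qed.
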